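(* Let $W\in\{0,1,2,\dots\}$. (i) Let $P$ be an odd prime and $m$ a positive integer with either ($P\ge5$ and $m\ge 2$) or ($P\ge 3$ and $m\ge 3$); let $q=P^m$. Then there exist at least two $(q+W-6)$-dimensional orbifold lens spaces with groups of order $P^m$ which are isospectral but not isometric. (ii) Let $P_1\ne P_2$ be odd primes with $q=P_1P_2\ge 33$. Then there exist at least two $(q+W-6)$-dimensional orbifold lens spaces with groups of order $P_1P_2$ which are isospectral but not isometric. (iii) Let $q=2^m$ with $m\ge 6$. Then there exist at least two $(q+W-5)$-dimensional orbifold lens spaces with groups of order $2^m$ which are isospectral but not isometric. (iv) Let $q=2P$ with $P\ge 7$ an odd prime. Then there exist at least two $(q+W-5)$-dimensional orbifold lens spaces with groups of order $2P$ which are isospectral but not isometric.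
   Context: Let $R(\theta)=\begin{pmatrix}\cos 2\pi\theta & \sin 2\pi\theta\\ -\sin 2\pi\theta & \cos 2\pi\theta\end{pmatrix}$. For integers $q\ge 2$, $n\ge1$, $W\ge 0$ and integers $p_1,\dots,p_n$ with $\gcd(p_1,\dots,p_n,q)=1$, let $g=\mathrm{diag}(R(p_1/q),\dots,R(p_n/q),I_W)\in O(2n+W)$ ($I_W$ the $W\times W$ identity) and $G=\langle g\rangle$, cyclic of order $q$ (the group of the lens space). The orbifold lens space $L^{(W)}(q:p_1,\dots,p_n)=S^{2n+W-1}/G$, where $S^{2n+W-1}$ is the round unit sphere, is a $(2n+W-1)$-dimensional Riemannian orbifold with the induced metric; the $p_i$ need not be coprime to $q$, so $G$ may have fixed points. Its spectrum is the spectrum (with multiplicities) of the Laplacian acting on $G$-invariant smooth functions on the sphere; isospectral means equal spectra. In this theorem ''orbifold lens space'' means a space $L^{(W)}(q:p_1,\dots,p_n)$ of this form. *)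

(* Defs.v *)
From Stdlib Require Import Reals Lra Lia ZArith Arith List Znumtheory.
Open Scope R_scope.

(** Points of R^d are encoded as [nat -> R]; a point of R^d has all
    coordinates of index >= d equal to 0. *)
Definition pt := nat -> R.

Fixpoint sumR (d : nat) (f : nat -> R) : R :=
  match d with O => 0 | S d' => sumR d' f + f d' end.

Definition norm2 (d : nat) (x : pt) : R := sumR d (fun i => x i ^ 2).

Definition on_sphere (d : nat) (x : pt) : Prop :=
  (forall i, (d <= i)%nat -> x i = 0) /\ norm2 d x = 1.

Record lens := Lens { lq : nat; lps : list Z; lW : nat }.
Definition ln (L : lens) : nat := length (lps L).
Definition lamb (L : lens) : nat := (2 * ln L + lW L)%nat.
Definition ldim (L : lens) : nat := (lamb L - 1)%nat.

Definition lens_wf (L : lens) : Prop :=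
  (2 <= lq L)%nat /\ (1 <= ln L)%nat /\
  fold_left Z.gcd (lps L) (Z.of_nat (lq L)) = 1%Z.

Definition lang (L : lens) (k i : nat) : R :=
  2 * PI * (IZR (Z.of_nat k * nth i (lps L) 0%Z) / INR (lq L)).

(** action of g^k, g = diag(R(p_1/q),...,R(p_n/q),I_W), with
    R(t) = [[cos 2 pi t, sin 2 pi t],[-sin 2 pi t, cos 2 pi t]] *)
Definition lact (L : lens) (k : nat) (x : pt) : pt :=
  fun j =>
    if (j <? 2 * ln L)%nat then
      let a := lang L k (j / 2) in
      if Nat.even j then cos a * x j + sin a * x (S j)
      else - sin a * x (pred j) + cos a * x j
    else x j.

Definition invariant (L : lens) (F : pt -> R) : Prop :=
  forall k x, on_sphere (lamb L) x -> F (lact L k x) = F x.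

Definition normalize (d : nat) (y : pt) : pt :=
  fun j => if (j <? d)%nat then y j / sqrt (norm2 d y) else 0.
Definition ext (d : nat) (F : pt -> R) : pt -> R := fun y => F (normalize d y).

Definition inU (d : nat) (y : pt) : Prop :=
  (forall j, (d <= j)%nat -> y j = 0) /\ 0 < norm2 d y.

Definition shift (y : pt) (i : nat) (t : R) : pt :=
  fun j => if Nat.eqb j i then y j + t else y j.

Definition partial_on (d : nat) (F : pt -> R) (i : nat) (G : pt -> R) : Prop :=
  forall y, inU d y -> derivable_pt_lim (fun t => F (shift y i t)) 0 (G y).

Definition cont_on (d : nat) (F : pt -> R) : Prop :=
  forall y, inU d y -> forall eps, 0 < eps -> exists delta, 0 < delta /\
    forall z, inU d z -> norm2 d (fun j => z j - y j) < delta ^ 2 ->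
      Rabs (F z - F y) < eps.

Fixpoint Cn (d n : nat) (F : pt -> R) : Prop :=
  match n with
  | O => cont_on d F
  | S n' => cont_on d F /\
      forall i, (i < d)%nat -> exists G, partial_on d F i G /\ Cn d n' G
  end.

Definition smooth_sph (d : nat) (F : pt -> R) : Prop := forall n, Cn d n (ext d F).

(** Laplace-Beltrami of S^{d-1}: Delta_S F (x) = (Euclidean Laplacian of
    ext d F)(x) for x on the sphere; eigen-equation Delta_S F = - lam F. *)
Definition lap_eigen (d : nat) (F : pt -> R) (lam : R) : Prop :=
  forall x, on_sphere d x ->
    exists (G : nat -> pt -> R) (h : nat -> R),
      (forall i, (i < d)%nat ->
         partial_on d (ext d F) i (G i) /\
         derivable_pt_lim (fun t => G i (shift x i t)) 0 (h i)) /\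
      sumR d h = - lam * F x.

Definition eigenfun (L : lens) (lam : R) (F : pt -> R) : Prop :=
  smooth_sph (lamb L) F /\ invariant L F /\ lap_eigen (lamb L) F lam.

Definition mult_ge (L : lens) (lam : R) (m : nat) : Prop :=
  exists Fs : nat -> pt -> R,
    (forall j, (j < m)%nat -> eigenfun L lam (Fs j)) /\
    (forall c : nat -> R,
       (forall x, on_sphere (lamb L) x -> sumR m (fun j => c j * Fs j x) = 0) ->
       forall j, (j < m)%nat -> c j = 0).

Definition isospectral (L1 L2 : lens) : Prop :=
  forall lam m, mult_ge L1 lam m <-> mult_ge L2 lam m.

Definition sdist (d : nat) (x y : pt) : R := acos (sumR d (fun i => x i * y i)).

Definition qdist (L : lens) (x y : pt) : R :=
  fold_right Rmin (sdist (lamb L) x y)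
    (map (fun k => sdist (lamb L) x (lact L k y)) (seq 1 (lq L - 1))).

(** isometry between the orbit spaces (as metric spaces), given by a map
    of representatives: distance preserving and surjective on orbits *)
Definition isometric (L1 L2 : lens) : Prop :=
  exists phi : pt -> pt,
    (forall x, on_sphere (lamb L1) x -> on_sphere (lamb L2) (phi x)) /\
    (forall y, on_sphere (lamb L2) y ->
       exists x, on_sphere (lamb L1) x /\ qdist L2 (phi x) y = 0) /\
    (forall x y, on_sphere (lamb L1) x -> on_sphere (lamb L1) y ->
       qdist L2 (phi x) (phi y) = qdist L1 x y).

Definition iso_noniso_pair (q dim : nat) (L1 L2 : lens) : Prop :=
  lens_wf L1 /\ lens_wf L2 /\ lq L1 = q /\ lq L2 = q /\
  ldim L1 = dim /\ ldim L2 = dim /\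
  isospectral L1 L2 /\ ~ isometric L1 L2.

(* Main.v *)
(** An eigenfunction of the sphere, extended with the right homogeneity degree [t >= 0], is a
    harmonic function; its partial derivatives of large order are harmonic of negative degree, hence
    vanish by a maximum principle, so that the extension is a polynomial.  Thus the multiplicity of
    the [k]-th eigenvalue of a quotient is the dimension of the space of invariant harmonic
    polynomials of degree [k].  In the complex coordinates which diagonalize the group, such a
    polynomial is determined by its coefficients at the invariant monomials not divisible by
    [z_1 * conj z_1], and these can be prescribed; so the spectrum depends only on the number of
    invariant monomials of each degree.

    Let the weights of a lens space be all of [1, ..., q / 2] except [1] and [b].  If [1 + b] and
    [1 - b] are units modulo [q], inclusion-exclusion expresses the number of invariant monomials by
    the numbers of monomials of weights [0], [1] and [b] for the full list [1, ..., q / 2].  The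
    latter only depend on the orbits of these weights under the units, so that [b] may be replaced
    by [u * b] for a unit [u].

    An isometry of two quotients agrees, near a point with trivial isotropy, with an orthogonal
    matrix up to the groups, and this matrix conjugates one group to the other.  Comparing the
    eigenvalues of the generators, the lens spaces given by [b] and [u * b] are not isometric when
    [b] is not a unit and [u * b] is neither [b] nor [- b].  The pairs [(b, u)] are: [(P, 2)] for
    [P ^ m]; [b] congruent to [0] modulo [P1] and to [2] modulo [P2], and [u = 2], for [P1 * P2] with
    [P1 < P2]; [(2, 3)] for [2 ^ m]; [(2, P + 2)] for [2 * P]. *)

Require Import Defs.
From Stdlib Require Import Reals ZArith Arith List Znumtheory.
From Stdlib Require Import Lra Lia Psatz FunctionalExtensionality ClassicalEpsilon.
From Stdlib Require Import FinFun Permutation Zpow_facts.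
From Coquelicot Require Import Coquelicot.
From mathcomp Require all_boot all_order all_algebra classical_sets reals ring lra Rstruct.
Import Defs.
Open Scope R_scope.

(** * Smooth functions on the punctured space *)

(** The dimension comes from keeping all but two of the $\lfloor q/2 \rfloor$ weights: the sphere
    lies in a real space of dimension $2 (\lfloor q/2 \rfloor - 2) + W$, so its own dimension is $q
    + W - 6$ for odd $q$ and $q + W - 5$ for even $q$. Removing the weights $\pm 1, \pm b$
    introduces only the residues $0, \pm 1, \pm b, \pm 1 \pm b$, and the hypothesis on $1 \pm b$
    moves the last four into the orbit of $1$ under the units. That $b$ is not a unit distinguishes
    it from $1$ among the missing weights, so that an isometry cannot exchange the two. The delicate
    point is the isometry itself: it is a bare map of representatives, without continuity or
    equivariance, and the groups may have fixed points, so no covering argument applies. All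
    information is drawn from inequalities between inner products of a point with the points of an
    orbit. *)

Lemma sumR_ext (d : nat) (f g : nat -> R) :
  (forall i, (i < d)%nat -> f i = g i) -> sumR d f = sumR d g.
Proof.
  induction d as [|d IH]; intros H; simpl; auto.
  rewrite IH by (intros; apply H; lia). rewrite H by lia. reflexivity.
Qed.

Lemma sumR_plus (d : nat) (f g : nat -> R) :
  sumR d (fun i => f i + g i) = sumR d f + sumR d g.
Proof. induction d as [|d IH]; simpl; [lra|]. rewrite IH; lra. Qed.

Lemma sumR_scal (d : nat) (c : R) (f : nat -> R) :
  sumR d (fun i => c * f i) = c * sumR d f.
Proof. induction d as [|d IH]; simpl; [lra|]. rewrite IH; lra. Qed.

Lemma sumR_0 (d : nat) (f : nat -> R) :
  (forall i, (i < d)%nat -> f i = 0) -> sumR d f = 0.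
Proof.
  induction d as [|d IH]; intros H; simpl; auto.
  rewrite IH by (intros; apply H; lia). rewrite H by lia. lra.
Qed.

Lemma sumR_const (d : nat) (c : R) : sumR d (fun _ => c) = INR d * c.
Proof. induction d as [|d IH]; [simpl; lra|]. simpl sumR. rewrite IH, S_INR; lra. Qed.

Lemma sumR_le (d : nat) (f g : nat -> R) :
  (forall i, (i < d)%nat -> f i <= g i) -> sumR d f <= sumR d g.
Proof.
  induction d as [|d IH]; intros H; simpl; [lra|].
  apply Rplus_le_compat; [apply IH; intros; apply H | apply H]; lia.
Qed.

Lemma sumR_indic (d i : nat) (f : nat -> R) (a : R) :
  sumR d (fun j => f j + (if Nat.eqb j i then a else 0)) =
  sumR d f + (if (i <? d)%nat then a else 0).
Proof.
  induction d as [|d IH]; simpl sumR.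
  - simpl. lra.
  - rewrite IH.
    destruct (Nat.eqb_spec d i); destruct (Nat.ltb_spec i d);
      destruct (Nat.ltb_spec i (S d)); try lia; lra.
Qed.

Lemma sumR_term_le (d i : nat) (f : nat -> R) :
  (forall j, (j < d)%nat -> 0 <= f j) -> (i < d)%nat -> f i <= sumR d f.
Proof.
  induction d as [|d IH]; intros H Hi; [lia|]. simpl.
  assert (0 <= sumR d f).
  { rewrite <- (sumR_0 d (fun _ => 0)) by auto. apply sumR_le. intros; apply H; lia. }
  destruct (Nat.eq_dec i d) as [->|]; [lra|].
  assert (f i <= sumR d f) by (apply IH; [intros; apply H|]; lia).
  specialize (H d ltac:(lia)). lra.
Qed.

Lemma norm2_nonneg (d : nat) (x : pt) : 0 <= norm2 d x.
Proof.
  unfold norm2. rewrite <- (sumR_0 d (fun _ => 0)) by auto.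
  apply sumR_le; intros; apply pow2_ge_0.
Qed.

Lemma norm2_ge_coord (d i : nat) (x : pt) : (i < d)%nat -> x i ^ 2 <= norm2 d x.
Proof.
  intros Hi. unfold norm2.
  apply (sumR_term_le d i (fun i => x i ^ 2)); auto. intros; apply pow2_ge_0.
Qed.

Lemma norm2_shift (d i : nat) (y : pt) (t : R) : (i < d)%nat ->
  norm2 d (shift y i t) = norm2 d y + 2 * t * y i + t ^ 2.
Proof.
  intros Hi. unfold norm2, shift.
  rewrite (sumR_ext d _ (fun j => y j ^ 2 + (if Nat.eqb j i then 2 * t * y i + t ^ 2 else 0))).
  - rewrite sumR_indic. destruct (Nat.ltb_spec i d); [lra|lia].
  - intros j _. destruct (Nat.eqb_spec j i); subst; ring.
Qed.

Lemma shift_0 (y : pt) (i : nat) : shift y i 0 = y.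
Proof.
  apply functional_extensionality; intros j; unfold shift.
  destruct (Nat.eqb j i); lra.
Qed.

Lemma shift_shift (y : pt) (i : nat) (s t : R) : shift (shift y i s) i t = shift y i (s + t).
Proof.
  apply functional_extensionality; intros j; unfold shift.
  destruct (Nat.eqb j i); lra.
Qed.

Lemma inU_nonzero (d : nat) (y : pt) : inU d y -> exists i, (i < d)%nat /\ y i <> 0.
Proof.
  intros [_ H]. apply NNPP. intros Hn.
  unfold norm2 in H. rewrite sumR_0 in H; [lra|].
  intros i Hi. destruct (Req_dec (y i) 0) as [->|Hy]; [ring|].
  exfalso; apply Hn; eauto.
Qed.

Lemma inU_intro (d i : nat) (y : pt) :
  (forall j, (d <= j)%nat -> y j = 0) -> (i < d)%nat -> y i <> 0 -> inU d y.
Proof.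
  intros H Hi Hy. split; auto.
  apply Rlt_le_trans with (y i ^ 2); [nra | apply norm2_ge_coord; auto].
Qed.

Lemma sphere_inU (d : nat) (x : pt) : on_sphere d x -> inU d x.
Proof. intros [H1 H2]; split; auto. lra. Qed.

Lemma coord_close (d i : nat) (z y : pt) (delta : R) : 0 < delta -> (i < d)%nat ->
  norm2 d (fun j => z j - y j) < delta ^ 2 -> Rabs (z i - y i) < delta.
Proof.
  intros Hd Hi H.
  assert ((z i - y i) ^ 2 < delta ^ 2).
  { eapply Rle_lt_trans; [|apply H]. apply (norm2_ge_coord d i (fun j => z j - y j) Hi). }
  apply Rabs_def1; nra.
Qed.

Lemma inU_open (d : nat) (y : pt) : inU d y -> exists rho, 0 < rho /\
  forall z, (forall j, (d <= j)%nat -> z j = 0) ->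
    norm2 d (fun j => z j - y j) < rho ^ 2 -> inU d z.
Proof.
  intros Hy. destruct (inU_nonzero d y Hy) as [i [Hi Hn]].
  exists (Rabs (y i)). split; [apply Rabs_pos_lt; auto|].
  intros z Hz Hc. apply (inU_intro d i); auto.
  intros Hzi. pose proof (coord_close d i z y (Rabs (y i)) (Rabs_pos_lt _ Hn) Hi Hc) as H.
  rewrite Hzi in H. rewrite Rminus_0_l, Rabs_Ropp in H. lra.
Qed.

Lemma norm2_shift_diff (d i : nat) (y : pt) (t : R) : (i < d)%nat ->
  norm2 d (fun j => shift y i t j - y j) = t ^ 2.
Proof.
  intros Hi. unfold norm2, shift.
  rewrite (sumR_ext d _ (fun j => 0 + (if Nat.eqb j i then t ^ 2 else 0))).
  - rewrite sumR_indic, sumR_0 by auto. destruct (Nat.ltb_spec i d); [lra|lia].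
  - intros j _. destruct (Nat.eqb_spec j i); subst; ring.
Qed.

Lemma shift_zero_out (d i : nat) (y : pt) (t : R) : (i < d)%nat ->
  (forall j, (d <= j)%nat -> y j = 0) -> forall j, (d <= j)%nat -> shift y i t j = 0.
Proof.
  intros Hi H j Hj. unfold shift. destruct (Nat.eqb_spec j i); [lia|auto].
Qed.

Lemma inU_shift (d i : nat) (y : pt) : (i < d)%nat -> inU d y ->
  exists rho, 0 < rho /\ forall t, Rabs t < rho -> inU d (shift y i t).
Proof.
  intros Hi Hy. destruct (inU_open d y Hy) as [rho [Hr H]].
  exists rho. split; auto. intros t Ht. apply H.
  - apply shift_zero_out; auto. apply Hy.
  - rewrite norm2_shift_diff by auto. apply Rabs_def2 in Ht. nra.
Qed.

Lemma dpl_ext_loc (f g : R -> R) (x l rho : R) : 0 < rho ->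
  (forall t, Rabs (t - x) < rho -> f t = g t) ->
  derivable_pt_lim f x l -> derivable_pt_lim g x l.
Proof.
  intros Hr H Hf eps He. destruct (Hf eps He) as [del Hd].
  assert (Hm : 0 < Rmin del rho) by (apply Rmin_pos; [apply cond_pos|auto]).
  exists (mkposreal _ Hm). intros h Hh Hlt; simpl in Hlt.
  rewrite <- !H.
  - apply Hd; auto. eapply Rlt_le_trans; [apply Hlt|apply Rmin_l].
  - rewrite Rminus_diag, Rabs_R0; auto.
  - replace (x + h - x) with h by ring. eapply Rlt_le_trans; [apply Hlt|apply Rmin_r].
Qed.

Lemma partial_on_ext (d i : nat) (F F' G G' : pt -> R) : (i < d)%nat ->
  (forall y, inU d y -> F y = F' y) -> (forall y, inU d y -> G y = G' y) ->
  partial_on d F i G -> partial_on d F' i G'.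
Proof.
  intros Hi HF HG H y Hy. rewrite <- HG by auto.
  destruct (inU_shift d i y Hi Hy) as [rho [Hr Hin]].
  apply (dpl_ext_loc (fun t => F (shift y i t)) _ 0 _ rho); auto.
  intros t Ht. apply HF, Hin. rewrite Rminus_0_r in Ht; auto.
Qed.

Lemma partial_on_unique (d i : nat) (F G G' : pt -> R) :
  partial_on d F i G -> partial_on d F i G' -> forall y, inU d y -> G y = G' y.
Proof. intros H H' y Hy. eapply uniqueness_limite; [apply H|apply H']; auto. Qed.

Lemma cont_on_ext (d : nat) (F F' : pt -> R) :
  (forall y, inU d y -> F y = F' y) -> cont_on d F -> cont_on d F'.
Proof.
  intros H HF y Hy eps He. destruct (HF y Hy eps He) as [del [Hd Hc]].
  exists del; split; auto. intros z Hz Hlt. rewrite <- !H by auto. auto.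
Qed.

Lemma Cn_ext (d n : nat) (F F' : pt -> R) :
  (forall y, inU d y -> F y = F' y) -> Cn d n F -> Cn d n F'.
Proof.
  destruct n as [|n]; intros H; simpl.
  - apply cont_on_ext; auto.
  - intros [Hc Hp]; split; [eapply cont_on_ext; eauto|].
    intros i Hi. destruct (Hp i Hi) as [G [HG Hn]]. exists G; split; auto.
    apply (partial_on_ext d i F F' G G); auto.
Qed.

Lemma Cn_cont (d n : nat) (F : pt -> R) : Cn d n F -> cont_on d F.
Proof. destruct n; simpl; tauto. Qed.

Lemma Cn_pred (d n : nat) (F : pt -> R) : Cn d (S n) F -> Cn d n F.
Proof.
  revert F; induction n as [|n IH]; intros F H; [apply Cn_cont in H; auto|].
  destruct H as [Hc Hp]. split; auto.
  intros i Hi. destruct (Hp i Hi) as [G [HG Hn]]. exists G; split; auto.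
Qed.

Lemma cont_on_const (d : nat) (c : R) : cont_on d (fun _ => c).
Proof.
  intros y Hy eps He. exists 1; split; [lra|]. intros. rewrite Rminus_diag, Rabs_R0; auto.
Qed.

Lemma cont_on_coord (d i : nat) : (i < d)%nat -> cont_on d (fun y => y i).
Proof. intros Hi y Hy eps He. exists eps; split; auto. intros z Hz H. eapply coord_close; eauto. Qed.

Lemma cont_on_2 (d : nat) (op : R -> R -> R) (F G : pt -> R) :
  (forall x y, continuity_2d_pt op x y) ->
  cont_on d F -> cont_on d G -> cont_on d (fun y => op (F y) (G y)).
Proof.
  intros Hop HF HG y Hy eps He.
  destruct (Hop (F y) (G y) (mkposreal _ He)) as [del Hd].
  destruct (HF y Hy del (cond_pos del)) as [d1 [Hd1 H1]].
  destruct (HG y Hy del (cond_pos del)) as [d2 [Hd2 H2]].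
  exists (Rmin d1 d2); split; [apply Rmin_pos; auto|].
  intros z Hz Hlt. pose proof (Rmin_l d1 d2). pose proof (Rmin_r d1 d2).
  assert (0 < Rmin d1 d2) by (apply Rmin_pos; auto).
  apply Hd; [apply H1|apply H2]; auto; eapply Rlt_le_trans; eauto; nra.
Qed.

Lemma cont_on_plus (d : nat) (F G : pt -> R) :
  cont_on d F -> cont_on d G -> cont_on d (fun y => F y + G y).
Proof.
  apply cont_on_2. intros x y. apply continuity_2d_pt_plus;
  [apply continuity_2d_pt_id1|apply continuity_2d_pt_id2].
Qed.

Lemma cont_on_mult (d : nat) (F G : pt -> R) :
  cont_on d F -> cont_on d G -> cont_on d (fun y => F y * G y).
Proof.
  apply cont_on_2. intros x y. apply continuity_2d_pt_mult;
  [apply continuity_2d_pt_id1|apply continuity_2d_pt_id2].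
Qed.

Lemma cont_on_comp (d : nat) (h : R -> R) (F : pt -> R) :
  (forall y, inU d y -> continuity_pt h (F y)) -> cont_on d F -> cont_on d (fun y => h (F y)).
Proof.
  intros Hh HF y Hy eps He.
  destruct (Hh y Hy eps He) as [a [Ha H]].
  destruct (HF y Hy a Ha) as [del [Hd Hc]].
  exists del; split; auto. intros z Hz Hlt.
  destruct (Req_dec (F y) (F z)) as [->|Hne]; [rewrite Rminus_diag, Rabs_R0; auto|].
  apply H. split; [split; [exact I|auto]|]. apply Hc; auto.
Qed.

Lemma cont_on_sumR (d m : nat) (F : nat -> pt -> R) :
  (forall i, (i < m)%nat -> cont_on d (F i)) -> cont_on d (fun y => sumR m (fun i => F i y)).
Proof.
  induction m as [|m IH]; intros H; simpl; [apply cont_on_const|].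
  apply cont_on_plus; [apply IH; intros; apply H|apply H]; lia.
Qed.

Lemma cont_on_norm2 (d : nat) : cont_on d (norm2 d).
Proof.
  unfold norm2. apply (cont_on_sumR d d (fun i y => y i ^ 2)).
  intros i Hi. apply (cont_on_ext d (fun y => y i * y i)); [intros; ring|].
  apply cont_on_mult; apply cont_on_coord; auto.
Qed.

Lemma partial_const (d i : nat) (c : R) : partial_on d (fun _ => c) i (fun _ => 0).
Proof. intros y Hy. apply derivable_pt_lim_const. Qed.

Lemma partial_coord (d i j : nat) :
  partial_on d (fun y => y j) i (fun _ => if Nat.eqb j i then 1 else 0).
Proof.
  intros y Hy. unfold shift. destruct (Nat.eqb j i).
  - replace 1 with (0 + 1) by ring. apply (derivable_pt_lim_plus (fun _ => y j) id);
    [apply derivable_pt_lim_const|apply derivable_pt_lim_id].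
  - apply derivable_pt_lim_const.
Qed.

Lemma partial_plus (d i : nat) (F G F' G' : pt -> R) :
  partial_on d F i F' -> partial_on d G i G' ->
  partial_on d (fun y => F y + G y) i (fun y => F' y + G' y).
Proof.
  intros HF HG y Hy.
  apply (derivable_pt_lim_plus (fun t => F (shift y i t)) (fun t => G (shift y i t))); auto.
Qed.

Lemma partial_mult (d i : nat) (F G F' G' : pt -> R) :
  partial_on d F i F' -> partial_on d G i G' ->
  partial_on d (fun y => F y * G y) i (fun y => F' y * G y + F y * G' y).
Proof.
  intros HF HG y Hy.
  pose proof (derivable_pt_lim_mult (fun t => F (shift y i t)) (fun t => G (shift y i t))
    0 _ _ (HF y Hy) (HG y Hy)) as H.
  cbv beta in H. rewrite !shift_0 in H. exact H.
Qed.

Lemma partial_scal (d i : nat) (c : R) (F F' : pt -> R) :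
  partial_on d F i F' -> partial_on d (fun y => c * F y) i (fun y => c * F' y).
Proof.
  intros HF y Hy. apply (derivable_pt_lim_scal (fun t => F (shift y i t))); auto.
Qed.

Lemma partial_sumR (d i m : nat) (F G : nat -> pt -> R) :
  (forall j, (j < m)%nat -> partial_on d (F j) i (G j)) ->
  partial_on d (fun y => sumR m (fun j => F j y)) i (fun y => sumR m (fun j => G j y)).
Proof.
  induction m as [|m IH]; intros H; simpl; [apply partial_const|].
  apply (partial_plus d i (fun y => sumR m (fun j => F j y)) (F m)); [apply IH; intros; apply H|apply H]; lia.
Qed.

Lemma Cn_const (d n : nat) (c : R) : Cn d n (fun _ => c).
Proof.
  revert c; induction n as [|n IH]; intros c; simpl; [apply cont_on_const|].
  split; [apply cont_on_const|]. intros i Hi. exists (fun _ => 0); split; auto.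
  apply partial_const.
Qed.

Lemma Cn_coord (d n j : nat) : (j < d)%nat -> Cn d n (fun y => y j).
Proof.
  intros Hj. destruct n as [|n]; simpl; [apply cont_on_coord; auto|].
  split; [apply cont_on_coord; auto|]. intros i Hi. eexists; split; [apply partial_coord|].
  apply Cn_const.
Qed.

Lemma Cn_plus (d n : nat) (F G : pt -> R) :
  Cn d n F -> Cn d n G -> Cn d n (fun y => F y + G y).
Proof.
  revert F G; induction n as [|n IH]; intros F G; simpl; [apply cont_on_plus|].
  intros [HF PF] [HG PG]; split; [apply cont_on_plus; auto|].
  intros i Hi. destruct (PF i Hi) as [F' [? ?]]. destruct (PG i Hi) as [G' [? ?]].
  eexists; split; [apply partial_plus; eauto|]. auto.
Qed.

Lemma Cn_mult (d n : nat) (F G : pt -> R) :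
  Cn d n F -> Cn d n G -> Cn d n (fun y => F y * G y).
Proof.
  revert F G; induction n as [|n IH]; intros F G HF HG;
    [apply cont_on_mult; auto|].
  split; [apply cont_on_mult; eapply Cn_cont; eauto|].
  intros i Hi. destruct HF as [cF PF] eqn:EF. destruct HG as [cG PG] eqn:EG.
  destruct (PF i Hi) as [F' [? ?]]. destruct (PG i Hi) as [G' [? ?]].
  eexists; split; [apply partial_mult; eauto|].
  apply Cn_plus; apply IH; auto; apply Cn_pred; split; auto.
Qed.

(** This is $|y|^{2a}$, since [norm2] is the squared norm; the power $|y|^t$ is [Npow d (t / 2)]. *)
Definition Npow (d : nat) (a : R) : pt -> R := fun y => Rpower (norm2 d y) a.

Lemma cont_on_Npow (d : nat) (a : R) : cont_on d (Npow d a).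
Proof.
  apply (cont_on_comp d (fun t => Rpower t a)); [|apply cont_on_norm2].
  intros y [_ Hy]. apply derivable_continuous_pt.
  exists (a * Rpower (norm2 d y) (a - 1)). apply derivable_pt_lim_power; auto.
Qed.

Lemma partial_Npow (d i : nat) (a : R) : (i < d)%nat ->
  partial_on d (Npow d a) i (fun y => 2 * a * (y i * Npow d (a - 1) y)).
Proof.
  intros Hi y Hy. unfold Npow.
  assert (H : derivable_pt_lim (fun t => norm2 d (shift y i t)) 0 (2 * y i)).
  { apply (dpl_ext_loc (fun t => norm2 d y + (2 * y i * t + t * t)) _ 0 _ 1); [lra| |].
    - intros t _. rewrite norm2_shift by auto. ring.
    - apply is_derive_Reals. auto_derive; auto. ring. }
  replace (2 * a * (y i * Rpower (norm2 d y) (a - 1)))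
    with (a * Rpower (norm2 d (shift y i 0)) (a - 1) * (2 * y i))
    by (rewrite shift_0; ring).
  apply (derivable_pt_lim_comp (fun t => norm2 d (shift y i t)) (fun u => Rpower u a)); auto.
  apply derivable_pt_lim_power. rewrite shift_0. apply Hy.
Qed.

Lemma Cn_Npow (d n : nat) (a : R) : Cn d n (Npow d a).
Proof.
  revert a; induction n as [|n IH]; intros a; [apply cont_on_Npow|].
  split; [apply cont_on_Npow|]. intros i Hi.
  eexists; split; [apply partial_Npow; auto|].
  apply (Cn_mult d n (fun _ => 2 * a)); [apply Cn_const|].
  apply (Cn_mult d n (fun y => y i)); [apply Cn_coord; auto|auto].
Qed.

Definition smooth (d : nat) (F : pt -> R) : Prop := forall n, Cn d n F.

(** [Cn] may supply a different derivative for each order; by uniqueness of limits they agree on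
    [inU], so a single one serves all orders. *)
Lemma smooth_partial (d i : nat) (F : pt -> R) : (i < d)%nat -> smooth d F ->
  exists G, partial_on d F i G /\ smooth d G.
Proof.
  intros Hi H. destruct (H 1%nat) as [_ H1]. destruct (H1 i Hi) as [G [HG _]].
  exists G; split; auto. intros n. destruct (H (S n)) as [_ Hn].
  destruct (Hn i Hi) as [G' [HG' Hc]]. apply (Cn_ext d n G'); auto.
  apply (partial_on_unique d i F); auto.
Qed.

Lemma smooth_partials (d : nat) (F : pt -> R) : smooth d F ->
  exists G : nat -> pt -> R, forall i, (i < d)%nat -> partial_on d F i (G i) /\ smooth d (G i).
Proof.
  intros H.
  assert (Hc : forall i, exists G, (i < d)%nat -> partial_on d F i G /\ smooth d G).
  { intros i. destruct (le_lt_dec d i); [exists (fun _ => 0); lia|].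
    destruct (smooth_partial d i F) as [G HG]; auto. exists G; auto. }
  exists (fun i => proj1_sig (constructive_indefinite_description _ (Hc i))).
  intros i Hi. destruct (constructive_indefinite_description _ (Hc i)); simpl; auto.
Qed.

Lemma smooth_cont (d : nat) (F : pt -> R) : smooth d F -> cont_on d F.
Proof. intros H; exact (H 0%nat). Qed.

Lemma partial_at (d i : nat) (F G : pt -> R) (z : pt) (c : R) :
  partial_on d F i G -> inU d (shift z i c) ->
  derivable_pt_lim (fun s => F (shift z i s)) c (G (shift z i c)).
Proof.
  intros HF Hz eps He. destruct (HF _ Hz eps He) as [del H]. exists del.
  intros h Hh Hl. specialize (H h Hh Hl). cbv beta in H.
  rewrite !shift_shift, Rplus_0_l, Rplus_0_r in H. exact H.
Qed.

(** Leads from [y] to [y + t h] one coordinate at a time, so that an increment of [F] telescopes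
    into increments along the axes. *)
Definition hyb (y h : pt) (k : nat) (t : R) : pt :=
  fun j => if (j <? k)%nat then y j + t * h j else y j.

Lemma hyb_S (y h : pt) (k : nat) (t : R) : hyb y h (S k) t = shift (hyb y h k t) k (t * h k).
Proof.
  apply functional_extensionality; intros j; unfold hyb, shift.
  destruct (Nat.eqb_spec j k); destruct (Nat.ltb_spec j (S k)); destruct (Nat.ltb_spec j k);
    subst; try lia; ring.
Qed.

Lemma hyb_0 (y h : pt) (k : nat) : hyb y h k 0 = y.
Proof.
  apply functional_extensionality; intros j; unfold hyb. destruct (j <? k)%nat; ring.
Qed.

Lemma hyb_close (d k : nat) (y h : pt) (t tau : R) : (k < d)%nat -> Rabs tau <= Rabs (t * h k) ->
  norm2 d (fun j => shift (hyb y h k t) k tau j - y j) <= t ^ 2 * norm2 d h.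
Proof.
  intros Hk Ht. unfold norm2. rewrite <- sumR_scal. apply sumR_le. intros j Hj.
  assert (tau ^ 2 <= (t * h k) ^ 2).
  { rewrite <- (pow2_abs tau), <- (pow2_abs (t * h k)). pose proof (Rabs_pos tau). nra. }
  pose proof (pow2_ge_0 (t * h j)). unfold shift, hyb.
  destruct (Nat.eqb_spec j k); destruct (Nat.ltb_spec j k); subst; try lia; nra.
Qed.

(** Chain rule along a line. Each increment along an axis is a value of a partial derivative by the
    mean value theorem, and the continuity of this derivative at [y] controls the error. *)
Lemma dir_deriv (d : nat) (F : pt -> R) (G : nat -> pt -> R) (y h : pt) :
  (forall i, (i < d)%nat -> partial_on d F i (G i) /\ cont_on d (G i)) ->
  inU d y -> (forall j, (d <= j)%nat -> h j = 0) ->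
  forall k, (k <= d)%nat ->
    derivable_pt_lim (fun t => F (hyb y h k t)) 0 (sumR k (fun i => h i * G i y)).
Proof.
  intros HF Hy Hh. induction k as [|k IH]; intros Hk.
  - exact (derivable_pt_lim_const (F y) 0).
  - simpl sumR.
    apply (dpl_ext_loc (fun t => F (hyb y h k t) + (F (hyb y h (S k) t) - F (hyb y h k t))) _ 0 _ 1);
      [lra|intros; ring|].
    apply (derivable_pt_lim_plus (fun t => F (hyb y h k t))
      (fun t => F (hyb y h (S k) t) - F (hyb y h k t))); [apply IH; lia|].
    destruct (HF k ltac:(lia)) as [HP HC].
    intros eps He.
    assert (Hb : 0 < eps / (Rabs (h k) + 1)).
    { pose proof (Rabs_pos (h k)). apply Rdiv_lt_0_compat; lra. }
    destruct (HC y Hy _ Hb) as [d1 [Hd1 H1]].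
    destruct (inU_open d y Hy) as [rho [Hr Hin]].
    set (m := Rmin d1 rho). assert (Hm : 0 < m) by (apply Rmin_pos; auto).
    pose proof (norm2_nonneg d h) as HN. set (N := norm2 d h) in *.
    assert (Hdel : 0 < m / (1 + N)) by (apply Rdiv_lt_0_compat; lra).
    exists (mkposreal _ Hdel). intros t Ht0 Ht. simpl in Ht. rewrite Rplus_0_l, !hyb_0.
    assert (Hnear : forall tau, Rabs tau <= Rabs (t * h k) ->
      norm2 d (fun j => shift (hyb y h k t) k tau j - y j) < m ^ 2).
    { intros tau Htau. eapply Rle_lt_trans; [apply hyb_close; auto; lia|]. fold N.
      assert (Rabs t * (1 + N) < m).
      { apply Rmult_lt_reg_r with (/ (1 + N)); [apply Rinv_0_lt_compat; lra|].
        rewrite Rmult_assoc, Rinv_r by lra. unfold Rdiv in Ht. lra. }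
      rewrite <- (pow2_abs t). pose proof (Rabs_pos t).
      assert (Rabs t ^ 2 * N <= (Rabs t * (1 + N)) ^ 2).
      { replace ((Rabs t * (1 + N)) ^ 2) with (Rabs t ^ 2 * (1 + N) ^ 2) by ring.
        apply Rmult_le_compat_l; [nra|nra]. }
      assert (0 <= Rabs t * (1 + N)) by nra. nra. }
    assert (HinU : forall tau, Rabs tau <= Rabs (t * h k) -> inU d (shift (hyb y h k t) k tau)).
    { intros tau Htau. apply Hin.
      - apply shift_zero_out; [lia|]. intros j Hj. unfold hyb.
        rewrite Hh, Rmult_0_r by auto. destruct (j <? k)%nat; rewrite (proj1 Hy j Hj); ring.
      - eapply Rlt_le_trans; [apply Hnear; auto|]. 
        assert (m <= rho) by apply Rmin_r. nra. }
    assert (Hbet : forall x, Rmin 0 (t * h k) <= x <= Rmax 0 (t * h k) -> Rabs x <= Rabs (t * h k)).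
    { intros x. unfold Rmin, Rmax. destruct (Rle_dec 0 (t * h k)); intros [Hx1 Hx2];
        [rewrite !Rabs_pos_eq by lra; lra | rewrite !Rabs_left1 by lra; lra]. }
    destruct (MVT_gen (fun s => F (shift (hyb y h k t) k s)) 0 (t * h k)
      (fun s => G k (shift (hyb y h k t) k s))) as [c [Hc Heq]].
    + intros x Hx. apply is_derive_Reals. apply (partial_at d); auto. apply HinU, Hbet; lra.
    + intros x Hx. apply derivable_continuous_pt.
      exists (G k (shift (hyb y h k t) k x)). apply (partial_at d); auto.
    + rewrite shift_0, <- hyb_S in Heq. rewrite Rminus_diag, Rminus_0_r, Heq.
      set (z := shift (hyb y h k t) k c) in *.
      replace (G k z * (t * h k - 0) / t - h k * G k y) with (h k * (G k z - G k y)) by (field; auto).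
      assert (Rabs (G k z - G k y) < eps / (Rabs (h k) + 1)).
      { apply H1; [apply HinU, Hbet; auto|].
        eapply Rlt_le_trans; [apply Hnear, Hbet; auto|].
        assert (m <= d1) by apply Rmin_l. nra. }
      rewrite Rabs_mult. pose proof (Rabs_pos (h k)). pose proof (Rabs_pos (G k z - G k y)).
      set (q := eps / (Rabs (h k) + 1)) in *.
      assert (eps = q * (Rabs (h k) + 1)) by (unfold q; field; lra). nra.
Qed.

(** * Homogeneous functions, Euler's relation and symmetry of second derivatives *)

Definition scale (c : R) (y : pt) : pt := fun j => c * y j.

Definition homog (d : nat) (t : R) (w : pt -> R) : Prop :=
  forall c y, 0 < c -> inU d y -> w (scale c y) = Rpower c t * w y.

Lemma norm2_scale (d : nat) (c : R) (y : pt) : norm2 d (scale c y) = c ^ 2 * norm2 d y.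
Proof.
  unfold norm2, scale. rewrite <- sumR_scal. apply sumR_ext; intros; ring.
Qed.

Lemma inU_scale (d : nat) (c : R) (y : pt) : 0 < c -> inU d y -> inU d (scale c y).
Proof.
  intros Hc [H1 H2]; split; [intros j Hj; unfold scale; rewrite H1 by auto; ring|].
  rewrite norm2_scale. apply Rmult_lt_0_compat; auto. apply pow_lt; auto.
Qed.

(** Both sides are the derivative of [F ((1 + s) y)] at [s = 0], computed by the chain rule and by
    homogeneity. *)
Lemma euler (d : nat) (t : R) (F : pt -> R) (G : nat -> pt -> R) (y : pt) :
  (forall i, (i < d)%nat -> partial_on d F i (G i) /\ cont_on d (G i)) ->
  homog d t F -> inU d y -> sumR d (fun i => y i * G i y) = t * F y.
Proof.
  intros HF Hh Hy.
  pose proof (dir_deriv d F G y y HF Hy (proj1 Hy) d ltac:(lia)) as H.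
  eapply uniqueness_limite; [exact H|].
  apply (dpl_ext_loc (fun s => F y * Rpower (1 + s) t) _ 0 _ 1); [lra| |].
  - intros s Hs. rewrite Rminus_0_r in Hs. apply Rabs_def2 in Hs.
    rewrite Rmult_comm, <- Hh by (auto; lra). f_equal.
    apply functional_extensionality; intros j; unfold scale, hyb.
    destruct (Nat.ltb_spec j d); [ring|]. rewrite (proj1 Hy) by auto; ring.
  - replace (t * F y) with (F y * (t * Rpower (1 + 0) (t - 1) * 1)).
    + apply derivable_pt_lim_scal.
      apply (derivable_pt_lim_comp (fun s => 1 + s) (fun u => Rpower u t)).
      * apply is_derive_Reals. auto_derive; auto.
      * apply derivable_pt_lim_power; lra.
    + rewrite Rplus_0_r. unfold Rpower. rewrite ln_1, Rmult_0_r, exp_0. ring.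
Qed.

Lemma scale_shift (c : R) (y : pt) (i : nat) (s : R) : c <> 0 ->
  shift (scale c y) i s = scale c (shift y i (s / c)).
Proof.
  intros Hc. apply functional_extensionality; intros j; unfold shift, scale.
  destruct (Nat.eqb j i); [field; auto|auto].
Qed.

Lemma homog_partial (d i : nat) (t : R) (F G : pt -> R) : (i < d)%nat ->
  homog d t F -> partial_on d F i G -> homog d (t - 1) G.
Proof.
  intros Hi HF HG c y Hc Hy.
  eapply uniqueness_limite; [apply HG, inU_scale; auto|].
  destruct (inU_shift d i y Hi Hy) as [rho [Hr Hin]].
  apply (dpl_ext_loc (fun s => Rpower c t * F (shift y i (s / c))) _ 0 _ (rho * c)); [nra| |].
  - intros s Hs. rewrite Rminus_0_r in Hs. rewrite scale_shift by lra. rewrite HF; auto.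
    apply Hin. unfold Rdiv. rewrite Rabs_mult, (Rabs_pos_eq (/ c)) by (left; apply Rinv_0_lt_compat; auto).
    apply Rmult_lt_reg_r with c; auto. rewrite Rmult_assoc, Rinv_l by lra. lra.
  - replace (Rpower c (t - 1) * G y) with (Rpower c t * (G y * / c)).
    + apply (derivable_pt_lim_scal (fun s => F (shift y i (s / c)))).
      apply (derivable_pt_lim_comp (fun s => s / c) (fun u => F (shift y i u))).
      * apply is_derive_Reals. auto_derive; auto. field; lra.
      * unfold Rdiv; rewrite Rmult_0_l. apply HG; auto.
    + unfold Rminus. rewrite Rpower_plus, Rpower_Ropp, Rpower_1 by auto. ring.
Qed.

Lemma shift_comm (y : pt) (i j : nat) (u v : R) :
  shift (shift y i u) j v = shift (shift y j v) i u.
Proof.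
  apply functional_extensionality; intros k; unfold shift.
  destruct (Nat.eqb k i), (Nat.eqb k j); ring.
Qed.

Lemma norm2_shift2_diff (d i j : nat) (y : pt) (u v : R) : (i < d)%nat -> (j < d)%nat -> i <> j ->
  norm2 d (fun k => shift (shift y i u) j v k - y k) = u ^ 2 + v ^ 2.
Proof.
  intros Hi Hj Hij. unfold norm2, shift.
  rewrite (sumR_ext d _ (fun k => (0 + (if Nat.eqb k i then u ^ 2 else 0))
     + (if Nat.eqb k j then v ^ 2 else 0))).
  - rewrite !sumR_indic, sumR_0 by auto.
    destruct (Nat.ltb_spec i d); destruct (Nat.ltb_spec j d); try lia; ring.
  - intros k _. destruct (Nat.eqb_spec k i); destruct (Nat.eqb_spec k j); subst; try lia; ring.
Qed.

(** Restricts [F] to the plane through [y] spanned by two axes, where the theorem on functions of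
    two real variables applies; bounding both parameters by [rho / 2] keeps the plane inside [inU].
    The case [i = j] is uniqueness of derivatives. *)
Lemma schwarz (d i j : nat) (F Gi Gj Kij Kji : pt -> R) (y : pt) :
  (i < d)%nat -> (j < d)%nat ->
  partial_on d F i Gi -> partial_on d F j Gj -> partial_on d Gi j Kij -> partial_on d Gj i Kji ->
  cont_on d Kij -> cont_on d Kji -> inU d y -> Kij y = Kji y.
Proof.
  intros Hi Hj HGi HGj HKij HKji Cij Cji Hy.
  destruct (Nat.eq_dec i j) as [->|Hne].
  { eapply (partial_on_unique d j Gi); eauto.
    apply (partial_on_ext d j Gj Gi Kji Kji); auto. intros; eapply partial_on_unique; eauto. }
  set (P := fun u v => shift (shift y i u) j v).
  destruct (inU_open d y Hy) as [rho [Hr Hin]].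
  assert (HP : forall u v, Rabs u < rho / 2 -> Rabs v < rho / 2 -> inU d (P u v)).
  { intros u v Hu Hv. apply Hin.
    - unfold P. apply shift_zero_out, shift_zero_out; auto. apply Hy.
    - unfold P. rewrite norm2_shift2_diff by auto. apply Rabs_def2 in Hu, Hv. nra. }
  assert (D1 : forall u v, inU d (P u v) -> is_derive (fun z => F (P z v)) u (Gi (P u v))).
  { intros u v H. apply is_derive_Reals. unfold P in *. rewrite shift_comm in *.
    apply (dpl_ext_loc (fun z => F (shift (shift y j v) i z)) _ u _ 1); [lra|intros; rewrite shift_comm; auto|].
    apply (partial_at d); auto. }
  assert (D2 : forall u v, inU d (P u v) -> is_derive (fun z => F (P u z)) v (Gj (P u v))).
  { intros u v H. apply is_derive_Reals. apply (partial_at d); auto. }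
  assert (D3 : forall u v, inU d (P u v) -> is_derive (fun z => Gi (P u z)) v (Kij (P u v))).
  { intros u v H. apply is_derive_Reals. apply (partial_at d); auto. }
  assert (D4 : forall u v, inU d (P u v) -> is_derive (fun z => Gj (P z v)) u (Kji (P u v))).
  { intros u v H. apply is_derive_Reals. unfold P in *. rewrite shift_comm in *.
    apply (dpl_ext_loc (fun z => Gj (shift (shift y j v) i z)) _ u _ 1); [lra|intros; rewrite shift_comm; auto|].
    apply (partial_at d); auto. }
  assert (Hr2 : 0 < rho / 2) by lra.
  assert (Hloc : forall u, Rabs u < rho / 2 -> locally u (fun z => Rabs z < rho / 2)).
  { intros u Hu.
    assert (HT : forall a : R, Rabs a <= Rabs u + Rabs (a + - u)).
    { intros a. replace a with (u + (a + - u)) at 1 by ring. apply Rabs_triang. }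
    assert (Hp : 0 < rho / 2 - Rabs u) by lra. exists (mkposreal _ Hp). intros z Hz.
    unfold ball in Hz; simpl in Hz; unfold AbsRing_ball, abs, minus, plus, opp in Hz; simpl in Hz.
    specialize (HT z). lra. }
  assert (D5 : forall u v, Rabs u < rho / 2 -> Rabs v < rho / 2 ->
    is_derive (fun z => Derive (fun t => F (P z t)) v) u (Kji (P u v))).
  { intros u v Hu Hv. apply (is_derive_ext_loc (fun z => Gj (P z v))); [|apply D4, HP; auto].
    eapply filter_imp; [|apply Hloc, Hu]. intros z Hz. symmetry; apply is_derive_unique, D2, HP; auto. }
  assert (D6 : forall u v, Rabs u < rho / 2 -> Rabs v < rho / 2 ->
    is_derive (fun z => Derive (fun t => F (P t z)) u) v (Kij (P u v))).
  { intros u v Hu Hv. apply (is_derive_ext_loc (fun z => Gi (P u z))); [|apply D3, HP; auto].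
    eapply filter_imp; [|apply Hloc, Hv]. intros z Hz. symmetry; apply is_derive_unique, D1, HP; auto. }
  assert (H0 : P 0 0 = y) by (unfold P; rewrite !shift_0; auto).
  assert (Z : Rabs 0 < rho / 2) by (rewrite Rabs_R0; auto).
  assert (HC : forall K, cont_on d K -> continuity_2d_pt (fun u v => K (P u v)) 0 0).
  { intros K HK eps. destruct (HK y Hy eps (cond_pos eps)) as [del [Hd Hc]].
    assert (Hm : 0 < Rmin (rho / 2) (del / 2)) by (apply Rmin_pos; lra).
    exists (mkposreal _ Hm). simpl. intros u v Hu Hv. rewrite Rminus_0_r in Hu, Hv. rewrite H0.
    pose proof (Rmin_l (rho / 2) (del / 2)). pose proof (Rmin_r (rho / 2) (del / 2)).
    apply Hc; [apply HP; lra|]. unfold P. rewrite norm2_shift2_diff by auto.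
    assert (Rabs u < del / 2) as Hu' by lra. assert (Rabs v < del / 2) as Hv' by lra.
    apply Rabs_def2 in Hu', Hv'. nra. }
  assert (HE : forall (f g : R -> R -> R),
    (forall u v, Rabs u < rho / 2 -> Rabs v < rho / 2 -> g u v = f u v) ->
    continuity_2d_pt f 0 0 -> continuity_2d_pt g 0 0).
  { intros f g Hfg Hf. eapply continuity_2d_pt_ext_loc; [|exact Hf].
    exists (mkposreal _ Hr2). simpl; intros u v. rewrite !Rminus_0_r. intros; symmetry; auto. }
  assert (E5 : Derive (fun z => Derive (fun t => F (P z t)) 0) 0 = Kji (P 0 0))
    by (apply is_derive_unique, D5; auto).
  assert (E6 : Derive (fun z => Derive (fun t => F (P t z)) 0) 0 = Kij (P 0 0))
    by (apply is_derive_unique, D6; auto).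
  rewrite <- H0, <- E5, <- E6. symmetry. apply (Schwarz (fun u v => F (P u v))).
  - exists (mkposreal _ Hr2). simpl; intros u v. rewrite !Rminus_0_r. intros Hu Hv.
    repeat split; eexists; [apply D1|apply D2|apply D5|apply D6]; auto.
  - apply (HE (fun u v => Kji (P u v))); [|apply HC; auto].
    intros u v Hu Hv. apply is_derive_unique, D5; auto.
  - apply (HE (fun u v => Kij (P u v))); [|apply HC; auto].
    intros u v Hu Hv. apply is_derive_unique, D6; auto.
Qed.

(** * Eigenfunctions on the sphere are restrictions of homogeneous harmonic polynomials *)

(** [compactness_list] of Coquelicot speaks of nested tuples; [tuple_pt] and [pt_tuple]
    translate. *)
Fixpoint tuple_pt (n : nat) : Compactness.Tn n R -> pt :=
  match n with
  | O => fun _ _ => 0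
  | S n' => fun t j => match j with O => fst t | S j' => tuple_pt n' (snd t) j' end
  end.

Fixpoint pt_tuple (n : nat) (x : pt) : Compactness.Tn n R :=
  match n with O => tt | S n' => (x O, pt_tuple n' (fun j => x (S j))) end.

Lemma pt_tuple_bounded (n : nat) (a b : R) (x : pt) :
  (forall j, (j < n)%nat -> a <= x j <= b) ->
  bounded_n n (pt_tuple n (fun _ => a)) (pt_tuple n (fun _ => b)) (pt_tuple n x).
Proof.
  revert x; induction n as [|n IH]; intros x H; simpl; auto.
  split; [apply H; lia|]. apply IH. intros j Hj. apply (H (S j)). lia.
Qed.

Lemma close_tuple (n : nat) (delta : R) (x : pt) (t : Compactness.Tn n R) :
  close_n n delta (pt_tuple n x) t ->
  forall j, (j < n)%nat -> Rabs (x j - tuple_pt n t j) < delta.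
Proof.
  revert x; induction n as [|n IH]; intros x H j Hj; [lia|].
  simpl in *. destruct t as [t1 t2]. destruct H as [H1 H2].
  destruct j as [|j]; simpl; auto. apply (IH t2 (fun j => x (S j))); auto. lia.
Qed.

Lemma tuple_pt_out (n : nat) (t : Compactness.Tn n R) :
  forall j, (n <= j)%nat -> tuple_pt n t j = 0.
Proof.
  induction n as [|n IH]; intros j Hj; simpl; auto. destruct j; [lia|]. apply IH; lia.
Qed.

(** Unlike [cont_on_norm2] this includes the origin, because the cubes used in [sphere_max] have
    arbitrary centres. *)
Lemma norm2_cont (d : nat) (x : pt) (eps : R) : 0 < eps -> exists delta, 0 < delta /\
  forall z : pt, (forall j, (j < d)%nat -> Rabs (z j - x j) < delta) ->
    Rabs (norm2 d z - norm2 d x) < eps.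
Proof.
  revert eps; induction d as [|d IH]; intros eps He.
  - exists 1; split; [lra|]. intros. unfold norm2; simpl. rewrite Rminus_diag, Rabs_R0; auto.
  - destruct (IH (eps / 2)) as [d1 [Hd1 H1]]; [lra|].
    assert (Hc : continuity_pt (fun t => t ^ 2) (x d)).
    { apply derivable_continuous_pt. exists (INR 2 * x d ^ 1). apply derivable_pt_lim_pow. }
    destruct (Hc (eps / 2)) as [d2 [Hd2 H2]]; [lra|].
    exists (Rmin d1 d2); split; [apply Rmin_pos; auto|].
    intros z Hz. unfold norm2; cbn [sumR].
    assert (A : Rabs (norm2 d z - norm2 d x) < eps / 2).
    { apply H1. intros j Hj. eapply Rlt_le_trans; [apply Hz; lia|apply Rmin_l]. }
    assert (B : Rabs (z d ^ 2 - x d ^ 2) < eps / 2).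
    { destruct (Req_dec (x d) (z d)) as [->|Hne]; [rewrite Rminus_diag, Rabs_R0; lra|].
      apply H2. split; [split; [exact I|auto]|].
      eapply Rlt_le_trans; [apply Hz; lia|apply Rmin_r]. }
    unfold norm2 in A.
    replace (sumR d (fun i => z i ^ 2) + z d ^ 2 - (sumR d (fun i => x i ^ 2) + x d ^ 2))
      with ((sumR d (fun i => z i ^ 2) - sumR d (fun i => x i ^ 2)) + (z d ^ 2 - x d ^ 2)) by ring.
    eapply Rle_lt_trans; [apply Rabs_triang|]. lra.
Qed.

Lemma norm2_lt (d : nat) (x : pt) (delta : R) : 0 < delta ->
  (forall j, (j < d)%nat -> Rabs (x j) < delta / (INR d + 1)) -> norm2 d x < delta ^ 2.
Proof.
  intros Hd H. pose proof (pos_INR d) as Hp.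
  apply Rle_lt_trans with (INR d * (delta / (INR d + 1)) ^ 2).
  - rewrite <- sumR_const. unfold norm2. apply sumR_le. intros j Hj.
    rewrite <- (pow2_abs (x j)). specialize (H j Hj). pose proof (Rabs_pos (x j)). nra.
  - replace (delta ^ 2) with ((INR d + 1) ^ 2 * (delta / (INR d + 1)) ^ 2) by (field; lra).
    apply Rmult_lt_compat_r; [|nra]. apply pow_lt, Rdiv_lt_0_compat; lra.
Qed.

(* If no point of the sphere were a maximum, every point [x] would have a neighbourhood on which
   [F] stays below some value [F x']; finitely many of these cover the sphere. *)
Lemma sphere_max (d : nat) (F : pt -> R) : (1 <= d)%nat -> cont_on d F ->
  exists x, on_sphere d x /\ forall z, on_sphere d z -> F z <= F x.
Proof.
  intros Hd HF. apply NNPP. intros Hno.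
  assert (Hup : forall x, on_sphere d x -> exists x', on_sphere d x' /\ F x < F x').
  { intros x Hx. apply NNPP; intros Hn. apply Hno. exists x; split; auto.
    intros z Hz. apply Rnot_lt_le. intros Hlt. apply Hn; eauto. }
  set (Q := fun (t : Compactness.Tn d R) (delta : posreal) =>
    exists x', on_sphere d x' /\ forall z, on_sphere d z ->
      (forall j, (j < d)%nat -> Rabs (z j - tuple_pt d t j) < delta) ->
      on_sphere d (tuple_pt d t) /\ F z < F x').
  assert (He0 : on_sphere d (fun j => if Nat.eqb j 0 then 1 else 0)).
  { split; [intros i Hi; destruct (Nat.eqb_spec i 0); auto; lia|].
    unfold norm2. rewrite (sumR_ext d _ (fun j => 0 + (if Nat.eqb j 0 then 1 else 0))).
    - rewrite sumR_indic, sumR_0 by auto. destruct (Nat.ltb_spec 0 d); [lra|lia].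
    - intros j _. destruct (Nat.eqb j 0); ring. }
  assert (HQ : forall t, exists delta, Q t delta).
  { intros t. set (x := tuple_pt d t).
    destruct (classic (on_sphere d x)) as [Hx|Hx].
    - destruct (Hup x Hx) as [x' [Hx' Hlt]].
      destruct (HF x (sphere_inU d x Hx) (F x' - F x)) as [del [Hdel Hc]]; [lra|].
      assert (Hp : 0 < del / (INR d + 1)).
      { pose proof (pos_INR d). apply Rdiv_lt_0_compat; lra. }
      exists (mkposreal _ Hp). exists x'; split; auto. intros z Hz Hclose. split; auto.
      assert (Rabs (F z - F x) < F x' - F x) as HH.
      { apply Hc; [apply sphere_inU; auto|]. apply norm2_lt; auto. }
      apply Rabs_def2 in HH. lra.
    (* Around a point off the sphere the neighbourhood is chosen so small that it misses the sphere;
       the witness [x'] is then arbitrary. *)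
    - assert (Hn : norm2 d x <> 1).
      { intros Hn; apply Hx; split; auto. apply tuple_pt_out. }
      destruct (norm2_cont d x (Rabs (1 - norm2 d x))) as [del [Hdel Hc]].
      { apply Rabs_pos_lt. lra. }
      exists (mkposreal _ Hdel). eexists; split; [exact He0|]. intros z Hz Hclose.
      specialize (Hc z Hclose). rewrite (proj2 Hz) in Hc. lra. }
  set (delta := fun t => proj1_sig (constructive_indefinite_description _ (HQ t))).
  (* This gives the double negation of a finite cover, which is enough as the goal is [False]. *)
  apply (compactness_list d (pt_tuple d (fun _ => -1)) (pt_tuple d (fun _ => 1)) delta).
  intros [l Hl].
  assert (Hmax : exists z0, on_sphere d z0 /\ forall t, In t l -> exists x', F x' <= F z0 /\
    forall z, on_sphere d z -> (forall j, (j < d)%nat -> Rabs (z j - tuple_pt d t j) < delta t) ->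
      F z < F x').
  { clear Hl. induction l as [|t l IH]; [eexists; split; [exact He0|intros t []]|].
    destruct IH as [z0 [Hz0 IH]].
    assert (Ht := proj2_sig (constructive_indefinite_description _ (HQ t))).
    fold (delta t) in Ht. destruct Ht as [x' [Hx' Ht]].
    destruct (Rle_dec (F x') (F z0)) as [Hle|Hlt].
    - exists z0; split; auto. intros s [<-|Hs]; auto.
      exists x'; split; auto. intros z Hz Hc. apply Ht; auto.
    - exists x'; split; auto. intros s [<-|Hs].
      + exists x'; split; [lra|]. intros z Hz Hc. apply Ht; auto.
      + destruct (IH s Hs) as [y' [Hy' Hs']]. exists y'; split; auto. lra. }
  destruct Hmax as [z0 [Hz0 Hmax]].
  destruct (Hl (pt_tuple d z0)) as [t [Hin [_ Hclose]]].
  { apply pt_tuple_bounded. intros j Hj.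
    pose proof (norm2_ge_coord d j z0 Hj) as Hc. rewrite (proj2 Hz0) in Hc. nra. }
  destruct (Hmax t Hin) as [x' [Hx' Ht]].
  assert (F z0 < F x') by (apply Ht; auto; apply close_tuple; auto). lra.
Qed.

(** At the maximum [g 0 = 0]; if [h] were positive, [g] would be positive just to the right of 0,
    and [f] would increase there. *)
Lemma second_derivative_at_max (f g : R -> R) (h rho : R) : 0 < rho ->
  (forall s, Rabs s < rho -> derivable_pt_lim f s (g s)) -> derivable_pt_lim g 0 h ->
  (forall s, Rabs s < rho -> f s <= f 0) -> h <= 0.
Proof.
  intros Hr Hf Hg Hmax. apply Rnot_lt_le. intros Hh.
  assert (H0 : Rabs 0 < rho) by (rewrite Rabs_R0; auto).
  assert (Hg0 : g 0 = 0).
  { pose (pr := exist _ (g 0) (Hf 0 H0) : derivable_pt f 0).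
    assert (E : derive_pt f 0 pr = 0).
    { apply (deriv_maximum f (- rho) rho); try lra. intros x H1 H2. apply Hmax, Rabs_def1; lra. }
    transitivity (derive_pt f 0 pr); [symmetry; apply derive_pt_eq_0; auto|exact E]. }
  destruct (Hg (h / 2)) as [del Hd]; [lra|].
  set (s := Rmin del rho / 2).
  assert (Hm : 0 < Rmin del rho) by (apply Rmin_pos; [apply cond_pos|auto]).
  pose proof (Rmin_l del rho). pose proof (Rmin_r del rho).
  destruct (MVT_cor2 f g 0 s) as [c [Hc1 Hc2]]; [unfold s; lra| |].
  { intros c Hc. apply Hf. apply Rabs_def1; unfold s in Hc; lra. }
  assert (f s <= f 0) by (apply Hmax, Rabs_def1; unfold s; lra).
  assert (Hgc : Rabs ((g (0 + c) - g 0) / c - h) < h / 2).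
  { apply Hd; [lra|]. apply Rabs_def1; unfold s in Hc2; lra. }
  rewrite Rplus_0_l, Hg0, Rminus_0_r in Hgc. apply Rabs_def2 in Hgc.
  assert (0 < g c).
  { replace (g c) with (g c / c * c) by (field; lra). apply Rmult_lt_0_compat; lra. }
  rewrite Rminus_0_r in Hc1. nra.
Qed.

Definition laplacian_on (d : nat) (w H : pt -> R) : Prop :=
  exists G K : nat -> pt -> R,
    (forall i, (i < d)%nat -> partial_on d w i (G i) /\ partial_on d (G i) i (K i)) /\
    forall y, inU d y -> sumR d (fun i => K i y) = H y.

(** A common frame for eigenfunctions extended in degree 0 ([t = 0], [kap = - lam]) and for
    homogeneous harmonic functions ([kap = 0]); multiplication by a power of $|y|$ passes from one
    to the other. *)
Definition hom_eig (d : nat) (t kap : R) (w : pt -> R) : Prop :=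
  smooth d w /\ homog d t w /\ laplacian_on d w (fun y => kap * w y / norm2 d y).

Lemma laplacian_on_eq (d : nat) (w H : pt -> R) (G K : nat -> pt -> R) (y : pt) :
  laplacian_on d w H ->
  (forall i, (i < d)%nat -> partial_on d w i (G i) /\ partial_on d (G i) i (K i)) ->
  inU d y -> sumR d (fun i => K i y) = H y.
Proof.
  intros [G' [K' [H1 H2]]] H3 Hy. rewrite <- H2 by auto. apply sumR_ext. intros i Hi.
  destruct (H1 i Hi) as [P1 P2]. destruct (H3 i Hi) as [P3 P4].
  apply (partial_on_unique d i (G i)); auto.
  apply (partial_on_ext d i (G' i) (G i) (K' i) (K' i)); auto.
  apply (partial_on_unique d i w); auto.
Qed.

Lemma Npow_pred (d : nat) (a : R) (y : pt) : inU d y ->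
  Npow d (a - 1) y = Npow d a y / norm2 d y.
Proof.
  intros [_ Hy]. unfold Npow, Rminus. rewrite Rpower_plus, Rpower_Ropp, Rpower_1 by auto.
  reflexivity.
Qed.

Lemma homog_Npow (d : nat) (a : R) : homog d (2 * a) (Npow d a).
Proof.
  intros c y Hc [_ Hy]. unfold Npow. rewrite norm2_scale.
  rewrite <- Rpower_mult_distr by (auto; apply pow_lt; auto).
  rewrite <- (Rpower_pow 2 c), Rpower_mult by auto. reflexivity.
Qed.

Lemma homog_mult (d : nat) (s t : R) (F G : pt -> R) :
  homog d s F -> homog d t G -> homog d (s + t) (fun y => F y * G y).
Proof.
  intros HF HG c y Hc Hy. rewrite HF, HG, Rpower_plus by auto. ring.
Qed.

(** In $\Delta (|y|^{2a} w)$ the cross term is $4 a t$ by Euler's relation, and $\Delta |y|^{2a} =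
    2a (2a + d - 2) |y|^{2a-2}$. *)
Lemma hom_eig_Npow (d : nat) (t kap a : R) (w : pt -> R) : hom_eig d t kap w ->
  hom_eig d (2 * a + t) (kap + 4 * a * t + 2 * a * (2 * a + INR d - 2))
    (fun y => Npow d a y * w y).
Proof.
  intros [Hs [Hh HL]]. split; [|split].
  - intros n. apply Cn_mult; [apply Cn_Npow|apply Hs].
  - apply homog_mult; auto. apply homog_Npow.
  - destruct HL as [G [K [HP HK]]].
    eexists _, _. split.
    + intros i Hi. destruct (HP i Hi) as [P1 P2]. split.
      * apply partial_mult; [apply partial_Npow; auto|exact P1].
      * apply partial_plus.
        -- apply partial_mult; [apply partial_scal, partial_mult; 
             [apply partial_coord|apply partial_Npow; auto]|exact P1].
        -- apply partial_mult; [apply partial_Npow; auto|exact P2].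
    + intros y Hy. simpl.
      assert (HE : sumR d (fun i => y i * G i y) = t * w y).
      { apply euler; auto. intros i Hi. split; [apply HP; auto|].
        destruct (smooth_partial d i w Hi Hs) as [G' [HG' HS']].
        apply (cont_on_ext d G'); [|apply smooth_cont; auto].
        apply (partial_on_unique d i w); auto. apply HP; auto. }
      set (N := norm2 d y). assert (HN : 0 < N) by apply Hy.
      rewrite (sumR_ext d _ (fun i => 2 * a * Npow d a y / N * w y * 1 +
         (4 * a * (a - 1) * Npow d a y / N / N * w y * y i ^ 2 +
         (4 * a * Npow d a y / N * (y i * G i y) + Npow d a y * K i y)))).
      * rewrite !sumR_plus, !sumR_scal, sumR_const, HE, HK by auto.
        fold (norm2 d y). fold N. field. lra.
      * intros i Hi. rewrite Nat.eqb_refl, !Npow_pred by auto. fold N. field. lra.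
Qed.

Lemma normalize_sphere (d : nat) (y : pt) : inU d y -> on_sphere d (normalize d y).
Proof.
  intros [_ Hy]. split.
  - intros i Hi. unfold normalize. destruct (Nat.ltb_spec i d); [lia|auto].
  - assert (Hs : sqrt (norm2 d y) <> 0) by (apply Rgt_not_eq, sqrt_lt_R0; auto).
    unfold norm2 at 1. rewrite (sumR_ext d _ (fun i => / norm2 d y * y i ^ 2)).
    + rewrite sumR_scal. fold (norm2 d y). field. lra.
    + intros i Hi. unfold normalize. destruct (Nat.ltb_spec i d); [|lia].
      rewrite <- (sqrt_sqrt (norm2 d y)) at 2 by lra. field. auto.
Qed.

Lemma scale_normalize (d : nat) (y : pt) : inU d y ->
  y = scale (sqrt (norm2 d y)) (normalize d y).
Proof.
  intros [Hz Hy]. assert (Hs : sqrt (norm2 d y) <> 0) by (apply Rgt_not_eq, sqrt_lt_R0; auto).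
  apply functional_extensionality; intros j. unfold scale, normalize.
  destruct (Nat.ltb_spec j d); [field; auto|]. rewrite Hz by auto; ring.
Qed.

Lemma normalize_on_sphere (d : nat) (x : pt) : on_sphere d x -> normalize d x = x.
Proof.
  intros [H1 H2]. apply functional_extensionality; intros j. unfold normalize.
  rewrite H2, sqrt_1. destruct (Nat.ltb_spec j d); [field|]. rewrite H1; auto.
Qed.

Lemma normalize_scale (d : nat) (c : R) (y : pt) : 0 < c -> inU d y ->
  normalize d (scale c y) = normalize d y.
Proof.
  intros Hc [_ Hy]. apply functional_extensionality; intros j. unfold normalize.
  destruct (j <? d)%nat; auto. rewrite norm2_scale.
  rewrite sqrt_mult by (try lra; apply pow2_ge_0). rewrite sqrt_pow2 by lra.
  unfold scale. field. split; [apply Rgt_not_eq, sqrt_lt_R0; auto|lra].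
Qed.

Lemma sqrt_Rpower (x t : R) : 0 < x -> Rpower (sqrt x) t = Rpower x (t / 2).
Proof.
  intros Hx. rewrite <- Rpower_sqrt, Rpower_mult by auto. f_equal. field.
Qed.

Lemma homog_normalize (d : nat) (t : R) (w : pt -> R) (y : pt) : homog d t w -> inU d y ->
  w y = Npow d (t / 2) y * w (normalize d y).
Proof.
  intros Hw Hy. rewrite (scale_normalize d y Hy) at 1.
  rewrite Hw; [|apply sqrt_lt_R0, Hy|apply sphere_inU, normalize_sphere; auto].
  rewrite sqrt_Rpower by apply Hy. reflexivity.
Qed.

(* At a maximum [x] of [w] on the sphere, [w - w x * |y| ^ t] is maximal on the whole punctured
   space, so that its Laplacian at [x] is nonpositive. *)
Lemma max_principle_le (d : nat) (t kap : R) (w : pt -> R) : (1 <= d)%nat ->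
  hom_eig d t kap w -> t * (t + INR d - 2) < kap -> forall y, inU d y -> w y <= 0.
Proof.
  intros Hd [Hs [Hh [G [K [HP HK]]]]] Hkap.
  destruct (sphere_max d w Hd (smooth_cont d w Hs)) as [x [Hx Hmax]].
  assert (HxU := sphere_inU d x Hx). assert (Hx1 := proj2 Hx).
  set (M := w x) in *.
  assert (Hbound : forall y, inU d y -> w y <= M * Npow d (t / 2) y).
  { intros y Hy. rewrite (homog_normalize d t w y Hh Hy), Rmult_comm.
    apply Rmult_le_compat_r; [left; apply exp_pos|]. apply Hmax, normalize_sphere; auto. }
  assert (HM : M <= 0).
  { apply Rnot_lt_le. intros HM.
    assert (N1 : forall a, Npow d a x = 1).
    { intros a. unfold Npow. rewrite Hx1. unfold Rpower. rewrite ln_1, Rmult_0_r. apply exp_0. }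
    assert (Hi : forall i, (i < d)%nat ->
      K i x + - M * (t * 1 + (t * (t - 2)) * x i ^ 2) <= 0).
    { intros i Hi. destruct (HP i Hi) as [P1 P2].
      destruct (inU_shift d i x Hi HxU) as [rho [Hr Hin]].
      pose proof (partial_plus d i _ _ _ _ P1
        (partial_scal d i (- M) _ _ (partial_Npow d i (t / 2) Hi))) as Q1.
      pose proof (partial_plus d i _ _ _ _ P2 (partial_scal d i (- M) _ _
        (partial_scal d i (2 * (t / 2)) _ _ (partial_mult d i _ _ _ _
           (partial_coord d i i) (partial_Npow d i (t / 2 - 1) Hi))))) as Q2.
      pose proof (Q2 x HxU) as Q3. cbv beta in Q3. rewrite Nat.eqb_refl, !N1 in Q3.
      eapply (second_derivative_at_max
        (fun s => w (shift x i s) + - M * Npow d (t / 2) (shift x i s)) _ _ rho); auto.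
      - intros s Hs'. apply (partial_at d i _ _ x s Q1). auto.
      - replace (K i x + - M * (t * 1 + t * (t - 2) * x i ^ 2)) with
          (K i x + - M * (2 * (t / 2) * (1 * 1 + x i * (2 * (t / 2 - 1) * (x i * 1))))) by field.
        exact Q3.
      - intros s Hs'. rewrite !shift_0, N1. fold M.
        specialize (Hbound (shift x i s) (Hin s Hs')). lra. }
    (* The sum is [(kap - t * (t + d - 2)) * M], so a positive [M] contradicts the hypothesis on
       [kap]. *)
    assert (HS : sumR d (fun i => K i x + - M * (t * 1 + (t * (t - 2)) * x i ^ 2)) <= 0).
    { rewrite <- (sumR_0 d (fun _ => 0)) by auto. apply sumR_le; auto. }
    rewrite sumR_plus, HK, sumR_scal, sumR_plus, !sumR_scal, sumR_const in HS by auto.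
    fold (norm2 d x) in HS. rewrite Hx1 in HS. fold M in HS. nra. }
  intros y Hy. eapply Rle_trans; [apply Hbound; auto|].
  assert (0 < Npow d (t / 2) y) by apply exp_pos. nra.
Qed.

Lemma hom_eig_opp (d : nat) (t kap : R) (w : pt -> R) :
  hom_eig d t kap w -> hom_eig d t kap (fun y => -1 * w y).
Proof.
  intros [Hs [Hh [G [K [HP HK]]]]]. split; [|split].
  - intros n. apply (Cn_mult d n (fun _ => -1)); [apply Cn_const|apply Hs].
  - intros c y Hc Hy. rewrite Hh by auto. ring.
  - exists (fun i y => -1 * G i y), (fun i y => -1 * K i y). split.
    + intros i Hi. destruct (HP i Hi). split; apply partial_scal; auto.
    + intros y Hy. rewrite sumR_scal, HK by auto. field. apply Rgt_not_eq, Hy.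
Qed.

Lemma max_principle (d : nat) (t kap : R) (w : pt -> R) : (1 <= d)%nat ->
  hom_eig d t kap w -> t * (t + INR d - 2) < kap -> forall y, inU d y -> w y = 0.
Proof.
  intros Hd Hw Hk y Hy. apply Rle_antisym; [eapply max_principle_le; eauto|].
  pose proof (max_principle_le d t kap _ Hd (hom_eig_opp _ _ _ _ Hw) Hk y Hy). lra.
Qed.

(** Two exchanges of derivatives give $\partial_j^2 \partial_i w = \partial_i \partial_j^2 w$, and
    the sum of the $\partial_j^2 w$ is zero on the punctured space. *)
Lemma hom_eig_partial (d i : nat) (t : R) (w G : pt -> R) : (i < d)%nat ->
  hom_eig d t 0 w -> partial_on d w i G -> smooth d G -> hom_eig d (t - 1) 0 G.
Proof.
  intros Hi [Hs [Hh HL]] HG HsG. split; [|split]; auto.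
  { eapply homog_partial; eauto. }
  destruct (smooth_partials d w Hs) as [D HD].
  destruct (smooth_partials d G HsG) as [P HP].
  (* The components are $\partial_j^2 \partial_i w$, $\partial_j^2 w$ and $\partial_i \partial_j^2
     w$, packed into a triple so that a single choice over [j] suffices. *)
  assert (HQ : forall j, exists QKT : (pt -> R) * (pt -> R) * (pt -> R), (j < d)%nat ->
    partial_on d (P j) j (fst (fst QKT)) /\ partial_on d (D j) j (snd (fst QKT)) /\
    partial_on d (snd (fst QKT)) i (snd QKT) /\
    forall y, inU d y -> fst (fst QKT) y = snd QKT y).
  { intros j. destruct (le_lt_dec d j) as [|Hj].
    { exists (fun _ => 0, fun _ => 0, fun _ => 0). lia. }
    destruct (HD j Hj) as [D1 D2]. destruct (HP j Hj) as [P1 P2].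
    destruct (smooth_partial d j (P j) Hj P2) as [Q [Q1 Q2]].
    destruct (smooth_partial d j (D j) Hj D2) as [K [K1 K2]].
    destruct (smooth_partial d i K Hi K2) as [T [T1 T2]].
    destruct (smooth_partial d i (D j) Hi D2) as [S [S1 S2]].
    exists (Q, K, T). intros _. repeat split; auto. intros y Hy.
    assert (HPS : forall z, inU d z -> P j z = S z).
    { intros z Hz. apply (schwarz d i j w G (D j) (P j) S z); auto; apply smooth_cont; auto. }
    assert (QS : partial_on d S j Q) by (apply (partial_on_ext d j (P j) S Q Q); auto).
    apply (schwarz d i j (D j) S K Q T y); auto; apply smooth_cont; auto. }
  set (c := fun j => proj1_sig (constructive_indefinite_description _ (HQ j))).
  assert (Hc : forall j, (j < d)%nat -> partial_on d (P j) j (fst (fst (c j))) /\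
    partial_on d (D j) j (snd (fst (c j))) /\ partial_on d (snd (fst (c j))) i (snd (c j)) /\
    forall y, inU d y -> fst (fst (c j)) y = snd (c j) y).
  { intros j. exact (proj2_sig (constructive_indefinite_description _ (HQ j))). }
  exists P, (fun j => fst (fst (c j))). split.
  { intros j Hj. split; [apply HP; auto|apply Hc; auto]. }
  intros y Hy. replace (0 * G y / norm2 d y) with 0 by (field; apply Rgt_not_eq, Hy).
  rewrite (sumR_ext d _ (fun j => snd (c j) y)) by (intros j Hj; apply Hc; auto).
  assert (H1 : partial_on d (fun z => sumR d (fun j => snd (fst (c j)) z)) i
    (fun z => sumR d (fun j => snd (c j) z))).
  { apply (partial_sumR d i d (fun j => snd (fst (c j))) (fun j => snd (c j))).
    intros j Hj. apply Hc; auto. }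
  apply (partial_on_unique d i _ _ (fun _ => 0) H1); auto.
  apply (partial_on_ext d i (fun _ => 0) _ (fun _ => 0) (fun _ => 0)); auto;
    [|apply partial_const].
  intros z Hz. symmetry.
  rewrite (laplacian_on_eq d w _ D (fun j => snd (fst (c j))) z HL); auto.
  - field. apply Rgt_not_eq, Hz.
  - intros j Hj. split; [apply HD|apply Hc]; auto.
Qed.

(** The nonzero coordinate [j] keeps the whole line away from the origin. *)
Lemma const_along (d i j : nat) (w : pt -> R) (y : pt) (s : R) :
  partial_on d w i (fun _ => 0) -> (i < d)%nat -> (j < d)%nat -> j <> i -> y j <> 0 ->
  (forall k, (d <= k)%nat -> y k = 0) -> w (shift y i s) = w y.
Proof.
  intros Hp Hi Hj Hij Hyj Hy.
  assert (HU : forall c, inU d (shift y i c)).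
  { intros c. apply (inU_intro d j); auto; [apply shift_zero_out; auto|].
    unfold shift. destruct (Nat.eqb_spec j i); [lia|auto]. }
  destruct (MVT_gen (fun c => w (shift y i c)) 0 s (fun _ => 0)) as [c [_ Hc]].
  - intros x _. apply is_derive_Reals, (partial_at d i w (fun _ => 0)); auto.
  - intros x _. apply derivable_continuous_pt. exists 0.
    apply (partial_at d i w (fun _ => 0)); auto.
  - rewrite shift_0 in Hc. lra.
Qed.

(** Joins [y] to the point [ones] along the axes while avoiding the origin: coordinate 0 is made
    nonzero if necessary, the other coordinates are set to 1, and coordinate 0 is adjusted last. *)
Lemma const_of_partials (d : nat) (w : pt -> R) : (2 <= d)%nat ->
  (forall i, (i < d)%nat -> partial_on d w i (fun _ => 0)) ->
  exists c, forall y, inU d y -> w y = c.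
Proof.
  intros Hd Hp.
  set (ones := fun j => if (j <? d)%nat then 1 else 0).
  assert (Hmain : forall y, inU d y -> y O <> 0 -> w y = w ones).
  { intros y Hy H0.
    set (fill := fun k j => if andb (1 <=? j)%nat (j <? k)%nat then 1 else y j).
    assert (Hz : forall k, (k <= d)%nat -> forall j, (d <= j)%nat -> fill k j = 0).
    { intros k Hk j Hj. unfold fill. destruct (Nat.ltb_spec j k); [lia|].
      rewrite Bool.andb_false_r. apply Hy; auto. }
    assert (Hf : forall k, (k <= d)%nat -> w (fill k) = w y).
    { induction k as [|k IH]; intros Hk.
      - f_equal. apply functional_extensionality; intros j. unfold fill.
        rewrite Bool.andb_false_r. auto.
      - rewrite <- IH by lia. destruct (Nat.eq_dec k 0) as [->|Hk0].
        + f_equal. apply functional_extensionality; intros j. unfold fill.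
          destruct (Nat.leb_spec 1 j); destruct (Nat.ltb_spec j 1); simpl; auto; lia.
        + rewrite <- (const_along d k 0 w (fill k) (1 - y k)); auto; try lia; [|apply Hz; lia].
          f_equal. apply functional_extensionality; intros j. unfold fill, shift.
          destruct (Nat.leb_spec 1 j); destruct (Nat.ltb_spec j (S k)); destruct (Nat.ltb_spec j k);
            destruct (Nat.eqb_spec j k); simpl; subst; try lia; ring. }
    rewrite <- (Hf d) by lia.
    rewrite <- (const_along d 0 1 w (fill d) (1 - y O)); auto; try lia; try (apply Hp; lia).
    - f_equal. apply functional_extensionality; intros j. unfold fill, shift, ones.
      destruct (Nat.leb_spec 1 j); destruct (Nat.ltb_spec j d); destruct (Nat.eqb_spec j 0);
        simpl; subst; try lia; try ring. apply Hy; auto.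
    - unfold fill. destruct (Nat.ltb_spec 1 d); [simpl; exact R1_neq_R0|lia]. }
  exists (w ones). intros y Hy.
  destruct (Req_dec (y O) 0) as [H0|H0]; [|apply Hmain; auto].
  destruct (inU_nonzero d y Hy) as [j [Hj Hyj]].
  assert (Hj0 : j <> 0%nat) by congruence.
  rewrite <- (const_along d 0 j w y 1); auto; try lia; [|apply Hp; lia|apply Hy].
  apply Hmain.
  - apply (inU_intro d j); auto; [apply shift_zero_out; [lia|apply Hy]|].
    unfold shift. destruct (Nat.eqb_spec j 0); [lia|auto].
  - unfold shift. simpl. rewrite H0, Rplus_0_l. exact R1_neq_R0.
Qed.

(** Homogeneous polynomials on the punctured space, in the form in which Euler's relation delivers
    them. *)
Inductive hpoly (d : nat) : nat -> (pt -> R) -> Prop :=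
| hpoly_const (c : R) (w : pt -> R) : (forall y, inU d y -> w y = c) -> hpoly d 0 w
| hpoly_step (k : nat) (w : pt -> R) (g : nat -> pt -> R) :
    (forall i, (i < d)%nat -> hpoly d k (g i)) ->
    (forall y, inU d y -> w y = sumR d (fun i => y i * g i y)) -> hpoly d (S k) w.

Lemma hpoly_zero (d k : nat) (w : pt -> R) : (forall y, inU d y -> w y = 0) -> hpoly d k w.
Proof.
  revert w; induction k as [|k IH]; intros w Hw; [apply (hpoly_const d 0); auto|].
  apply (hpoly_step d k w (fun _ _ => 0)).
  - intros i Hi. apply IH; auto.
  - intros y Hy. rewrite Hw by auto. symmetry. apply sumR_0. intros; ring.
Qed.

(* The partial derivatives of order [k] of [w] are harmonic and homogeneous of negative degree,
   and hence vanish by the maximum principle. *)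
Lemma harmonic_homog_poly (d : nat) : (4 <= d)%nat -> forall (k : nat) (t : R) (w : pt -> R),
  INR k - 1 <= t < INR k -> hom_eig d t 0 w ->
  (forall y, inU d y -> w y = 0) \/ exists k', k = S k' /\ t = INR k' /\ hpoly d k' w.
Proof.
  intros Hd. induction k as [|k IH]; intros t w Ht Hw.
  (* For $-1 \le t < 0$ and $d \ge 4$ one has $t (t + d - 2) < 0$. *)
  - left. simpl in Ht. apply (max_principle d t 0); auto; [lia|].
    apply (le_INR 4 d) in Hd. simpl in Hd. nra.
  - rewrite S_INR in Ht. destruct Hw as [Hs [Hh HL]] eqn:E. clear E.
    destruct (smooth_partials d w Hs) as [G HG].
    assert (HE : forall y, inU d y -> sumR d (fun i => y i * G i y) = t * w y).
    { intros y Hy. apply euler; auto. intros i Hi. split; [apply HG; auto|].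
      apply smooth_cont, HG; auto. }
    assert (HI : forall i, (i < d)%nat -> (forall y, inU d y -> G i y = 0) \/
      exists k', k = S k' /\ t - 1 = INR k' /\ hpoly d k' (G i)).
    { intros i Hi. apply IH; [lra|]. apply (hom_eig_partial d i t w); auto; apply HG; auto. }
    destruct k as [|k].
    + assert (H0 : forall i, (i < d)%nat -> forall y, inU d y -> G i y = 0).
      { intros i Hi. destruct (HI i Hi) as [H|[k' [Hk _]]]; [auto|discriminate]. }
      simpl in Ht. destruct (Req_dec t 0) as [->|Hne].
      * right. exists 0%nat. repeat split.
        destruct (const_of_partials d w) as [c Hc]; [lia| |apply (hpoly_const d c); auto].
        intros i Hi. apply (partial_on_ext d i w w (G i)); auto. apply HG; auto.
      * left. intros y Hy. specialize (HE y Hy). rewrite sumR_0 in HE; [nra|].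
        intros i Hi. rewrite H0 by auto. ring.
    + assert (Ht0 : 0 < t). { rewrite S_INR in Ht. pose proof (pos_INR k). lra. }
      destruct (classic (t - 1 = INR k)) as [He|Hne].
      * right. exists (S k). split; [auto|]. split; [rewrite S_INR; lra|].
        apply (hpoly_step d k w (fun i y => / t * G i y)).
        -- intros i Hi. destruct (HI i Hi) as [H|[k' [Hk [_ H]]]].
           ++ apply hpoly_zero. intros y Hy. rewrite H by auto. ring.
           ++ injection Hk as <-. clear -H. induction H as [c w Hw|k w g Hg IHg Hw].
              ** apply (hpoly_const d (/ t * c)). intros y Hy. rewrite Hw; auto.
              ** apply (hpoly_step d k _ (fun j y => / t * g j y)); auto.
                 intros y Hy. rewrite Hw, <- sumR_scal by auto. apply sumR_ext; intros; ring.
        -- intros y Hy. rewrite (sumR_ext d _ (fun i => / t * (y i * G i y))) by (intros; ring).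
           rewrite sumR_scal, HE by auto. field; lra.
      (* If [t] is not an integer, all the derivatives vanish by induction, and Euler's relation
         with [t > 0] gives [w = 0]. *)
      * left. intros y Hy. specialize (HE y Hy). rewrite sumR_0 in HE; [nra|].
        intros i Hi. destruct (HI i Hi) as [H|[k' [Hk [Ht' _]]]].
        -- rewrite H by auto. ring.
        -- injection Hk as <-. contradiction.
Qed.

(** [lap_eigen] gives the equation on the sphere only; both sides are homogeneous of degree -2,
    which extends it to the punctured space. *)
Lemma hom_eig_ext (d : nat) (F : pt -> R) (lam : R) :
  smooth_sph d F -> lap_eigen d F lam -> hom_eig d 0 (- lam) (ext d F).
Proof.
  intros Hs HL.
  assert (Hh : homog d 0 (ext d F)).
  { intros c y Hc Hy. unfold ext. rewrite normalize_scale by auto.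
    rewrite Rpower_O by auto. ring. }
  split; [exact Hs|split; [exact Hh|]].
  destruct (smooth_partials d (ext d F) Hs) as [G HG].
  assert (HK : forall i, exists K, (i < d)%nat -> partial_on d (G i) i K).
  { intros i. destruct (le_lt_dec d i); [exists (fun _ => 0); lia|].
    destruct (smooth_partial d i (G i)) as [K [HK _]]; [auto|apply HG; auto|].
    exists K; auto. }
  set (K := fun i => proj1_sig (constructive_indefinite_description _ (HK i))).
  assert (HK' : forall i, (i < d)%nat -> partial_on d (G i) i (K i))
    by (intros i; exact (proj2_sig (constructive_indefinite_description _ (HK i)))).
  exists G, K. split; [intros i Hi; split; [apply HG|apply HK']; auto|].
  intros y Hy. set (x := normalize d y).
  assert (Hx : on_sphere d x) by (apply normalize_sphere; auto).
  assert (HxU := sphere_inU d x Hx).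
  assert (HKx : sumR d (fun i => K i x) = - lam * F x).
  { destruct (HL x Hx) as [G' [h [Hh' HS]]]. rewrite <- HS. apply sumR_ext. intros i Hi.
    destruct (Hh' i Hi) as [P1 P2].
    eapply uniqueness_limite; [apply HK'; eauto|].
    destruct (inU_shift d i x Hi HxU) as [rho [Hr Hin]].
    apply (dpl_ext_loc (fun s => G' i (shift x i s)) _ 0 _ rho); auto.
    intros s Hs'. rewrite Rminus_0_r in Hs'.
    apply (partial_on_unique d i (ext d F)); auto. apply HG; auto. }
  rewrite (sumR_ext d _ (fun i => / norm2 d y * K i x)).
  - rewrite sumR_scal, HKx. unfold ext. fold x. field. apply Rgt_not_eq, Hy.
  - intros i Hi.
    assert (H1 : homog d (0 - 1 - 1) (K i)).
    { apply (homog_partial d i _ (G i)); auto. apply (homog_partial d i _ (ext d F)); auto.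
      apply HG; auto. }
    rewrite (homog_normalize d _ _ y H1 Hy). fold x. f_equal.
    unfold Npow. replace ((0 - 1 - 1) / 2) with (Ropp 1) by field.
    rewrite Rpower_Ropp, Rpower_1; [auto|apply Hy].
Qed.

(* [|y| ^ s * F (y / |y|)] is harmonic when [s (s + d - 2) = lam]. *)
Theorem eigenfunction_poly (d : nat) (F : pt -> R) (lam : R) : (4 <= d)%nat ->
  smooth_sph d F -> lap_eigen d F lam ->
  (forall x, on_sphere d x -> F x = 0) \/
  exists (k : nat) (u : pt -> R), lam = INR k * (INR k + INR d - 2) /\ hpoly d k u /\
    hom_eig d (INR k) 0 u /\ forall x, on_sphere d x -> u x = F x.
Proof.
  intros Hd Hs HL. assert (He := hom_eig_ext d F lam Hs HL).
  assert (Hx : forall x, on_sphere d x -> ext d F x = F x).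
  { intros x Hx. unfold ext. rewrite normalize_on_sphere; auto. }
  assert (Hd4 := le_INR 4 d Hd). simpl in Hd4.
  destruct (Rlt_le_dec lam 0) as [Hneg|Hpos].
  { left. intros x Hx'. rewrite <- Hx by auto.
    apply (max_principle d 0 (- lam)); auto; [lia|nra|apply sphere_inU; auto]. }
  set (D := INR d - 2) in *.
  (* The nonnegative root of $s (s + D) = \lambda$. *)
  set (s := (- D + sqrt (D ^ 2 + 4 * lam)) / 2).
  assert (Hq : 0 <= D ^ 2 + 4 * lam) by (pose proof (pow2_ge_0 D); lra).
  assert (HD : 2 <= D) by (unfold D; lra).
  assert (Hss : s * (s + D) = lam).
  { unfold s. replace ((- D + sqrt (D ^ 2 + 4 * lam)) / 2 * ((- D + sqrt (D ^ 2 + 4 * lam)) / 2 + D))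
      with ((sqrt (D ^ 2 + 4 * lam) * sqrt (D ^ 2 + 4 * lam) - D ^ 2) / 4) by field.
    rewrite sqrt_sqrt by auto. field. }
  assert (Hs0 : 0 <= s).
  { unfold s. assert (D <= sqrt (D ^ 2 + 4 * lam)); [|lra].
    rewrite <- (sqrt_pow2 D) at 1 by lra. apply sqrt_le_1; auto; [apply pow2_ge_0|lra]. }
  pose proof (hom_eig_Npow d 0 (- lam) (s / 2) _ He) as Hu.
  replace (2 * (s / 2) + 0) with s in Hu by field.
  replace (- lam + 4 * (s / 2) * 0 + 2 * (s / 2) * (2 * (s / 2) + INR d - 2)) with 0 in Hu
    by (rewrite <- Hss; unfold D; field).
  set (u := fun y => Npow d (s / 2) y * ext d F y) in *.
  assert (Hux : forall x, on_sphere d x -> u x = F x).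
  { intros x Hx'. unfold u. rewrite Hx by auto. unfold Npow. rewrite (proj2 Hx').
    unfold Rpower. rewrite ln_1, Rmult_0_r, exp_0. ring. }
  destruct (nfloor_ex s Hs0) as [k Hk].
  destruct (harmonic_homog_poly d Hd (S k) s u) as [H|[k' [_ [Hk' Hp]]]]; auto.
  - rewrite S_INR; lra.
  - left. intros x Hx'. rewrite <- Hux by auto. apply H, sphere_inU; auto.
  - right. exists k', u. rewrite <- Hk'. repeat split; auto; [|apply Hu..].
    rewrite <- Hss. unfold D; ring.
Qed.

(** Multiplication by $|y|^{-k}$ produces the extension of degree 0, and [hom_eig_Npow] with $a =
    -k/2$ gives $-k (k + d - 2)$ for the new [kap]. *)
Lemma poly_eigenfunction (d k : nat) (u : pt -> R) : hom_eig d (INR k) 0 u ->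
  smooth_sph d u /\ lap_eigen d u (INR k * (INR k + INR d - 2)).
Proof.
  intros Hu. pose proof (hom_eig_Npow d (INR k) 0 (- INR k / 2) u Hu) as H.
  assert (He : forall y, inU d y -> Npow d (- INR k / 2) y * u y = ext d u y).
  { intros y Hy. destruct Hu as [_ [Hh _]]. unfold ext.
    rewrite (homog_normalize d _ u y Hh Hy). unfold Npow.
    rewrite <- Rmult_assoc, <- Rpower_plus.
    replace (- INR k / 2 + INR k / 2) with 0 by field. rewrite Rpower_O by apply Hy. ring. }
  destruct H as [Hs [_ [G [K [HP HK]]]]]. split.
  - intros n. apply (Cn_ext d n _ _ He), Hs.
  - intros x Hx. assert (HxU := sphere_inU d x Hx). exists G, (fun i => K i x). split.
    + intros i Hi. destruct (HP i Hi) as [P1 P2]. split; [|apply P2; auto].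
      apply (partial_on_ext d i _ _ _ (G i) Hi He) in P1; auto.
    + rewrite HK, He by auto. rewrite (proj2 Hx). unfold ext. rewrite normalize_on_sphere by auto.
      field.
Qed.

(** * Polynomials in complex coordinates *)

Fixpoint inc (j : nat) (e : list nat) : list nat :=
  match e, j with
  | nil, _ => nil
  | a :: e', O => S a :: e'
  | a :: e', S j' => a :: inc j' e'
  end.

Fixpoint dec (j : nat) (e : list nat) : list nat :=
  match e, j with
  | nil, _ => nil
  | a :: e', O => pred a :: e'
  | a :: e', S j' => a :: dec j' e'
  end.

Definition deg (e : list nat) : nat := list_sum e.

Lemma inc_length (j : nat) (e : list nat) : length (inc j e) = length e.
Proof. revert j; induction e as [|a e IH]; intros [|j]; simpl; auto. Qed.

Lemma dec_length (j : nat) (e : list nat) : length (dec j e) = length e.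
Proof. revert j; induction e as [|a e IH]; intros [|j]; simpl; auto. Qed.

Lemma dec_inc (j : nat) (e : list nat) : dec j (inc j e) = e.
Proof. revert j; induction e as [|a e IH]; intros [|j]; simpl; f_equal; auto. Qed.

Lemma inc_dec (j : nat) (e : list nat) : nth j e 0%nat <> 0%nat -> inc j (dec j e) = e.
Proof.
  revert j; induction e as [|a e IH]; intros [|j] H; simpl in *; f_equal; auto; lia.
Qed.

Lemma nth_inc (i j : nat) (e : list nat) : (j < length e)%nat ->
  nth i (inc j e) 0%nat = if Nat.eqb i j then S (nth i e 0%nat) else nth i e 0%nat.
Proof.
  revert i j; induction e as [|a e IH]; intros [|i] [|j] H; simpl in *; auto; try lia.
  apply IH; lia.
Qed.

Lemma nth_dec (i j : nat) (e : list nat) :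
  nth i (dec j e) 0%nat = if Nat.eqb i j then pred (nth i e 0%nat) else nth i e 0%nat.
Proof.
  revert i j; induction e as [|a e IH]; intros [|i] [|j]; simpl in *; auto.
  destruct (Nat.eqb i j); auto.
Qed.

Lemma dec_comm (i j : nat) (e : list nat) : dec i (dec j e) = dec j (dec i e).
Proof. revert i j; induction e as [|a e IH]; intros [|i] [|j]; simpl; f_equal; auto. Qed.

Lemma inc_comm (i j : nat) (e : list nat) : inc i (inc j e) = inc j (inc i e).
Proof. revert i j; induction e as [|a e IH]; intros [|i] [|j]; simpl; f_equal; auto. Qed.

Lemma deg_inc (j : nat) (e : list nat) : (j < length e)%nat -> deg (inc j e) = S (deg e).
Proof.
  unfold deg. revert j; induction e as [|a e IH]; intros [|j] H; simpl in *; try lia.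
  rewrite IH; lia.
Qed.

Lemma deg_dec (j : nat) (e : list nat) : nth j e 0%nat <> 0%nat -> deg e = S (deg (dec j e)).
Proof.
  unfold deg. revert j; induction e as [|a e IH]; intros [|j] H; simpl in *; try lia.
  rewrite (IH j); lia.
Qed.

Lemma deg_pos (e : list nat) : (0 < deg e)%nat ->
  exists j, (j < length e)%nat /\ nth j e 0%nat <> 0%nat.
Proof.
  unfold deg. induction e as [|a e IH]; simpl; intros H; [lia|].
  destruct (Nat.eq_dec a 0) as [->|Ha]; [|exists 0%nat; split; [lia|auto]].
  destruct IH as [j [H1 H2]]; [lia|]. exists (S j); split; auto; lia.
Qed.

Lemma deg_0 (e : list nat) : deg e = 0%nat -> e = repeat 0%nat (length e).
Proof. unfold deg. induction e as [|a e IH]; simpl; intros H; f_equal; try lia. apply IH; lia. Qed.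

(* In [zeta n x] the first [n] pairs of real coordinates of [x] are replaced by the complex
   coordinate and its conjugate. *)
Definition zeta (n : nat) (x : pt) : nat -> C := fun j =>
  if (j <? 2 * n)%nat then (if Nat.even j then (x j, x (S j)) else (x (pred j), - x j))
  else (x j, 0).

Fixpoint cmono (z : nat -> C) (e : list nat) : C :=
  match e with
  | nil => RtoC 1
  | a :: e' => (Cpow (z 0%nat) a * cmono (fun j => z (S j)) e')%C
  end.

(** Real coefficients, monomials in [zeta]. A monomial may occur several times, so only [coef] is
    meaningful. *)
Definition poly := list (R * list nat).

Definition evC (n : nat) (p : poly) (x : pt) : C :=
  fold_right (fun t s => (RtoC (fst t) * cmono (zeta n x) (snd t) + s)%C) (RtoC 0) p.

(* [Re m + Im m], for [m] ranging over the monomials in [zeta], is a basis of the real polynomials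
   on which rotations of the coordinate planes act almost diagonally; [Re m - Im m] is the
   element of that basis attached to the conjugate of [m]. *)
Definition ev (n : nat) (p : poly) (x : pt) : R := fst (evC n p x) + snd (evC n p x).
Definition evm (n : nat) (p : poly) (x : pt) : R := fst (evC n p x) - snd (evC n p x).

Definition coef (p : poly) (e : list nat) : R :=
  fold_right (fun t s => (if list_eq_dec Nat.eq_dec (snd t) e then fst t else 0) + s) 0 p.

Definition pscale (c : R) (p : poly) : poly := map (fun t => (c * fst t, snd t)) p.

Fixpoint pder (j : nat) (p : poly) : poly :=
  match p with
  | nil => nil
  | (c, e) :: p' =>
      if Nat.eq_dec (nth j e 0%nat) 0 then pder j p'
      else (c * INR (nth j e 0%nat), dec j e) :: pder j p'
  end.

Definition pinc (j : nat) (p : poly) : poly := map (fun t => (fst t, inc j (snd t))) p.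

Definition pwf (d k : nat) (p : poly) : Prop :=
  forall t, In t p -> length (snd t) = d /\ deg (snd t) = k.

Fixpoint psum (m : nat) (f : nat -> poly) : poly :=
  match m with O => nil | S m' => psum m' f ++ f m' end.

Lemma evC_app (n : nat) (p q : poly) (x : pt) : evC n (p ++ q) x = (evC n p x + evC n q x)%C.
Proof.
  unfold evC in *. induction p as [|t p IH]; cbn [app fold_right]; [ring|]. rewrite IH. ring.
Qed.

Lemma ev_app (n : nat) (p q : poly) (x : pt) : ev n (p ++ q) x = ev n p x + ev n q x.
Proof. unfold ev. rewrite evC_app. simpl. ring. Qed.

Lemma evm_app (n : nat) (p q : poly) (x : pt) : evm n (p ++ q) x = evm n p x + evm n q x.
Proof. unfold evm. rewrite evC_app. simpl. ring. Qed.

Lemma evC_scale (n : nat) (c : R) (p : poly) (x : pt) :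
  evC n (pscale c p) x = (RtoC c * evC n p x)%C.
Proof.
  unfold evC, pscale. induction p as [|t p IH]; cbn [map fold_right fst snd]; [ring|].
  rewrite IH, RtoC_mult. ring.
Qed.

Lemma ev_scale (n : nat) (c : R) (p : poly) (x : pt) : ev n (pscale c p) x = c * ev n p x.
Proof. unfold ev. rewrite evC_scale. simpl. ring. Qed.

Lemma evm_scale (n : nat) (c : R) (p : poly) (x : pt) : evm n (pscale c p) x = c * evm n p x.
Proof. unfold evm. rewrite evC_scale. simpl. ring. Qed.

Lemma ev_psum (n m : nat) (f : nat -> poly) (x : pt) :
  ev n (psum m f) x = sumR m (fun i => ev n (f i) x).
Proof.
  induction m as [|m IH]; [unfold ev; simpl; ring|]. cbn [psum sumR]. rewrite ev_app, IH. auto.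
Qed.

Lemma coef_app (p q : poly) (e : list nat) : coef (p ++ q) e = coef p e + coef q e.
Proof.
  unfold coef in *. induction p as [|t p IH]; cbn [app fold_right]; [ring|]. rewrite IH. ring.
Qed.

Lemma coef_map (f : list nat -> R) (p : poly) (e : list nat) :
  coef (map (fun t => (f (snd t) * fst t, snd t)) p) e = f e * coef p e.
Proof.
  unfold coef in *. induction p as [|t p IH]; cbn [map fold_right fst snd]; [ring|]. rewrite IH.
  destruct (list_eq_dec Nat.eq_dec (snd t) e) as [->|]; ring.
Qed.

Lemma coef_scale (c : R) (p : poly) (e : list nat) : coef (pscale c p) e = c * coef p e.
Proof. apply (coef_map (fun _ => c)). Qed.

Lemma coef_psum (m : nat) (f : nat -> poly) (e : list nat) :
  coef (psum m f) e = sumR m (fun i => coef (f i) e).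
Proof. induction m as [|m IH]; [auto|]. cbn [psum sumR]. rewrite coef_app, IH. auto. Qed.

Lemma coef_pder (j : nat) (p : poly) (e : list nat) : (j < length e)%nat ->
  coef (pder j p) e = INR (S (nth j e 0%nat)) * coef p (inc j e).
Proof.
  intros Hj. induction p as [|[c e'] p IH]; [cbn; ring|].
  cbn [pder]. change (coef ((c, e') :: p) (inc j e)) with
    ((if list_eq_dec Nat.eq_dec e' (inc j e) then c else 0) + coef p (inc j e)).
  rewrite Rmult_plus_distr_l, <- IH. clear IH.
  destruct (Nat.eq_dec (nth j e' 0%nat) 0) as [H0|H0].
  - destruct (list_eq_dec Nat.eq_dec e' (inc j e)) as [->|_]; [|ring].
    rewrite nth_inc, Nat.eqb_refl in H0 by auto. discriminate.
  - cbn [coef fold_right fst snd]. fold (coef (pder j p) e). f_equal.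
    destruct (list_eq_dec Nat.eq_dec (dec j e') e) as [He|He];
      destruct (list_eq_dec Nat.eq_dec e' (inc j e)) as [He'|He'].
    + subst e'. rewrite nth_inc, Nat.eqb_refl by auto. ring.
    + exfalso. apply He'. rewrite <- He, inc_dec; auto.
    + exfalso. apply He. rewrite He', dec_inc; auto.
    + ring.
Qed.

Lemma coef_deg (d k : nat) (p : poly) (e : list nat) : pwf d k p -> deg e <> k -> coef p e = 0.
Proof.
  intros Hp He. induction p as [|t p IH]; auto. cbn [coef fold_right]. fold (coef p e).
  rewrite IH by (intros s Hs; apply Hp; right; auto).
  destruct (list_eq_dec Nat.eq_dec (snd t) e) as [Ht|]; [|ring].
  destruct (Hp t) as [_ H]; [left; auto|]. congruence.
Qed.

Lemma pwf_app (d k : nat) (p q : poly) : pwf d k p -> pwf d k q -> pwf d k (p ++ q).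
Proof. intros Hp Hq t Ht. apply in_app_or in Ht. destruct Ht; auto. Qed.

Lemma pwf_scale (d k : nat) (c : R) (p : poly) : pwf d k p -> pwf d k (pscale c p).
Proof.
  intros Hp t Ht. apply in_map_iff in Ht. destruct Ht as [s [<- Hs]]. simpl. apply Hp; auto.
Qed.

Lemma pwf_psum (d k m : nat) (f : nat -> poly) :
  (forall i, (i < m)%nat -> pwf d k (f i)) -> pwf d k (psum m f).
Proof.
  induction m as [|m IH]; intros H; [intros t []|]. apply pwf_app; [apply IH; intros; apply H|apply H]; lia.
Qed.

Lemma pwf_pder (d k j : nat) (p : poly) : pwf d (S k) p -> pwf d k (pder j p).
Proof.
  intros Hp. induction p as [|[c e] p IH]; [intros t []|].
  assert (IH' := IH (fun t Ht => Hp t (or_intror Ht))). cbn [pder].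
  destruct (Nat.eq_dec (nth j e 0%nat) 0) as [|H0]; auto.
  intros t [<-|Ht]; auto. destruct (Hp (c, e)) as [H1 H2]; [left; auto|]. simpl in *.
  rewrite dec_length. split; auto. rewrite (deg_dec j e H0) in H2. lia.
Qed.

Lemma pwf_pinc (d k j : nat) (p : poly) : (j < d)%nat -> pwf d k p -> pwf d (S k) (pinc j p).
Proof.
  intros Hj Hp t Ht. apply in_map_iff in Ht. destruct Ht as [s [<- Hs]]. simpl.
  destruct (Hp s Hs) as [H1 H2]. rewrite inc_length, deg_inc by lia. auto.
Qed.

Lemma pder_app (j : nat) (p q : poly) : pder j (p ++ q) = pder j p ++ pder j q.
Proof.
  induction p as [|[c e] p IH]; auto. cbn [pder app].
  destruct (Nat.eq_dec (nth j e 0%nat) 0); rewrite IH; auto.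
Qed.

Lemma pder_scale (j : nat) (c : R) (p : poly) : pder j (pscale c p) = pscale c (pder j p).
Proof.
  induction p as [|[a e] p IH]; auto. cbn [pder pscale map fst snd].
  destruct (Nat.eq_dec (nth j e 0%nat) 0); [exact IH|].
  cbn [map fst snd]. rewrite Rmult_assoc. f_equal. exact IH.
Qed.

Lemma evC_pder_comm (n i j : nat) (p : poly) (x : pt) :
  evC n (pder i (pder j p)) x = evC n (pder j (pder i p)) x.
Proof.
  induction p as [|[c e] p IH]; auto.
  destruct (Nat.eq_dec i j) as [->|Hij]; auto.
  cbn [pder]. destruct (Nat.eq_dec (nth j e 0%nat) 0) as [Hj|Hj];
    destruct (Nat.eq_dec (nth i e 0%nat) 0) as [Hi|Hi]; cbn [pder]; rewrite ?nth_dec; auto.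
  - destruct (Nat.eqb_spec j i); [congruence|].
    destruct (Nat.eq_dec (nth j e 0%nat) 0); [auto|congruence].
  - destruct (Nat.eqb_spec i j); [congruence|].
    destruct (Nat.eq_dec (nth i e 0%nat) 0); [auto|congruence].
  - destruct (Nat.eqb_spec i j); [congruence|]. destruct (Nat.eqb_spec j i); [congruence|].
    destruct (Nat.eq_dec (nth i e 0%nat) 0); [congruence|].
    destruct (Nat.eq_dec (nth j e 0%nat) 0); [congruence|].
    cbn [evC fold_right fst snd]. unfold evC in IH. rewrite IH, dec_comm.
    f_equal. f_equal. rewrite !RtoC_mult. ring.
Qed.

Definition dC (f : R -> C) (l : C) : Prop :=
  derivable_pt_lim (fun t => fst (f t)) 0 (fst l) /\
  derivable_pt_lim (fun t => snd (f t)) 0 (snd l).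

Lemma dC_const (c : C) : dC (fun _ => c) (RtoC 0).
Proof. split; apply derivable_pt_lim_const. Qed.

Lemma dC_plus (f g : R -> C) (l m : C) : dC f l -> dC g m -> dC (fun t => (f t + g t)%C) (l + m)%C.
Proof.
  intros [F1 F2] [G1 G2]; split.
  - apply (derivable_pt_lim_plus (fun t => fst (f t)) (fun t => fst (g t))); auto.
  - apply (derivable_pt_lim_plus (fun t => snd (f t)) (fun t => snd (g t))); auto.
Qed.

Lemma dC_mult (f g : R -> C) (l m : C) : dC f l -> dC g m ->
  dC (fun t => (f t * g t)%C) (l * g 0%R + f 0%R * m)%C.
Proof.
  intros [F1 F2] [G1 G2]; split.
  - pose proof (derivable_pt_lim_minus _ _ _ _ _ (derivable_pt_lim_mult _ _ _ _ _ F1 G1)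
      (derivable_pt_lim_mult _ _ _ _ _ F2 G2)) as H.
    match type of H with derivable_pt_lim _ _ ?v => replace (fst _) with v by (simpl; ring) end.
    exact H.
  - pose proof (derivable_pt_lim_plus _ _ _ _ _ (derivable_pt_lim_mult _ _ _ _ _ F1 G2)
      (derivable_pt_lim_mult _ _ _ _ _ F2 G1)) as H.
    match type of H with derivable_pt_lim _ _ ?v => replace (snd _) with v by (simpl; ring) end.
    exact H.
Qed.

Lemma dC_eq (f : R -> C) (l m : C) : l = m -> dC f l -> dC f m.
Proof. intros ->; auto. Qed.

Lemma dC_pow (f : R -> C) (l : C) (a : nat) : dC f l ->
  dC (fun t => Cpow (f t) a) (RtoC (INR a) * Cpow (f 0%R) (pred a) * l)%C.
Proof.
  intros Hf. induction a as [|a IH].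
  - eapply dC_eq; [|exact (dC_const (RtoC 1))]. simpl INR. ring.
  - eapply dC_eq; [|apply (dC_mult f (fun t => Cpow (f t) a) _ _ Hf IH)].
    rewrite S_INR, RtoC_plus. destruct a as [|a]; cbn [pred Cpow]; [simpl INR|]; ring.
Qed.

(** The derivative of [cmono] at [z] in the direction [dl], by the product rule. *)
Fixpoint dmono (z dl : nat -> C) (e : list nat) : C :=
  match e with
  | nil => RtoC 0
  | a :: e' => (RtoC (INR a) * Cpow (z 0%nat) (pred a) * dl 0%nat * cmono (fun j => z (S j)) e'
                + Cpow (z 0%nat) a * dmono (fun j => z (S j)) (fun j => dl (S j)) e')%C
  end.

Lemma dC_cmono (z : R -> nat -> C) (dl : nat -> C) (e : list nat) :
  (forall j, dC (fun t => z t j) (dl j)) -> dC (fun t => cmono (z t) e) (dmono (z 0%R) dl e).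
Proof.
  revert z dl; induction e as [|a e IH]; intros z dl H; [exact (dC_const (RtoC 1))|].
  apply (dC_mult (fun t => Cpow (z t 0%nat) a) (fun t => cmono (fun j => z t (S j)) e)).
  - apply dC_pow, H.
  - apply (IH (fun t j => z t (S j))). intros j; apply H.
Qed.

Lemma dmono_plus (z dl dl' : nat -> C) (e : list nat) :
  dmono z (fun j => dl j + dl' j)%C e = (dmono z dl e + dmono z dl' e)%C.
Proof.
  revert z dl dl'; induction e as [|a e IH]; intros z dl dl'; cbn [dmono]; [ring|].
  rewrite (IH _ (fun j => dl (S j)) (fun j => dl' (S j))). ring.
Qed.

Lemma dmono_0 (z : nat -> C) (e : list nat) : dmono z (fun _ => RtoC 0) e = RtoC 0.
Proof.
  revert z; induction e as [|a e IH]; intros z; cbn [dmono]; auto. rewrite IH. ring.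
Qed.

Lemma dmono_single (z : nat -> C) (j : nat) (dl : C) (e : list nat) :
  dmono z (fun k => if Nat.eqb k j then dl else RtoC 0) e =
  (RtoC (INR (nth j e 0%nat)) * dl * cmono z (dec j e))%C.
Proof.
  revert z j; induction e as [|a e IH]; intros z [|j]; cbn [dmono nth dec]; try (simpl; ring).
  - cbn [Nat.eqb]. rewrite dmono_0. cbn [cmono]. ring.
  - cbn [Nat.eqb]. rewrite IH. cbn [cmono]. ring.
Qed.

Lemma evC_dmono (n j : nat) (dl : C) (p : poly) (x : pt) :
  fold_right (fun t s => (RtoC (fst t) *
    dmono (zeta n x) (fun k => if Nat.eqb k j then dl else RtoC 0) (snd t) + s)%C) (RtoC 0) p
  = (dl * evC n (pder j p) x)%C.
Proof.
  induction p as [|[c e] p IH]; cbn [fold_right pder]; [cbn [evC fold_right]; ring|].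
  rewrite IH. cbn [fst snd]. rewrite dmono_single.
  destruct (Nat.eq_dec (nth j e 0%nat) 0) as [H|H].
  - rewrite H. simpl INR. ring.
  - cbn [evC fold_right fst snd]. fold (evC n (pder j p) x). rewrite RtoC_mult. ring.
Qed.

Lemma dC_evC (n : nat) (p : poly) (z : R -> pt) (dl : nat -> C) :
  (forall j, dC (fun t => zeta n (z t) j) (dl j)) ->
  dC (fun t => evC n p (z t)) (fold_right (fun t s => (RtoC (fst t) *
    dmono (zeta n (z 0)) dl (snd t) + s)%C) (RtoC 0) p).
Proof.
  intros H. induction p as [|[c e] p IH]; [exact (dC_const (RtoC 0))|].
  cbn [evC fold_right fst snd].
  apply (dC_plus (fun t => RtoC c * cmono (zeta n (z t)) e)%C (fun t => evC n p (z t))); auto.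
  eapply dC_eq; [|apply (dC_mult (fun _ => RtoC c) (fun t => cmono (zeta n (z t)) e)
    _ _ (dC_const _) (dC_cmono (fun t => zeta n (z t)) dl e H))]. ring.
Qed.

Lemma dC_lin (a b : R -> R) (l m : R) : derivable_pt_lim a 0 l -> derivable_pt_lim b 0 m ->
  dC (fun t => (a t, b t)) (l, m).
Proof. intros H1 H2; split; auto. Qed.

Lemma shift_coord_dpl (x : pt) (i j : nat) :
  derivable_pt_lim (fun t => shift x i t j) 0 (if Nat.eqb j i then 1 else 0).
Proof.
  unfold shift. destruct (Nat.eqb j i); [|apply derivable_pt_lim_const].
  apply is_derive_Reals. auto_derive; auto.
Qed.

Lemma dC_zeta (n i j : nat) (x : pt) :
  dC (fun t => zeta n (shift x i t) j) (zeta n (fun k => if Nat.eqb k i then 1 else 0) j).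
Proof.
  unfold zeta. destruct (j <? 2 * n)%nat; [destruct (Nat.even j)|].
  - apply dC_lin; apply shift_coord_dpl.
  - apply dC_lin; [apply shift_coord_dpl|].
    apply (derivable_pt_lim_opp (fun t => shift x i t j)), shift_coord_dpl.
  - apply dC_lin; [apply shift_coord_dpl|apply derivable_pt_lim_const].
Qed.

(** Moving $x$ moves both $z$ and $\bar z$ by 1, hence $\partial_x = \partial_z + \partial_{\bar
    z}$; the next lemma similarly yields $\partial_y = i (\partial_z - \partial_{\bar z})$. *)
Lemma zeta_unit_even (n a : nat) : (a < n)%nat ->
  zeta n (fun k => if Nat.eqb k (2 * a) then 1 else 0) =
  fun j => ((if Nat.eqb j (2 * a) then RtoC 1 else RtoC 0) +
            (if Nat.eqb j (2 * a + 1) then RtoC 1 else RtoC 0))%C.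
Proof.
  intros Ha. apply functional_extensionality; intros j. unfold zeta.
  destruct (Nat.ltb_spec j (2 * n)).
  - destruct (Nat.even j) eqn:E.
    + apply Nat.even_spec in E. destruct E as [b ->].
      destruct (Nat.eqb_spec (2 * b) (2 * a)); destruct (Nat.eqb_spec (S (2 * b)) (2 * a));
      destruct (Nat.eqb_spec (2 * b) (2 * a + 1)); try lia;
      apply injective_projections; simpl; ring.
    + rewrite <- Nat.negb_odd in E. apply Bool.negb_false_iff, Nat.odd_spec in E.
      destruct E as [b ->].
      destruct (Nat.eqb_spec (pred (2 * b + 1)) (2 * a)); destruct (Nat.eqb_spec (2 * b + 1) (2 * a));
      destruct (Nat.eqb_spec (2 * b + 1) (2 * a + 1)); try lia;
      apply injective_projections; simpl; ring.
  - destruct (Nat.eqb_spec j (2 * a)); destruct (Nat.eqb_spec j (2 * a + 1)); try lia;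
      apply injective_projections; simpl; ring.
Qed.

Lemma zeta_unit_odd (n a : nat) : (a < n)%nat ->
  zeta n (fun k => if Nat.eqb k (2 * a + 1) then 1 else 0) =
  fun j => ((if Nat.eqb j (2 * a) then Ci else RtoC 0) +
            (if Nat.eqb j (2 * a + 1) then - Ci else RtoC 0))%C.
Proof.
  intros Ha. apply functional_extensionality; intros j. unfold zeta.
  destruct (Nat.ltb_spec j (2 * n)).
  - destruct (Nat.even j) eqn:E.
    + apply Nat.even_spec in E. destruct E as [b ->].
      destruct (Nat.eqb_spec (2 * b) (2 * a)); destruct (Nat.eqb_spec (S (2 * b)) (2 * a + 1));
      destruct (Nat.eqb_spec (2 * b) (2 * a + 1)); try lia;
      apply injective_projections; simpl; ring.
    + rewrite <- Nat.negb_odd in E. apply Bool.negb_false_iff, Nat.odd_spec in E.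
      destruct E as [b ->].
      destruct (Nat.eqb_spec (pred (2 * b + 1)) (2 * a + 1)); destruct (Nat.eqb_spec (2 * b + 1) (2 * a));
      destruct (Nat.eqb_spec (2 * b + 1) (2 * a + 1)); try lia;
      apply injective_projections; simpl; ring.
  - destruct (Nat.eqb_spec j (2 * a)); destruct (Nat.eqb_spec j (2 * a + 1)); try lia;
      apply injective_projections; simpl; ring.
Qed.

Lemma zeta_unit_real (n i : nat) : (2 * n <= i)%nat ->
  zeta n (fun k => if Nat.eqb k i then 1 else 0) = fun j => if Nat.eqb j i then RtoC 1 else RtoC 0.
Proof.
  intros Ha. apply functional_extensionality; intros j. unfold zeta.
  destruct (Nat.ltb_spec j (2 * n)).
  - destruct (Nat.eqb_spec j i); [lia|]. destruct (Nat.even j) eqn:E.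
    + apply Nat.even_spec in E. destruct E as [b ->].
      destruct (Nat.eqb_spec (S (2 * b)) i); [lia|]. auto.
    + destruct (Nat.eqb_spec (pred j) i); [lia|]. apply injective_projections; simpl; ring.
  - destruct (Nat.eqb_spec j i); auto.
Qed.

Lemma fold_dmono_plus (n : nat) (p : poly) (x : pt) (dl dl' : nat -> C) :
  fold_right (fun t s => (RtoC (fst t) *
    dmono (zeta n x) (fun j => dl j + dl' j)%C (snd t) + s)%C) (RtoC 0) p =
  (fold_right (fun t s => (RtoC (fst t) * dmono (zeta n x) dl (snd t) + s)%C) (RtoC 0) p +
   fold_right (fun t s => (RtoC (fst t) * dmono (zeta n x) dl' (snd t) + s)%C) (RtoC 0) p)%C.
Proof.
  induction p as [|t p IH]; cbn [fold_right]; [ring|]. rewrite IH, dmono_plus. ring.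
Qed.

Lemma dC_evC_even (n a : nat) (p : poly) (x : pt) : (a < n)%nat ->
  dC (fun t => evC n p (shift x (2 * a) t)) (evC n (pder (2 * a) p ++ pder (2 * a + 1) p) x).
Proof.
  intros Ha. eapply dC_eq; [|apply (dC_evC n p (shift x (2 * a)) _ (fun j => dC_zeta n _ j x))].
  rewrite zeta_unit_even, fold_dmono_plus, !evC_dmono, shift_0, evC_app by auto. ring.
Qed.

Lemma dC_evC_odd (n a : nat) (p : poly) (x : pt) : (a < n)%nat ->
  dC (fun t => evC n p (shift x (2 * a + 1) t))
     (Ci * evC n (pder (2 * a) p ++ pscale (-1) (pder (2 * a + 1) p)) x)%C.
Proof.
  intros Ha. eapply dC_eq; [|apply (dC_evC n p (shift x (2 * a + 1)) _ (fun j => dC_zeta n _ j x))].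
  rewrite zeta_unit_odd, fold_dmono_plus, !evC_dmono, shift_0, evC_app, evC_scale by auto.
  replace (RtoC (-1)) with (- RtoC 1)%C by (apply injective_projections; simpl; ring). ring.
Qed.

Lemma dC_evC_real (n i : nat) (p : poly) (x : pt) : (2 * n <= i)%nat ->
  dC (fun t => evC n p (shift x i t)) (evC n (pder i p) x).
Proof.
  intros Ha. eapply dC_eq; [|apply (dC_evC n p (shift x i) _ (fun j => dC_zeta n _ j x))].
  rewrite zeta_unit_real, evC_dmono, shift_0 by auto. ring.
Qed.

Lemma dC_ev (f : R -> C) (l : C) : dC f l ->
  derivable_pt_lim (fun t => fst (f t) + snd (f t)) 0 (fst l + snd l).
Proof.
  intros [H1 H2]. apply (derivable_pt_lim_plus (fun t => fst (f t)) (fun t => snd (f t))); auto.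
Qed.

Lemma dC_evm (f : R -> C) (l : C) : dC f l ->
  derivable_pt_lim (fun t => fst (f t) - snd (f t)) 0 (fst l - snd l).
Proof.
  intros [H1 H2]. apply (derivable_pt_lim_minus (fun t => fst (f t)) (fun t => snd (f t))); auto.
Qed.

Lemma partial_ev_even (d n a : nat) (p : poly) : (a < n)%nat ->
  partial_on d (ev n p) (2 * a) (ev n (pder (2 * a) p ++ pder (2 * a + 1) p)).
Proof. intros Ha y Hy. apply dC_ev, dC_evC_even; auto. Qed.

(** The factor $i$ of $\partial_y$ turns [ev] into [evm], since $\mathrm{Re}(iX) + \mathrm{Im}(iX) =
    \mathrm{Re} X - \mathrm{Im} X$. *)
Lemma partial_ev_odd (d n a : nat) (p : poly) : (a < n)%nat ->
  partial_on d (ev n p) (2 * a + 1) (evm n (pder (2 * a) p ++ pscale (-1) (pder (2 * a + 1) p))).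
Proof.
  intros Ha y Hy. pose proof (dC_ev _ _ (dC_evC_odd n a p y Ha)) as H.
  unfold evm. set (X := evC n _ y) in *.
  replace (fst X - snd X) with (fst (Ci * X)%C + snd (Ci * X)%C) by (simpl; ring). exact H.
Qed.

Lemma partial_evm_odd (d n a : nat) (p : poly) : (a < n)%nat ->
  partial_on d (evm n p) (2 * a + 1)
    (fun y => -1 * ev n (pder (2 * a) p ++ pscale (-1) (pder (2 * a + 1) p)) y).
Proof.
  intros Ha y Hy. pose proof (dC_evm _ _ (dC_evC_odd n a p y Ha)) as H.
  unfold ev. set (X := evC n _ y) in *.
  replace (-1 * (fst X + snd X)) with (fst (Ci * X)%C - snd (Ci * X)%C) by (simpl; ring). exact H.
Qed.

Lemma partial_ev_real (d n i : nat) (p : poly) : (2 * n <= i)%nat ->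
  partial_on d (ev n p) i (ev n (pder i p)).
Proof. intros Ha y Hy. apply dC_ev, dC_evC_real; auto. Qed.

Definition smoothC (d : nat) (f : pt -> C) : Prop :=
  smooth d (fun y => fst (f y)) /\ smooth d (fun y => snd (f y)).

Lemma smoothC_const (d : nat) (c : C) : smoothC d (fun _ => c).
Proof. split; intros n; apply Cn_const. Qed.

Lemma smooth_scal (d : nat) (c : R) (F : pt -> R) : smooth d F -> smooth d (fun y => c * F y).
Proof. intros H n. apply (Cn_mult d n (fun _ => c)); [apply Cn_const|apply H]. Qed.

Lemma smooth_minus (d : nat) (F G : pt -> R) :
  smooth d F -> smooth d G -> smooth d (fun y => F y - G y).
Proof.
  intros HF HG n. apply (Cn_ext d n (fun y => F y + -1 * G y)); [intros; ring|].
  apply Cn_plus; [apply HF|]. apply (smooth_scal d (-1) G HG n).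
Qed.

Lemma smoothC_plus (d : nat) (f g : pt -> C) :
  smoothC d f -> smoothC d g -> smoothC d (fun y => f y + g y)%C.
Proof.
  intros [F1 F2] [G1 G2]; split; intros n.
  - apply (Cn_plus d n (fun y => fst (f y)) (fun y => fst (g y))); auto.
  - apply (Cn_plus d n (fun y => snd (f y)) (fun y => snd (g y))); auto.
Qed.

Lemma smoothC_mult (d : nat) (f g : pt -> C) :
  smoothC d f -> smoothC d g -> smoothC d (fun y => f y * g y)%C.
Proof.
  intros [F1 F2] [G1 G2]; split.
  - apply (smooth_minus d (fun y => fst (f y) * fst (g y)) (fun y => snd (f y) * snd (g y)));
      intros n; apply Cn_mult; auto.
  - intros n. apply (Cn_plus d n (fun y => fst (f y) * snd (g y)) (fun y => snd (f y) * fst (g y)));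
      apply Cn_mult; auto.
Qed.

Lemma smoothC_cmono (d : nat) (z : nat -> pt -> C) (e : list nat) :
  (forall j, (j < length e)%nat -> smoothC d (z j)) -> smoothC d (fun y => cmono (fun j => z j y) e).
Proof.
  revert z; induction e as [|a e IH]; intros z H; [exact (smoothC_const d (RtoC 1))|].
  apply (smoothC_mult d (fun y => Cpow (z 0%nat y) a) (fun y => cmono (fun j => z (S j) y) e)).
  - assert (H0 : smoothC d (z 0%nat)) by (apply H; simpl; lia).
    induction a as [|a IHa]; [exact (smoothC_const d (RtoC 1))|]. apply (smoothC_mult d (z 0%nat)); auto.
  - apply (IH (fun j => z (S j))). intros j Hj. apply H. simpl; lia.
Qed.

Lemma smoothC_zeta (d n j : nat) : (2 * n <= d)%nat -> (j < d)%nat ->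
  smoothC d (fun y => zeta n y j).
Proof.
  intros Hn Hj. unfold zeta. destruct (Nat.ltb_spec j (2 * n)); [destruct (Nat.even j) eqn:E|].
  - split; intros k; apply Cn_coord; auto. apply Nat.even_spec in E. destruct E; lia.
  - split; [intros k; apply Cn_coord; lia|].
    intros k. apply (Cn_ext d k (fun y => -1 * y j)); [intros; simpl; ring|].
    apply smooth_scal. intros k'; apply Cn_coord; auto.
  - split; intros k; [apply Cn_coord; auto|exact (Cn_const d k 0)].
Qed.

Lemma smoothC_evC (d n k : nat) (p : poly) : (2 * n <= d)%nat -> pwf d k p ->
  smoothC d (evC n p).
Proof.
  intros Hn Hp. induction p as [|[c e] p IH]; [exact (smoothC_const d (RtoC 0))|].
  apply (smoothC_plus d (fun y => RtoC c * cmono (zeta n y) e)%C (evC n p)).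
  - apply (smoothC_mult d (fun _ => RtoC c)); [apply smoothC_const|].
    apply (smoothC_cmono d (fun j y => zeta n y j)). intros j Hj. apply smoothC_zeta; auto.
    destruct (Hp (c, e)) as [He _]; [left; auto|]. simpl in He. lia.
  - apply IH. intros t Ht. apply Hp. right; auto.
Qed.

Lemma smooth_ev (d n k : nat) (p : poly) : (2 * n <= d)%nat -> pwf d k p -> smooth d (ev n p).
Proof.
  intros Hn Hp m. destruct (smoothC_evC d n k p Hn Hp) as [H1 H2].
  apply (Cn_plus d m (fun y => fst (evC n p y)) (fun y => snd (evC n p y))); auto.
Qed.

Lemma cmono_scale (c : R) (z : nat -> C) (e : list nat) :
  cmono (fun j => RtoC c * z j)%C e = (RtoC (c ^ deg e) * cmono z e)%C.
Proof.
  unfold deg. revert z; induction e as [|a e IH]; intros z; cbn [cmono list_sum fold_right].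
  - rewrite pow_O. ring.
  - rewrite (IH (fun j => z (S j))), Cpow_mult_l, <- RtoC_pow, pow_add, RtoC_mult.
    unfold list_sum. ring.
Qed.

Lemma zeta_scale (n : nat) (c : R) (x : pt) :
  zeta n (scale c x) = fun j => (RtoC c * zeta n x j)%C.
Proof.
  apply functional_extensionality; intros j. unfold zeta, scale.
  destruct (j <? 2 * n)%nat; [destruct (Nat.even j)|];
    apply injective_projections; simpl; ring.
Qed.

Lemma evC_scale_pt (d n k : nat) (p : poly) (c : R) (x : pt) : pwf d k p ->
  evC n p (scale c x) = (RtoC (c ^ k) * evC n p x)%C.
Proof.
  intros Hp. unfold evC. induction p as [|t p IH]; cbn [fold_right]; [ring|].
  rewrite IH by (intros s Hs; apply Hp; right; auto).
  rewrite zeta_scale, cmono_scale. destruct (Hp t) as [_ ->]; [left; auto|]. ring.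
Qed.

Lemma homog_ev (d n k : nat) (p : poly) : pwf d k p -> homog d (INR k) (ev n p).
Proof.
  intros Hp c y Hc Hy. rewrite Rpower_pow by auto. unfold ev.
  rewrite (evC_scale_pt d n k p c y Hp). simpl. ring.
Qed.

(** On each plane $\partial_x^2 + \partial_y^2 = 4 \partial_z \partial_{\bar z}$. *)
Definition plap (n W : nat) (p : poly) : poly :=
  psum n (fun a => pscale 4 (pder (2 * a) (pder (2 * a + 1) p))) ++
  psum W (fun j => pder (2 * n + j) (pder (2 * n + j) p)).

Lemma sumR_split (a b : nat) (f : nat -> R) :
  sumR (a + b) f = sumR a f + sumR b (fun j => f (a + j)%nat).
Proof.
  induction b as [|b IH]; [rewrite Nat.add_0_r; simpl; ring|].
  rewrite Nat.add_succ_r. cbn [sumR]. rewrite IH. ring.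
Qed.

Lemma sumR_double (n : nat) (f : nat -> R) :
  sumR (2 * n) f = sumR n (fun a => f (2 * a)%nat + f (2 * a + 1)%nat).
Proof.
  induction n as [|n IH]; [reflexivity|].
  replace (2 * S n)%nat with (S (S (2 * n))) by lia. cbn [sumR]. rewrite IH.
  replace (S (2 * n)) with (2 * n + 1)%nat by lia. ring.
Qed.

Lemma parity_cases (n d i : nat) (Q : nat -> Prop) :
  (forall a, (a < n)%nat -> Q (2 * a)%nat) -> (forall a, (a < n)%nat -> Q (2 * a + 1)%nat) ->
  (forall i, (2 * n <= i < d)%nat -> Q i) -> (i < d)%nat -> Q i.
Proof.
  intros H1 H2 H3 Hi. destruct (le_lt_dec (2 * n) i) as [|Hlt]; [apply H3; lia|].
  destruct (Nat.Even_or_Odd i) as [[a ->]|[a ->]]; [apply H1|apply H2]; lia.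
Qed.

Lemma laplacian_ev (n W : nat) (p : poly) :
  laplacian_on (2 * n + W) (ev n p) (ev n (plap n W p)).
Proof.
  set (d := (2 * n + W)%nat).
  assert (HGK : forall i, exists GK : (pt -> R) * (pt -> R), (i < d)%nat ->
    partial_on d (ev n p) i (fst GK) /\ partial_on d (fst GK) i (snd GK) /\
    (forall a, i = (2 * a)%nat -> (a < n)%nat -> snd GK =
       ev n (pder i (pder i p ++ pder (i + 1) p) ++ pder (i + 1) (pder i p ++ pder (i + 1) p))) /\
    (forall a, i = (2 * a + 1)%nat -> (a < n)%nat -> snd GK =
       (fun y => -1 * ev n (pder (2 * a) (pder (2 * a) p ++ pscale (-1) (pder i p)) ++
          pscale (-1) (pder i (pder (2 * a) p ++ pscale (-1) (pder i p)))) y)) /\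
    ((2 * n <= i)%nat -> snd GK = ev n (pder i (pder i p)))).
  { intros i. destruct (le_lt_dec d i) as [|Hi]; [exists (fun _ => 0, fun _ => 0); lia|].
    revert Hi. pattern i. apply (parity_cases n (S i)); try lia.
    - intros a Ha. eexists (_, _). intros _. cbn [fst snd].
      split; [|split; [|split; [|split]]].
      + apply partial_ev_even; auto.
      + apply partial_ev_even; auto.
      + intros b Hb _. assert (b = a) by lia. subst. auto.
      + intros b Hb. lia.
      + lia.
    - intros a Ha. eexists (_, _). intros _. cbn [fst snd].
      split; [|split; [|split; [|split]]].
      + apply partial_ev_odd; auto.
      + apply partial_evm_odd; auto.
      + intros b Hb. lia.
      + intros b Hb _. assert (b = a) by lia. subst. auto.
      + lia.
    - intros i' Hi. eexists (_, _). intros _. cbn [fst snd].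
      split; [|split; [|split; [|split]]].
      + apply partial_ev_real; lia.
      + apply partial_ev_real; lia.
      + intros b Hb. lia.
      + intros b Hb. lia.
      + auto. }
  set (GK := fun i => proj1_sig (constructive_indefinite_description _ (HGK i))).
  assert (HGK' := fun i => proj2_sig (constructive_indefinite_description _ (HGK i))).
  fold GK in HGK'. cbv beta in HGK'.
  exists (fun i => fst (GK i)), (fun i => snd (GK i)). split.
  { intros i Hi. destruct (HGK' i Hi) as [H1 [H2 _]]. split; auto. }
  intros y _. unfold d. rewrite sumR_split, sumR_double. unfold plap.
  rewrite ev_app, !ev_psum. f_equal; apply sumR_ext; intros a Ha.
  - destruct (HGK' (2 * a)%nat) as [_ [_ [H1 _]]]; [unfold d; lia|].
    destruct (HGK' (2 * a + 1)%nat) as [_ [_ [_ [H2 _]]]]; [unfold d; lia|].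
    (* Both second derivatives of the plane combine by $(D + D')^2 - (D - D')^2 = 4 D D'$. *)
    unfold GK. rewrite (H1 a), (H2 a) by auto. cbn beta.
    rewrite !pder_app, !pder_scale, !ev_app, !ev_scale, !ev_app, !ev_scale.
    unfold ev. rewrite !(evC_pder_comm n (2 * a + 1) (2 * a)). ring.
  - destruct (HGK' (2 * n + a)%nat) as [_ [_ [_ [_ H]]]]; [unfold d; lia|].
    unfold GK. rewrite H by lia. auto.
Qed.

Lemma coef_plap (n W : nat) (p : poly) (e : list nat) : length e = (2 * n + W)%nat ->
  coef (plap n W p) e =
  sumR n (fun a => 4 * (INR (S (nth (2 * a) e 0%nat)) * (INR (S (nth (2 * a + 1) e 0%nat)) *
    coef p (inc (2 * a) (inc (2 * a + 1) e))))) +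
  sumR W (fun j => INR (S (nth (2 * n + j) e 0%nat)) * (INR (S (S (nth (2 * n + j) e 0%nat))) *
    coef p (inc (2 * n + j) (inc (2 * n + j) e)))).
Proof.
  intros He. unfold plap. rewrite coef_app, !coef_psum. f_equal; apply sumR_ext; intros a Ha.
  - rewrite coef_scale, coef_pder, coef_pder, nth_inc by (rewrite ?inc_length; lia).
    destruct (Nat.eqb_spec (2 * a + 1) (2 * a)); [lia|]. rewrite inc_comm. ring.
  - rewrite coef_pder, coef_pder, nth_inc, Nat.eqb_refl by (rewrite ?inc_length; lia). auto.
Qed.

Lemma pwf_plap (n W k : nat) (p : poly) : pwf (2 * n + W) (S (S k)) p ->
  pwf (2 * n + W) k (plap n W p).
Proof.
  intros Hp. apply pwf_app; apply pwf_psum; intros i Hi; [apply pwf_scale|];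
    apply pwf_pder, pwf_pder; auto.
Qed.

(** Conjugation in every plane. It exchanges [ev] and [evm], so that derivatives in odd coordinates
    can be treated like the others in [ev_independent]. *)
Definition conj_pt (n : nat) (x : pt) : pt :=
  fun j => if andb (j <? 2 * n)%nat (Nat.odd j) then - x j else x j.

Lemma conj_pt_invol (n : nat) (x : pt) : conj_pt n (conj_pt n x) = x.
Proof.
  apply functional_extensionality; intros j. unfold conj_pt.
  destruct (andb (j <? 2 * n)%nat (Nat.odd j)); ring.
Qed.

Lemma inU_conj_pt (d n : nat) (x : pt) : inU d x -> inU d (conj_pt n x).
Proof.
  intros [H1 H2]. split.
  - intros j Hj. unfold conj_pt. rewrite H1 by auto. destruct (andb _ _); ring.
  - replace (norm2 d (conj_pt n x)) with (norm2 d x); auto. apply sumR_ext. intros j _.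
    unfold conj_pt. destruct (andb _ _); ring.
Qed.

Lemma odd_double (b : nat) : Nat.odd (2 * b) = false.
Proof. rewrite Nat.odd_mul. reflexivity. Qed.

Lemma odd_double_1 (b : nat) : Nat.odd (2 * b + 1) = true.
Proof. rewrite Nat.add_1_r, Nat.odd_succ, Nat.even_mul. reflexivity. Qed.

Lemma zeta_conj_pt (n : nat) (x : pt) (j : nat) : zeta n (conj_pt n x) j = Cconj (zeta n x j).
Proof.
  unfold zeta, conj_pt, Cconj. destruct (Nat.ltb_spec j (2 * n)).
  - destruct (Nat.Even_or_Odd j) as [[b ->]|[b ->]].
    + rewrite Nat.even_mul. replace (S (2 * b)) with (2 * b + 1)%nat by lia.
      rewrite odd_double, odd_double_1.
      destruct (Nat.ltb_spec (2 * b) (2 * n)); [|lia].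
      destruct (Nat.ltb_spec (2 * b + 1) (2 * n)); [|lia]. simpl. auto.
    + rewrite <- Nat.negb_odd, odd_double_1. replace (pred (2 * b + 1)) with (2 * b)%nat by lia.
      rewrite odd_double. destruct (Nat.ltb_spec (2 * b) (2 * n)); [|lia]. simpl. auto.
  - simpl. f_equal. ring.
Qed.

Lemma Cconj_pow (c : C) (a : nat) : Cconj (Cpow c a) = Cpow (Cconj c) a.
Proof.
  induction a as [|a IH]; cbn [Cpow]; [apply injective_projections; simpl; ring|].
  rewrite Cmult_conj, IH. auto.
Qed.

Lemma cmono_conj (z z' : nat -> C) (e : list nat) : (forall j, z' j = Cconj (z j)) ->
  cmono z' e = Cconj (cmono z e).
Proof.
  revert z z'; induction e as [|a e IH]; intros z z' H; cbn [cmono].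
  - apply injective_projections; simpl; ring.
  - rewrite Cmult_conj, Cconj_pow, <- H. f_equal. apply (IH (fun j => z (S j))). auto.
Qed.

Lemma evC_conj_pt (n : nat) (p : poly) (x : pt) : evC n p (conj_pt n x) = Cconj (evC n p x).
Proof.
  unfold evC. induction p as [|t p IH]; cbn [fold_right].
  - apply injective_projections; simpl; ring.
  - rewrite Cplus_conj, Cmult_conj, <- IH, <- (cmono_conj _ _ _ (zeta_conj_pt n x)).
    f_equal. f_equal. apply injective_projections; simpl; ring.
Qed.

Lemma evm_conj_pt (n : nat) (p : poly) (x : pt) : evm n p x = ev n p (conj_pt n x).
Proof. unfold evm, ev. rewrite evC_conj_pt. simpl. ring. Qed.

Lemma cmono_repeat0 (z : nat -> C) (m : nat) : cmono z (repeat 0%nat m) = RtoC 1.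
Proof.
  revert z; induction m as [|m IH]; intros z; cbn [repeat cmono]; auto. rewrite IH. cbn [Cpow]. ring.
Qed.

Lemma inU_exists (d : nat) : (1 <= d)%nat -> exists x, inU d x.
Proof.
  intros Hd. exists (fun j => if Nat.eqb j 0 then 1 else 0). apply (inU_intro d 0); auto.
  - intros j Hj. destruct (Nat.eqb_spec j 0); auto; lia.
  - exact R1_neq_R0.
Qed.

(** Induction on the degree: the derivatives of the zero function vanish, so by induction the sum
    and the difference of $\partial_z p$ and $\partial_{\bar z} p$ have zero coefficients, and these
    determine the coefficients of [p]. *)
Theorem ev_independent (d n k : nat) (p : poly) : (1 <= d)%nat -> (2 * n <= d)%nat -> pwf d k p ->
  (forall x, inU d x -> ev n p x = 0) -> forall e, length e = d -> coef p e = 0.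
Proof.
  intros Hd Hn. revert p. induction k as [|k IH]; intros p Hp H0 e He.
  - destruct (Nat.eq_dec (deg e) 0) as [Hdeg|]; [|eapply coef_deg; eauto].
    assert (HC : forall x, evC n p x = RtoC (coef p e)).
    { clear H0. intros x. unfold evC, coef. induction p as [|t p IHp]; cbn [fold_right]; auto.
      rewrite IHp by (intros s Hs; apply Hp; right; auto).
      destruct (Hp t) as [H1 H2]; [left; auto|].
      assert (Hte : snd t = e) by (rewrite (deg_0 e Hdeg), (deg_0 _ H2), H1, He; auto).
      destruct (list_eq_dec Nat.eq_dec (snd t) e); [|contradiction].
      rewrite (deg_0 _ H2), cmono_repeat0, RtoC_plus. ring. }
    destruct (inU_exists d Hd) as [x Hx]. specialize (H0 x Hx). unfold ev in H0.
    rewrite HC in H0. simpl in H0. lra.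
  - destruct (Nat.eq_dec (deg e) 0) as [Hdeg|Hdeg]; [eapply coef_deg; eauto; lia|].
    destruct (deg_pos e) as [j [Hj Hnz]]; [lia|]. rewrite <- (inc_dec j e Hnz).
    assert (Hle : length (dec j e) = d) by (rewrite dec_length; auto).
    set (e' := dec j e) in *. rewrite He in Hj. clearbody e'. clear Hnz Hdeg e He.
    assert (Hzero : forall i G, partial_on d (ev n p) i G -> (i < d)%nat ->
      forall x, inU d x -> G x = 0).
    { intros i G HG Hi. apply (partial_on_unique d i (ev n p)); auto.
      apply (partial_on_ext d i (fun _ => 0) _ (fun _ => 0) (fun _ => 0)); auto; [|apply partial_const].
      intros; symmetry; auto. }
    assert (Hpair : forall a, (a < n)%nat ->
      coef p (inc (2 * a) e') = 0 /\ coef p (inc (2 * a + 1) e') = 0).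
    { intros a Ha.
      assert (H1 := Hzero _ _ (partial_ev_even d n a p Ha) ltac:(lia)).
      assert (H2 := Hzero _ _ (partial_ev_odd d n a p Ha) ltac:(lia)).
      apply (IH _ (pwf_app _ _ _ _ (pwf_pder _ _ _ _ Hp) (pwf_pder _ _ _ _ Hp))) with (e := e') in H1;
        auto.
      assert (H3 : forall x, inU d x ->
        ev n (pder (2 * a) p ++ pscale (-1) (pder (2 * a + 1) p)) x = 0).
      { intros x Hx. rewrite <- (conj_pt_invol n x), <- evm_conj_pt. apply H2, inU_conj_pt; auto. }
      apply (IH _ (pwf_app _ _ _ _ (pwf_pder _ _ _ _ Hp) (pwf_scale _ _ _ _ (pwf_pder _ _ _ _ Hp))))
        with (e := e') in H3; auto.
      rewrite coef_app, (coef_pder (2 * a)), (coef_pder (2 * a + 1)) in H1 by lia.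
      rewrite coef_app, coef_scale, (coef_pder (2 * a)), (coef_pder (2 * a + 1)) in H3 by lia.
      pose proof (pos_INR (nth (2 * a) e' 0%nat)). pose proof (pos_INR (nth (2 * a + 1) e' 0%nat)).
      rewrite !S_INR in H1, H3.
      split; [apply (Rmult_eq_reg_l (INR (nth (2 * a) e' 0%nat) + 1))
             |apply (Rmult_eq_reg_l (INR (nth (2 * a + 1) e' 0%nat) + 1))]; try lra; apply Rgt_not_eq; lra. }
    revert Hj. pattern j. apply (parity_cases n (S j)); try lia.
    + intros a Ha _. apply Hpair; auto.
    + intros a Ha _. apply Hpair; auto.
    + intros i Hi Hid.
      assert (H1 := Hzero _ _ (partial_ev_real d n i p ltac:(lia)) Hid).
      apply (IH _ (pwf_pder _ _ _ _ Hp)) with (e := e') in H1; auto.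
      rewrite coef_pder in H1 by lia. pose proof (pos_INR (nth i e' 0%nat)).
      rewrite S_INR in H1. apply (Rmult_eq_reg_l (INR (nth i e' 0%nat) + 1)); try lra;
        apply Rgt_not_eq; lra.
Qed.

(** Conjugation of monomials: exchanges the exponents within each of the first [n] pairs. *)
Fixpoint swp (n : nat) (e : list nat) : list nat :=
  match n, e with
  | S n', a :: b :: e' => b :: a :: swp n' e'
  | _, _ => e
  end.

Lemma swp_length (n : nat) (e : list nat) : length (swp n e) = length e.
Proof.
  revert e; induction n as [|n IH]; intros [|a [|b e]]; cbn [swp length]; auto.
Qed.

Lemma swp_deg (n : nat) (e : list nat) : deg (swp n e) = deg e.
Proof.
  unfold deg. revert e; induction n as [|n IH]; intros [|a [|b e]]; simpl; auto. rewrite IH. lia.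
Qed.

Lemma swp_invol (n : nat) (e : list nat) : swp n (swp n e) = e.
Proof.
  revert e; induction n as [|n IH]; intros [|a [|b e]]; cbn [swp]; auto. rewrite IH; auto.
Qed.

Lemma zeta_tail (n : nat) (x : pt) :
  (fun j => zeta (S n) x (S (S j))) = zeta n (fun j => x (S (S j))).
Proof.
  apply functional_extensionality; intros j. unfold zeta.
  destruct (Nat.ltb_spec (S (S j)) (2 * S n)); destruct (Nat.ltb_spec j (2 * n)); try lia; auto.
  simpl Nat.even. destruct (Nat.even j) eqn:E; auto. destruct j; [discriminate|auto].
Qed.

Lemma cmono_swp (n : nat) (x : pt) (e : list nat) : (2 * n <= length e)%nat ->
  cmono (zeta n x) (swp n e) = Cconj (cmono (zeta n x) e).
Proof.
  revert x e; induction n as [|n IH]; intros x e He.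
  - cbn [swp]. apply cmono_conj. intros j. apply injective_projections; simpl; ring.
  - destruct e as [|a [|b e]]; simpl in He; try lia. cbn [swp cmono].
    rewrite !Cmult_conj, !Cconj_pow, (zeta_tail n x), IH by lia.
    replace (zeta (S n) x 1) with (Cconj (zeta (S n) x 0)).
    2:{ unfold zeta. destruct (Nat.ltb_spec 0 (2 * S n)); [|lia].
        destruct (Nat.ltb_spec 1 (2 * S n)); [|lia]. reflexivity. }
    assert (HC : forall c : C, Cconj (Cconj c) = c)
      by (intros c; apply injective_projections; simpl; ring).
    rewrite HC. ring.
Qed.

Definition pswp (n : nat) (p : poly) : poly := map (fun t => (fst t, swp n (snd t))) p.

Lemma evm_pswp (d n k : nat) (p : poly) (x : pt) : (2 * n <= d)%nat -> pwf d k p ->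
  ev n (pswp n p) x = evm n p x.
Proof.
  intros Hn Hp. assert (H : evC n (pswp n p) x = Cconj (evC n p x)).
  { unfold evC, pswp. induction p as [|t p IH]; cbn [map fold_right fst snd].
    - apply injective_projections; simpl; ring.
    - rewrite IH by (intros s Hs; apply Hp; right; auto).
      rewrite cmono_swp by (destruct (Hp t) as [-> _]; [left; auto|auto]).
      rewrite Cplus_conj, Cmult_conj. f_equal. f_equal. apply injective_projections; simpl; ring. }
  unfold ev, evm. rewrite H. simpl. ring.
Qed.

Lemma pwf_pswp (d k n : nat) (p : poly) : pwf d k p -> pwf d k (pswp n p).
Proof.
  intros Hp t Ht. apply in_map_iff in Ht. destruct Ht as [s [<- Hs]]. simpl.
  rewrite swp_length, swp_deg. apply Hp; auto.
Qed.

Lemma coef_pswp (n : nat) (p : poly) (e : list nat) : coef (pswp n p) e = coef p (swp n e).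
Proof.
  unfold coef, pswp. induction p as [|t p IH]; cbn [map fold_right fst snd]; auto. rewrite IH.
  f_equal. destruct (list_eq_dec Nat.eq_dec (swp n (snd t)) e) as [H|H];
    destruct (list_eq_dec Nat.eq_dec (snd t) (swp n e)) as [H'|H']; auto.
  - exfalso; apply H'. rewrite <- H, swp_invol; auto.
  - exfalso; apply H. rewrite H', swp_invol; auto.
Qed.

Lemma cmono_inc (z : nat -> C) (j : nat) (e : list nat) : (j < length e)%nat ->
  cmono z (inc j e) = (z j * cmono z e)%C.
Proof.
  revert z j; induction e as [|a e IH]; intros z [|j] Hj; simpl in Hj; try lia; cbn [inc cmono].
  - cbn [Cpow]. ring.
  - rewrite IH by lia. ring.
Qed.

Lemma evC_pinc (d n k j : nat) (p : poly) (x : pt) : (j < d)%nat -> pwf d k p ->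
  evC n (pinc j p) x = (zeta n x j * evC n p x)%C.
Proof.
  intros Hj Hp. unfold evC, pinc. induction p as [|t p IH]; cbn [map fold_right fst snd]; [ring|].
  rewrite IH by (intros s Hs; apply Hp; right; auto).
  rewrite cmono_inc by (destruct (Hp t) as [-> _]; [left; auto|auto]). ring.
Qed.

(** Uses $x = (z + \bar z) / 2$ and $y = (z - \bar z) / (2 i)$; the division by $i$ exchanges [ev]
    and [evm], which [pswp] undoes. *)
Lemma coord_mult_ev (d n k i : nat) (p : poly) : (2 * n <= d)%nat -> (i < d)%nat -> pwf d k p ->
  exists q, pwf d (S k) q /\ forall x, ev n q x = x i * ev n p x.
Proof.
  intros Hn Hi Hp. revert Hi. pattern i. apply (parity_cases n (S i)); try lia.
  - intros a Ha Hi. exists (pscale (/ 2) (pinc (2 * a) p ++ pinc (2 * a + 1) p)). split.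
    + apply pwf_scale, pwf_app; apply pwf_pinc; auto; lia.
    + intros x. rewrite ev_scale, ev_app. unfold ev. rewrite !(evC_pinc d n k) by (auto; lia).
      unfold zeta. destruct (Nat.ltb_spec (2 * a) (2 * n)); [|lia].
      destruct (Nat.ltb_spec (2 * a + 1) (2 * n)); [|lia].
      rewrite Nat.even_add, !Nat.even_mul. simpl orb. cbn [Bool.eqb].
      replace (pred (2 * a + 1)) with (2 * a)%nat by lia.
      replace (2 * a + 1)%nat with (S (2 * a)) by lia. simpl. field.
  - intros a Ha Hi.
    exists (pscale (- / 2) (pswp n (pinc (2 * a) p ++ pscale (-1) (pinc (2 * a + 1) p)))).
    assert (Hw : pwf d (S k) (pinc (2 * a) p ++ pscale (-1) (pinc (2 * a + 1) p))).
    { apply pwf_app; [|apply pwf_scale]; apply pwf_pinc; auto; lia. }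
    split; [apply pwf_scale, pwf_pswp; auto|].
    intros x. rewrite ev_scale, (evm_pswp d n (S k)), evm_app, evm_scale by auto.
    unfold ev, evm. rewrite !(evC_pinc d n k) by (auto; lia).
    unfold zeta. destruct (Nat.ltb_spec (2 * a) (2 * n)); [|lia].
    destruct (Nat.ltb_spec (2 * a + 1) (2 * n)); [|lia].
    rewrite Nat.even_add, !Nat.even_mul. simpl orb. cbn [Bool.eqb].
    replace (pred (2 * a + 1)) with (2 * a)%nat by lia.
    replace (2 * a + 1)%nat with (S (2 * a)) by lia. simpl. field.
  - intros j Hi Hid. exists (pinc j p). split; [apply pwf_pinc; auto|].
    intros x. unfold ev. rewrite (evC_pinc d n k) by auto.
    unfold zeta. destruct (Nat.ltb_spec j (2 * n)); [lia|]. simpl. ring.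
Qed.

Lemma hpoly_ev (d n k : nat) (u : pt -> R) : (2 * n <= d)%nat -> hpoly d k u ->
  exists p, pwf d k p /\ forall y, inU d y -> u y = ev n p y.
Proof.
  intros Hn H. induction H as [c w Hw|k w g Hg IH Hw].
  - exists ((c, repeat 0%nat d) :: nil). split.
    + intros t [<-|[]]. simpl. rewrite repeat_length. split; auto.
      clear. unfold deg. induction d; simpl; auto.
    + intros y Hy. rewrite Hw by auto. unfold ev, evC. cbn [fold_right fst snd].
      rewrite cmono_repeat0. simpl. ring.
  - assert (Hq : forall i, exists q, (i < d)%nat ->
      pwf d (S k) q /\ forall x, inU d x -> ev n q x = x i * g i x).
    { intros i. destruct (le_lt_dec d i) as [|Hi]; [exists nil; lia|].
      destruct (IH i Hi) as [p [Hp He]].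
      destruct (coord_mult_ev d n k i p Hn Hi Hp) as [q [H1 H2]].
      exists q. intros _. split; auto. intros x Hx. rewrite He by auto. auto. }
    set (q := fun i => proj1_sig (constructive_indefinite_description _ (Hq i))).
    assert (Hq' := fun i => proj2_sig (constructive_indefinite_description _ (Hq i))).
    exists (psum d q). split.
    + apply pwf_psum. intros i Hi. apply Hq'; auto.
    + intros y Hy. rewrite Hw, ev_psum by auto. apply sumR_ext. intros i Hi. symmetry.
      apply Hq'; auto.
Qed.

(** * Invariant harmonic polynomials *)

Definition weights (ps : list Z) (W : nat) : list Z :=
  flat_map (fun p => p :: (- p)%Z :: nil) ps ++ repeat 0%Z W.

Fixpoint wt (ws : list Z) (e : list nat) : Z :=
  match ws, e with
  | w :: ws', a :: e' => (w * Z.of_nat a + wt ws' e')%Z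
  | _, _ => 0%Z
  end.

Definition cis (t : R) : C := (cos t, sin t).

Lemma cis_plus (s t : R) : cis (s + t) = (cis s * cis t)%C.
Proof.
  unfold cis. rewrite cos_plus, sin_plus. apply injective_projections; simpl; ring.
Qed.

Lemma cis_0 : cis 0 = RtoC 1.
Proof. unfold cis. rewrite cos_0, sin_0. auto. Qed.

Lemma cis_pow (s : R) (a : nat) : Cpow (cis s) a = cis (s * INR a).
Proof.
  induction a as [|a IH]; [simpl INR; rewrite Rmult_0_r, cis_0; auto|].
  cbn [Cpow]. rewrite IH, S_INR, Rmult_plus_distr_l, cis_plus, Rmult_1_r. ring.
Qed.

Lemma cmono_cis (t : R) (ws : list Z) (z : nat -> C) (e : list nat) :
  cmono (fun j => cis (t * IZR (nth j ws 0%Z)) * z j)%C e = (cis (t * IZR (wt ws e)) * cmono z e)%C.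
Proof.
  revert ws z; induction e as [|a e IH]; intros [|w ws] z;
    try (cbn [cmono wt]; rewrite Rmult_0_r, cis_0; ring).
  - replace (fun j => (cis (t * IZR (nth j nil 0%Z)) * z j)%C) with z.
    + cbn [wt]. rewrite Rmult_0_r, cis_0. ring.
    + apply functional_extensionality; intros j. destruct j; cbn [nth];
        rewrite Rmult_0_r, cis_0; ring.
  - cbn [cmono nth wt]. rewrite (IH ws (fun j => z (S j))).
    rewrite Cpow_mult_l, cis_pow, plus_IZR, mult_IZR, <- INR_IZR_INZ, Rmult_plus_distr_l, cis_plus.
    rewrite Rmult_assoc. ring.
Qed.

Lemma cis_2PI (z : Z) : cis (2 * PI * IZR z) = RtoC 1.
Proof.
  unfold cis. replace (2 * PI * IZR z) with (2 * (IZR z * PI)) by ring.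
  rewrite cos_2a_sin, sin_2a. rewrite (sin_eq_0_1 (IZR z * PI)) by eauto.
  apply injective_projections; simpl; ring.
Qed.

Lemma sin_PI_div (q m : Z) : (0 < q)%Z -> sin (PI * IZR m / IZR q) = 0 -> (m mod q = 0)%Z.
Proof.
  intros Hq H. apply sin_eq_0_0 in H. destruct H as [k Hk].
  assert (Hq' : 0 < IZR q) by (apply (IZR_lt 0); auto).
  assert (E : IZR m = IZR (k * q)).
  { rewrite mult_IZR. apply (Rmult_eq_reg_l PI); [|apply PI_neq0].
    apply (Rmult_eq_reg_r (/ IZR q)); [|apply Rinv_neq_0_compat; lra].
    transitivity (PI * IZR m / IZR q); [unfold Rdiv; ring|]. rewrite Hk. field. lra. }
  apply eq_IZR in E. rewrite E. apply Z_mod_mult.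
Qed.

Lemma nth_weights_even (ps : list Z) (W a : nat) : (a < length ps)%nat ->
  nth (2 * a) (weights ps W) 0%Z = nth a ps 0%Z.
Proof.
  unfold weights. revert a; induction ps as [|p ps IH]; intros a Ha; simpl in Ha; [lia|].
  destruct a as [|a]; [reflexivity|]. replace (2 * S a)%nat with (S (S (2 * a))) by lia.
  cbn [flat_map app nth]. apply IH. lia.
Qed.

Lemma nth_weights_odd (ps : list Z) (W a : nat) : (a < length ps)%nat ->
  nth (2 * a + 1) (weights ps W) 0%Z = (- nth a ps 0)%Z.
Proof.
  unfold weights. revert a; induction ps as [|p ps IH]; intros a Ha; simpl in Ha; [lia|].
  destruct a as [|a]; [reflexivity|]. replace (2 * S a + 1)%nat with (S (S (2 * a + 1))) by lia.
  cbn [flat_map app nth]. apply IH. lia.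
Qed.

Lemma nth_weights_real (ps : list Z) (W j : nat) : (2 * length ps <= j)%nat ->
  nth j (weights ps W) 0%Z = 0%Z.
Proof.
  unfold weights. revert j; induction ps as [|p ps IH]; intros j Hj; simpl in Hj.
  - cbn [flat_map app]. revert j Hj; induction W as [|W IHW]; intros [|j] Hj; simpl; auto.
    apply IHW; lia.
  - destruct j as [|[|j]]; try lia. cbn [flat_map app nth]. apply IH. lia.
Qed.

Lemma weights_length (ps : list Z) (W : nat) : length (weights ps W) = (2 * length ps + W)%nat.
Proof.
  unfold weights. rewrite length_app, repeat_length. f_equal.
  induction ps as [|p ps IH]; simpl; auto. rewrite IH. lia.
Qed.

(** The complex coordinates diagonalize the group; the minus sign is there because $R(\theta)$ turns
    clockwise. *)
Lemma zeta_lact (L : lens) (k : nat) (x : pt) : (0 < lq L)%nat ->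
  zeta (ln L) (lact L k x) = fun j =>
    (cis (- (2 * PI * INR k / INR (lq L)) * IZR (nth j (weights (lps L) (lW L)) 0%Z))
     * zeta (ln L) x j)%C.
Proof.
  intros Hq. apply functional_extensionality; intros j. set (n := ln L).
  assert (HA : forall a, - (2 * PI * INR k / INR (lq L)) * IZR (nth a (lps L) 0%Z) = - lang L k a).
  { intros a. unfold lang. rewrite mult_IZR, <- INR_IZR_INZ. field. apply not_0_INR. lia. }
  unfold zeta. destruct (Nat.ltb_spec j (2 * n)) as [Hj|Hj].
  - destruct (Nat.Even_or_Odd j) as [[b ->]|[b ->]].
    + rewrite Nat.even_mul. simpl orb. cbv iota.
      rewrite nth_weights_even by (unfold n, ln in Hj; lia). rewrite HA.
      unfold lact. fold n. destruct (Nat.ltb_spec (2 * b) (2 * n)); [|lia].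
      destruct (Nat.ltb_spec (S (2 * b)) (2 * n)); [|lia].
      rewrite Nat.even_mul. simpl orb. cbv iota zeta.
      replace (Nat.even (S (2 * b))) with false
        by (rewrite Nat.even_succ, odd_double; auto).
      replace (pred (S (2 * b))) with (2 * b)%nat by lia.
      replace (S (2 * b) / 2)%nat with b by (rewrite <- Nat.add_1_r, Nat.mul_comm;
        rewrite Nat.div_add_l by lia; simpl; lia).
      replace (2 * b / 2)%nat with b by (rewrite Nat.mul_comm, Nat.div_mul; lia).
      unfold cis. rewrite cos_neg, sin_neg. apply injective_projections; simpl; ring.
    + rewrite <- Nat.negb_odd, odd_double_1. simpl negb. cbv iota.
      rewrite nth_weights_odd, opp_IZR, Ropp_mult_distr_r_reverse by (unfold n, ln in Hj; lia).
      rewrite HA.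
      unfold lact. fold n. replace (pred (2 * b + 1)) with (2 * b)%nat by lia.
      destruct (Nat.ltb_spec (2 * b) (2 * n)); [|lia].
      destruct (Nat.ltb_spec (2 * b + 1) (2 * n)); [|lia].
      rewrite Nat.even_mul, <- (Nat.negb_odd (2 * b + 1)), odd_double_1. simpl orb. simpl negb.
      cbv iota zeta. replace (pred (2 * b + 1)) with (2 * b)%nat by lia.
      replace ((2 * b + 1) / 2)%nat with b by (rewrite Nat.mul_comm;
        rewrite Nat.div_add_l by lia; simpl; lia).
      replace (2 * b / 2)%nat with b by (rewrite Nat.mul_comm, Nat.div_mul; lia).
      replace (S (2 * b)) with (2 * b + 1)%nat by lia.
      rewrite Ropp_involutive. unfold cis. apply injective_projections; simpl; ring.
  - rewrite nth_weights_real, Rmult_0_r, cis_0 by (unfold n, ln in Hj; lia).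
    unfold lact. fold n. destruct (Nat.ltb_spec j (2 * n)); [lia|]. rewrite Cmult_1_l. auto.
Qed.

Definition theta (L : lens) (k : nat) (e : list nat) : R :=
  2 * PI * INR k / INR (lq L) * IZR (wt (weights (lps L) (lW L)) e).

Lemma cmono_lact (L : lens) (k : nat) (x : pt) (e : list nat) : (0 < lq L)%nat ->
  cmono (zeta (ln L) (lact L k x)) e = (cis (- theta L k e) * cmono (zeta (ln L) x) e)%C.
Proof.
  intros Hq. rewrite zeta_lact, cmono_cis by auto. unfold theta.
  rewrite Ropp_mult_distr_l_reverse. auto.
Qed.

Definition pmul (f : list nat -> R) (p : poly) : poly := map (fun t => (f (snd t) * fst t, snd t)) p.

(** For $M = a + ib$, real and imaginary part of $e^{-i\theta} M$ add up to $\cos\theta\,(a + b) -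
    \sin\theta\,(a - b)$: a monomial is only mixed with its conjugate. *)
Lemma ev_lact (L : lens) (k : nat) (p : poly) (x : pt) : (0 < lq L)%nat ->
  ev (ln L) p (lact L k x) =
  ev (ln L) (pmul (fun e => cos (theta L k e)) p) x
  - evm (ln L) (pmul (fun e => sin (theta L k e)) p) x.
Proof.
  intros Hq. unfold ev, evm, evC. induction p as [|[c e] p IH]; [simpl; ring|].
  cbn [pmul map fold_right fst snd] in *. rewrite cmono_lact by auto.
  unfold pmul in IH. unfold cis. rewrite cos_neg, sin_neg.
  match type of IH with _ + _ = ?a + ?b - (?c' - ?d') =>
    set (A := a) in *; set (B := b) in *; set (C' := c') in *; set (D := d') in * end.
  set (M := cmono (zeta (ln L) x) e) in *.
  match goal with |- ?l = _ => match type of IH with ?f + ?g = _ =>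
    replace l with ((c * (cos (theta L k e) * fst M + sin (theta L k e) * snd M)
      + c * (cos (theta L k e) * snd M - sin (theta L k e) * fst M)) + (f + g)) by (simpl; ring)
  end end.
  rewrite IH. simpl. fold M. unfold A, B, C', D. ring.
Qed.

Definition winv (q : Z) (ws : list Z) (e : list nat) : bool := (wt ws e mod q =? 0)%Z.

Lemma ev_invariant (L : lens) (k : nat) (p : poly) (x : pt) : (0 < lq L)%nat ->
  (forall t, In t p ->
     winv (Z.of_nat (lq L)) (weights (lps L) (lW L)) (snd t) = true) ->
  ev (ln L) p (lact L k x) = ev (ln L) p x.
Proof.
  intros Hq Hp. unfold ev. replace (evC (ln L) p (lact L k x)) with (evC (ln L) p x); auto.
  unfold evC. induction p as [|[c e] p IH]; auto. cbn [fold_right fst snd].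
  rewrite IH by (intros t Ht; apply Hp; right; auto).
  rewrite cmono_lact by auto. specialize (Hp (c, e) (or_introl eq_refl)).
  unfold winv in Hp. apply Z.eqb_eq in Hp. cbn [snd] in Hp.
  apply Z_div_exact_full_2 in Hp; [|lia].
  replace (- theta L k e) with
    (2 * PI * IZR (- (Z.of_nat k * (wt (weights (lps L) (lW L)) e / Z.of_nat (lq L))))).
  - rewrite cis_2PI. ring.
  - unfold theta. rewrite Hp at 2. rewrite opp_IZR, !mult_IZR, <- !INR_IZR_INZ. field.
    apply not_0_INR. lia.
Qed.

Lemma wt_swp (ps : list Z) (W : nat) (e : list nat) : (2 * length ps <= length e)%nat ->
  wt (weights ps W) (swp (length ps) e) = (- wt (weights ps W) e)%Z.
Proof.
  unfold weights. revert e; induction ps as [|p ps IH]; intros e He.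
  - cbn [length swp flat_map app]. assert (H : wt (repeat 0%Z W) e = 0%Z).
    { clear. revert e; induction W as [|W IH]; intros [|a e]; auto.
      cbn [repeat wt]. rewrite IH. lia. }
    rewrite H. auto.
  - destruct e as [|a [|b e]]; simpl in He; try lia.
    cbn [length swp flat_map app wt]. rewrite IH by lia. lia.
Qed.

Lemma lact_scale (L : lens) (k : nat) (c : R) (x : pt) :
  lact L k (scale c x) = scale c (lact L k x).
Proof.
  apply functional_extensionality; intros j. unfold lact, scale.
  destruct (j <? 2 * ln L)%nat; auto. destruct (Nat.even j); ring.
Qed.

Lemma lact_even (L : lens) (k a : nat) (x : pt) : (a < ln L)%nat ->
  lact L k x (2 * a)%nat = cos (lang L k a) * x (2 * a)%nat + sin (lang L k a) * x (2 * a + 1)%nat.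
Proof.
  intros Ha. unfold lact. destruct (Nat.ltb_spec (2 * a) (2 * ln L)); [|lia].
  rewrite Nat.even_mul. simpl orb. cbv iota zeta.
  replace (2 * a / 2)%nat with a by (rewrite Nat.mul_comm, Nat.div_mul; lia).
  replace (S (2 * a)) with (2 * a + 1)%nat by lia. auto.
Qed.

Lemma lact_odd (L : lens) (k a : nat) (x : pt) : (a < ln L)%nat ->
  lact L k x (2 * a + 1)%nat = - sin (lang L k a) * x (2 * a)%nat + cos (lang L k a) * x (2 * a + 1)%nat.
Proof.
  intros Ha. unfold lact. destruct (Nat.ltb_spec (2 * a + 1) (2 * ln L)); [|lia].
  rewrite <- (Nat.negb_odd (2 * a + 1)), odd_double_1. simpl negb. cbv iota zeta.
  replace (pred (2 * a + 1)) with (2 * a)%nat by lia.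
  replace ((2 * a + 1) / 2)%nat with a; auto.
  rewrite Nat.mul_comm, Nat.div_add_l by lia. simpl. lia.
Qed.

Lemma lact_real (L : lens) (k j : nat) (x : pt) : (2 * ln L <= j)%nat -> lact L k x j = x j.
Proof. intros Hj. unfold lact. destruct (Nat.ltb_spec j (2 * ln L)); [lia|auto]. Qed.

Lemma lact_dot (L : lens) (k : nat) (x y : pt) :
  sumR (lamb L) (fun j => lact L k x j * lact L k y j) = sumR (lamb L) (fun j => x j * y j).
Proof.
  unfold lamb. rewrite !sumR_split, !sumR_double. f_equal; apply sumR_ext; intros a Ha.
  - rewrite !lact_even, !lact_odd by auto. pose proof (sin2_cos2 (lang L k a)) as H.
    unfold Rsqr in H.
    transitivity ((sin (lang L k a) * sin (lang L k a) + cos (lang L k a) * cos (lang L k a)) *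
      (x (2 * a)%nat * y (2 * a)%nat + x (2 * a + 1)%nat * y (2 * a + 1)%nat)); [ring|].
    rewrite H. ring.
  - rewrite !lact_real by lia. auto.
Qed.

Lemma lact_sphere (L : lens) (k : nat) (x : pt) :
  on_sphere (lamb L) x -> on_sphere (lamb L) (lact L k x).
Proof.
  intros [H1 H2]. split.
  - intros j Hj. rewrite lact_real by (unfold lamb in Hj; lia). auto.
  - rewrite <- H2. unfold norm2. 
    rewrite (sumR_ext _ (fun i => lact L k x i ^ 2) (fun i => lact L k x i * lact L k x i)),
      (sumR_ext _ (fun i => x i ^ 2) (fun i => x i * x i)) by (intros; ring).
    apply lact_dot.
Qed.

Lemma ev_scale_pt (d n k : nat) (p : poly) (c : R) (x : pt) : pwf d k p ->
  ev n p (scale c x) = c ^ k * ev n p x.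
Proof. intros Hp. unfold ev. rewrite (evC_scale_pt d n k) by auto. simpl. ring. Qed.

(** Let $x, y$ be the coefficients at [e] and at its conjugate. Invariance gives $(c - 1) x + s y =
    0$ and $(c - 1) y - s x = 0$, with determinant $(c - 1)^2 + s^2$; it is nonzero because $c = 1$
    would make the weight of [e] divisible by $q$. *)
Lemma invariant_coef (L : lens) (k : nat) (p : poly) (e : list nat) :
  (2 <= lq L)%nat -> (1 <= lamb L)%nat -> pwf (lamb L) k p ->
  (forall x, on_sphere (lamb L) x -> ev (ln L) p (lact L 1 x) = ev (ln L) p x) ->
  length e = lamb L ->
  winv (Z.of_nat (lq L)) (weights (lps L) (lW L)) e = false -> coef p e = 0.
Proof.
  intros Hq Hd Hp HI He Hw. set (d := lamb L) in *. set (n := ln L) in *.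
  assert (Hn : (2 * n <= d)%nat) by (unfold d, lamb, n; lia).
  set (c1 := fun e => cos (theta L 1 e)). set (s1 := fun e => sin (theta L 1 e)).
  assert (Hmul : forall f, pwf d k (pmul f p)).
  { intros f t Ht. apply in_map_iff in Ht. destruct Ht as [s [<- Hs]]. exact (Hp s Hs). }
  set (P := pmul c1 p ++ pscale (-1) (pswp n (pmul s1 p)) ++ pscale (-1) p).
  assert (HP : pwf d k P).
  { unfold P. apply pwf_app; auto. apply pwf_app; apply pwf_scale; auto. apply pwf_pswp; auto. }
  assert (H0 : forall x, inU d x -> ev n P x = 0).
  { intros x Hx. unfold P. rewrite !ev_app, !ev_scale, (evm_pswp d n k) by auto.
    assert (E : ev n p (lact L 1 x) = ev n p x).
    { rewrite (scale_normalize d x Hx), lact_scale.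
      rewrite !(ev_scale_pt d n k) by auto. f_equal. apply HI, normalize_sphere; auto. }
    unfold n in E. rewrite ev_lact in E by lia. fold n c1 s1 in E. unfold n, c1, s1 in *. lra. }
  assert (HC : forall e, length e = d ->
    c1 e * coef p e + s1 e * coef p (swp n e) - coef p e = 0).
  { intros f Hf. pose proof (ev_independent d n k P Hd Hn HP H0 f Hf) as E.
    unfold P in E. rewrite !coef_app, !coef_scale, coef_pswp in E.
    unfold pmul in E. rewrite !coef_map in E.
    assert (Es : s1 (swp n f) = - s1 f).
    { unfold s1, theta. unfold n, ln. rewrite wt_swp; [|fold (ln L); fold n; lia].
      rewrite opp_IZR, Ropp_mult_distr_r_reverse, sin_neg. auto. }
    rewrite Es in E. lra. }
  assert (Ec : c1 (swp n e) = c1 e /\ s1 (swp n e) = - s1 e).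
  { unfold c1, s1, theta. unfold n, ln. rewrite wt_swp; [|fold (ln L); fold n; lia].
    rewrite opp_IZR, Ropp_mult_distr_r_reverse, sin_neg, cos_neg. auto. }
  pose proof (HC e He) as E1. pose proof (HC (swp n e) ltac:(rewrite swp_length; auto)) as E2.
  rewrite swp_invol in E2. destruct Ec as [-> ->] in E2.
  assert (Hne : c1 e <> 1).
  { intros E. unfold c1, theta in E. set (w := wt (weights (lps L) (lW L)) e) in *.
    replace (2 * PI * INR 1 / INR (lq L) * IZR w) with (2 * (PI * IZR w / IZR (Z.of_nat (lq L)))) in E
      by (rewrite <- INR_IZR_INZ; simpl; field; apply not_0_INR; lia).
    rewrite cos_2a_sin in E.
    assert (sin (PI * IZR w / IZR (Z.of_nat (lq L))) = 0) as Hs by nra.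
    apply sin_PI_div in Hs; [|lia]. unfold winv in Hw. fold w in Hw.
    apply Z.eqb_neq in Hw. contradiction. }
  set (x := coef p e) in *. set (y := coef p (swp n e)) in *.
  assert (Hx : (s1 e * s1 e + (c1 e - 1) * (c1 e - 1)) * x = 0).
  { replace ((s1 e * s1 e + (c1 e - 1) * (c1 e - 1)) * x) with
      ((c1 e - 1) * (c1 e * x + s1 e * y - x) - s1 e * (c1 e * y + - s1 e * x - y)) by ring.
    rewrite E1, E2. ring. }
  apply Rmult_integral in Hx. destruct Hx as [Hx|]; auto.
  exfalso. apply Hne. pose proof (Rle_0_sqr (s1 e)) as A. pose proof (Rle_0_sqr (c1 e - 1)) as B.
  unfold Rsqr in *. assert ((c1 e - 1) * (c1 e - 1) = 0) as Z by lra.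
  apply Rmult_integral in Z. lra.
Qed.

(** Either the first exponent is 0, or lowering it by 1 leads to degree [k - 1]; [cn] below follows
    the same recursion. *)
Fixpoint enum (d : nat) : nat -> list (list nat) :=
  match d with
  | O => fun k => match k with O => nil :: nil | S _ => nil end
  | S d' => fix en (k : nat) := map (cons 0%nat) (enum d' k) ++
      match k with O => nil | S k' => map (inc 0) (en k') end
  end.

Lemma in_enum (d k : nat) (e : list nat) : In e (enum d k) <-> length e = d /\ deg e = k.
Proof.
  revert k e; induction d as [|d IHd]; intros k e.
  - unfold deg. split.
    + destruct k; simpl; [intros [<-|[]]; auto|tauto].
    + destruct e; simpl; [|lia]. intros [_ <-]. simpl; auto.
  - revert e; induction k as [|k IHk]; intros e.
    + cbn [enum]. rewrite app_nil_r, in_map_iff. split.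
      * intros [f [<- Hf]]. apply IHd in Hf. destruct Hf. split; simpl; auto.
      * destruct e as [|a e]; simpl; [lia|]. intros [Hl Hk]. unfold deg in Hk; simpl in Hk.
        exists e. split; [f_equal; lia|]. apply IHd. split; [lia|unfold deg; lia].
    + change (enum (S d) (S k)) with (map (cons 0%nat) (enum d (S k)) ++ map (inc 0) (enum (S d) k)).
      rewrite in_app_iff, !in_map_iff. split.
      * intros [[f [<- Hf]]|[f [<- Hf]]].
        -- apply IHd in Hf. destruct Hf. split; simpl; auto.
        -- apply IHk in Hf. destruct Hf as [H1 H2]. rewrite inc_length, deg_inc by lia. auto.
      * intros [H1 H2]. destruct e as [|[|a] e]; simpl in H1; [lia| |].
        -- left. exists e. split; auto. apply IHd. split; [lia|auto].
        -- right. exists (a :: e). split; auto. apply IHk. split; [simpl; lia|].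
           unfold deg in *. simpl in *. lia.
Qed.

Lemma enum_NoDup (d k : nat) : NoDup (enum d k).
Proof.
  revert k; induction d as [|d IHd]; intros k.
  - destruct k; simpl; constructor; auto. constructor.
  - induction k as [|k IHk].
    + cbn [enum]. rewrite app_nil_r. apply Injective_map_NoDup; auto.
      intros a b H. congruence.
    + change (enum (S d) (S k)) with (map (cons 0%nat) (enum d (S k)) ++ map (inc 0) (enum (S d) k)).
      apply NoDup_app.
      * apply Injective_map_NoDup; auto. intros a b H. congruence.
      * apply Injective_map_NoDup; auto.
        intros a b H. rewrite <- (dec_inc 0 a), H, dec_inc. auto.
      * intros e He1 He2. apply in_map_iff in He1, He2.
        destruct He1 as [f [<- _]]. destruct He2 as [g [Hg _]]. destruct g; discriminate.
Qed.

(** * Invariant harmonic polynomials with prescribed boundary coefficients *)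

Definition exps (q : Z) (ws : list Z) (k : nat) : list (list nat) :=
  filter (winv q ws) (enum (length ws) k).

Definition boundary (e : list nat) : bool := orb (nth 0 e 0 =? 0)%nat (nth 1 e 0 =? 0)%nat.

(* Exponents of the invariant monomials not divisible by [zeta 0 * zeta 1]: the coefficients of an
   invariant harmonic polynomial at these exponents are arbitrary and determine it. *)
Definition bexps (q : Z) (ws : list Z) (k : nat) : list (list nat) :=
  filter boundary (exps q ws k).

Lemma in_exps (q : Z) (ws : list Z) (k : nat) (e : list nat) :
  In e (exps q ws k) <-> length e = length ws /\ deg e = k /\ winv q ws e = true.
Proof. unfold exps. rewrite filter_In, in_enum. tauto. Qed.

Lemma wt_inc (ws : list Z) (j : nat) (e : list nat) : length e = length ws -> (j < length e)%nat ->
  wt ws (inc j e) = (wt ws e + nth j ws 0)%Z.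
Proof.
  revert j e; induction ws as [|w ws IH]; intros [|j] [|a e] He Hj; simpl in *; try lia.
  rewrite IH by lia. lia.
Qed.

Lemma wt_inc_pair (ps : list Z) (W a : nat) (e : list nat) : (a < length ps)%nat ->
  length e = (2 * length ps + W)%nat ->
  wt (weights ps W) (inc (2 * a) (inc (2 * a + 1) e)) = wt (weights ps W) e.
Proof.
  intros Ha He. rewrite !wt_inc by (rewrite ?inc_length, ?weights_length; lia).
  rewrite nth_weights_even, nth_weights_odd by auto. lia.
Qed.

Lemma wt_inc_real (ps : list Z) (W j : nat) (e : list nat) : (j < W)%nat ->
  length e = (2 * length ps + W)%nat ->
  wt (weights ps W) (inc (2 * length ps + j) (inc (2 * length ps + j) e)) = wt (weights ps W) e.
Proof.
  intros Hj He. rewrite !wt_inc by (rewrite ?inc_length, ?weights_length; lia).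
  rewrite nth_weights_real by lia. lia.
Qed.

(* Solves the coefficient form of Laplace's equation for [e], given the coefficients with a smaller
   exponent of [zeta 0]. *)
Fixpoint sol (n W : nat) (a0 : list nat -> R) (fuel : nat) (e : list nat) : R :=
  match fuel with
  | O => a0 e
  | S f =>
    if Nat.eq_dec (nth 1 e 0%nat) 0 then a0 e else
    let e' := dec 0 (dec 1 e) in
    - / (4 * (INR (nth 0 e 0%nat) * INR (nth 1 e 0%nat))) *
    (sumR n (fun a => 4 * (INR (S (nth (2 * S a) e' 0%nat)) * (INR (S (nth (2 * S a + 1) e' 0%nat)) *
        sol n W a0 f (inc (2 * S a) (inc (2 * S a + 1) e'))))) +
     sumR W (fun j => INR (S (nth (2 * S n + j) e' 0%nat)) * (INR (S (S (nth (2 * S n + j) e' 0%nat))) *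
        sol n W a0 f (inc (2 * S n + j) (inc (2 * S n + j) e')))))
  end.

(** Every step of [sol] lowers the exponent of [zeta 0] by 1, so this exponent is enough fuel, and
    fuel 0 is only met at a boundary exponent. The number of planes is [n + 1]. *)
Definition harm (n W : nat) (a0 : list nat -> R) (e : list nat) : R :=
  sol n W a0 (nth 0 e 0%nat) e.

Lemma harm_boundary (n W : nat) (a0 : list nat -> R) (e : list nat) :
  boundary e = true -> harm n W a0 e = a0 e.
Proof.
  unfold boundary, harm. intros H. destruct (nth 0 e 0%nat) as [|f]; auto. simpl in H.
  cbn [sol]. destruct (Nat.eq_dec (nth 1 e 0%nat) 0) as [|H1]; auto.
  apply Nat.eqb_eq in H. contradiction.
Qed.

(** The right-hand side of [coef_plap] for an arbitrary family of coefficients. *)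
Definition lap_eq (n W : nat) (c : list nat -> R) (e : list nat) : R :=
  sumR n (fun a => 4 * (INR (S (nth (2 * a) e 0%nat)) * (INR (S (nth (2 * a + 1) e 0%nat)) *
    c (inc (2 * a) (inc (2 * a + 1) e))))) +
  sumR W (fun j => INR (S (nth (2 * n + j) e 0%nat)) * (INR (S (S (nth (2 * n + j) e 0%nat))) *
    c (inc (2 * n + j) (inc (2 * n + j) e)))).

Lemma lap_eq_lin (n W : nat) (r : R) (f g : list nat -> R) (e : list nat) :
  lap_eq n W (fun e => f e + r * g e) e = lap_eq n W f e + r * lap_eq n W g e.
Proof.
  unfold lap_eq. rewrite Rmult_plus_distr_l, <- !sumR_scal.
  match goal with |- _ = ?a + ?b + (?c + ?d) =>
    replace (a + b + (c + d)) with ((a + c) + (b + d)) by ring end.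
  rewrite <- !sumR_plus. f_equal; apply sumR_ext; intros; ring.
Qed.

Lemma lap_eq_sumR (n W m : nat) (c : nat -> R) (f : nat -> list nat -> R) (e : list nat) :
  lap_eq n W (fun e => sumR m (fun j => c j * f j e)) e = sumR m (fun j => c j * lap_eq n W (f j) e).
Proof.
  induction m as [|m IH]; cbn [sumR].
  - unfold lap_eq. rewrite !sumR_0; [ring| |]; intros; ring.
  - rewrite (lap_eq_lin n W (c m) (fun e => sumR m (fun j => c j * f j e)) (f m)), IH. auto.
Qed.

Lemma nth0_inc (j : nat) (e : list nat) : (0 < j)%nat -> nth 0 (inc j e) 0%nat = nth 0 e 0%nat.
Proof. destruct e, j; simpl; auto; lia. Qed.

Lemma lap_eq_S (n W : nat) (c : list nat -> R) (e : list nat) :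
  lap_eq (S n) W c e =
  4 * (INR (S (nth 0 e 0%nat)) * (INR (S (nth 1 e 0%nat)) * c (inc 0 (inc 1 e)))) +
  (sumR n (fun a => 4 * (INR (S (nth (2 * S a) e 0%nat)) * (INR (S (nth (2 * S a + 1) e 0%nat)) *
        c (inc (2 * S a) (inc (2 * S a + 1) e))))) +
   sumR W (fun j => INR (S (nth (2 * S n + j) e 0%nat)) * (INR (S (S (nth (2 * S n + j) e 0%nat))) *
        c (inc (2 * S n + j) (inc (2 * S n + j) e))))).
Proof.
  unfold lap_eq. rewrite <- Rplus_assoc. f_equal.
  change (S n) with (1 + n)%nat at 1. rewrite sumR_split. simpl (sumR 1 _).
  rewrite Rplus_0_l. f_equal.
Qed.

Lemma lap_eq_harm (n W : nat) (a0 : list nat -> R) (e : list nat) :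
  length e = (2 * S n + W)%nat -> lap_eq (S n) W (harm n W a0) e = 0.
Proof.
  intros He. rewrite lap_eq_S.
  assert (H : harm n W a0 (inc 0 (inc 1 e)) =
    - / (4 * (INR (S (nth 0 e 0%nat)) * INR (S (nth 1 e 0%nat)))) *
    (sumR n (fun a => 4 * (INR (S (nth (2 * S a) e 0%nat)) * (INR (S (nth (2 * S a + 1) e 0%nat)) *
        harm n W a0 (inc (2 * S a) (inc (2 * S a + 1) e))))) +
     sumR W (fun j => INR (S (nth (2 * S n + j) e 0%nat)) * (INR (S (S (nth (2 * S n + j) e 0%nat))) *
        harm n W a0 (inc (2 * S n + j) (inc (2 * S n + j) e)))))).
  { unfold harm at 1. rewrite nth_inc by (rewrite inc_length; lia). rewrite Nat.eqb_refl.
    rewrite nth0_inc by lia. cbn [sol].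
    assert (H1 : nth 1 (inc 0 (inc 1 e)) 0%nat = S (nth 1 e 0%nat)).
    { rewrite nth_inc by (rewrite inc_length; lia). simpl Nat.eqb. cbv iota.
      rewrite nth_inc by lia. auto. }
    assert (H0 : nth 0 (inc 0 (inc 1 e)) 0%nat = S (nth 0 e 0%nat)).
    { rewrite nth_inc by (rewrite inc_length; lia). simpl Nat.eqb. cbv iota.
      rewrite nth0_inc by lia. auto. }
    rewrite H0, H1. destruct (Nat.eq_dec (S (nth 1 e 0%nat)) 0); [lia|].
    rewrite (inc_comm 0 1), dec_inc, (dec_inc 0).
    f_equal. f_equal; apply sumR_ext; intros a Ha; unfold harm; rewrite !nth0_inc by lia; auto. }
  rewrite H. field. split; apply not_0_INR; lia.
Qed.

(** Induction on the exponent of [zeta 0]: the equation at [dec 0 (dec 1 e)] contains [c e] with a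
    nonzero factor, and otherwise only exponents with a smaller power of [zeta 0]. *)
Lemma lap_eq_unique (n W : nat) (c : list nat -> R) :
  (forall e, length e = (2 * S n + W)%nat -> boundary e = true -> c e = 0) ->
  (forall e, length e = (2 * S n + W)%nat -> lap_eq (S n) W c e = 0) ->
  forall e, length e = (2 * S n + W)%nat -> c e = 0.
Proof.
  intros Hb HL. assert (H : forall f e, nth 0 e 0%nat = f -> length e = (2 * S n + W)%nat -> c e = 0).
  { induction f as [|f IH]; intros e Hf He.
    - apply Hb; auto. unfold boundary. rewrite Hf. auto.
    - destruct (Nat.eq_dec (nth 1 e 0%nat) 0) as [H1|H1].
      + apply Hb; auto. unfold boundary. rewrite H1. apply Bool.orb_true_r.
      + set (e' := dec 0 (dec 1 e)).
        assert (E : inc 0 (inc 1 e') = e).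
        { unfold e'. rewrite inc_comm, (inc_dec 0), (inc_dec 1); auto.
          rewrite nth_dec. simpl. lia. }
        assert (He' : length e' = (2 * S n + W)%nat) by (unfold e'; rewrite !dec_length; auto).
        assert (Hf' : nth 0 e' 0%nat = f).
        { rewrite <- E, nth_inc, nth0_inc in Hf by (rewrite ?inc_length; lia). simpl in Hf. lia. }
        specialize (HL e' He'). rewrite lap_eq_S, E in HL.
        rewrite (sumR_0 n), (sumR_0 W) in HL.
        * assert (HH : INR (S (nth 0 e' 0%nat)) * (INR (S (nth 1 e' 0%nat)) * c e) = 0) by lra.
          apply Rmult_integral in HH. destruct HH as [HH|HH]; [exfalso; revert HH; apply not_0_INR; lia|].
          apply Rmult_integral in HH. destruct HH as [HH|HH]; [exfalso; revert HH; apply not_0_INR; lia|auto].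
        * intros j Hj. rewrite (IH (inc _ (inc _ e'))); [ring| |rewrite !inc_length; auto].
          rewrite !nth0_inc by lia. auto.
        * intros a Ha. rewrite (IH (inc _ (inc _ e'))); [ring| |rewrite !inc_length; auto].
          rewrite !nth0_inc by lia. auto. }
  intros e He. apply (H _ e eq_refl He).
Qed.

Lemma evC_coef (d n k : nat) (p : poly) (x : pt) : pwf d k p ->
  evC n p x = fold_right (fun e s => (RtoC (coef p e) * cmono (zeta n x) e + s)%C) (RtoC 0) (enum d k).
Proof.
  intros Hp. induction p as [|[c e] p IH].
  - cbn [evC fold_right]. induction (enum d k) as [|e l IHl]; auto.
    cbn [fold_right]. rewrite <- IHl. change (coef nil e) with 0. ring.
  - cbn [evC fold_right fst snd]. fold (evC n p x).
    rewrite IH by (intros t Ht; apply Hp; right; auto).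
    assert (Hin : In e (enum d k)) by (apply in_enum, (Hp (c, e)); left; auto).
    pose proof (enum_NoDup d k) as Hnd. clear IH Hp.
    induction (enum d k) as [|f l IHl]; [destruct Hin|].
    cbn [fold_right]. inversion Hnd as [|? ? Hf Hl]; subst.
    change (coef ((c, e) :: p) f) with ((if list_eq_dec Nat.eq_dec e f then c else 0) + coef p f).
    destruct (list_eq_dec Nat.eq_dec e f) as [->|Hef].
    + assert (E : fold_right (fun e s => (RtoC (coef ((c, f) :: p) e) * cmono (zeta n x) e + s)%C) (RtoC 0) l
        = fold_right (fun e s => (RtoC (coef p e) * cmono (zeta n x) e + s)%C) (RtoC 0) l).
      { clear IHl Hin Hnd Hl. induction l as [|g l IHl]; auto. cbn [fold_right].
        rewrite IHl by (intros H; apply Hf; right; auto).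
        change (coef ((c, f) :: p) g) with ((if list_eq_dec Nat.eq_dec f g then c else 0) + coef p g).
        destruct (list_eq_dec Nat.eq_dec f g) as [->|]; [exfalso; apply Hf; left; auto|].
        rewrite Rplus_0_l. auto. }
      rewrite E, RtoC_plus. ring.
    + destruct Hin as [->|Hin]; [contradiction|]. rewrite <- IHl by auto. rewrite Rplus_0_l. ring.
Qed.

Lemma ev_coef_zero (d n k : nat) (p : poly) (x : pt) : pwf d k p ->
  (forall e, length e = d -> coef p e = 0) -> ev n p x = 0.
Proof.
  intros Hp H. unfold ev. rewrite (evC_coef d n k p x Hp).
  assert (E : fold_right (fun e s => (RtoC (coef p e) * cmono (zeta n x) e + s)%C) (RtoC 0) (enum d k)
    = RtoC 0).
  { assert (Hl : forall e, In e (enum d k) -> coef p e = 0) by (intros e He; apply H; apply in_enum in He; tauto).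
    induction (enum d k) as [|e l IHl]; auto. cbn [fold_right].
    rewrite IHl by (intros; apply Hl; right; auto). rewrite Hl by (left; auto). ring. }
  rewrite E. simpl. ring.
Qed.

(** The invariant harmonic polynomial whose boundary coefficients are 1 at [y] and 0 elsewhere, for
    [y] in [bexps]. *)
Definition harm_poly (q : Z) (ps : list Z) (W k : nat) (y : list nat) : poly :=
  map (fun e => (harm (pred (length ps)) W (fun f => if list_eq_dec Nat.eq_dec f y then 1 else 0) e, e))
    (exps q (weights ps W) k).

Lemma coef_list (a : list nat -> R) (l : list (list nat)) (e : list nat) : NoDup l ->
  coef (map (fun e => (a e, e)) l) e = if in_dec (list_eq_dec Nat.eq_dec) e l then a e else 0.
Proof.
  intros Hl. induction Hl as [|f l Hf Hl IH]; auto.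
  cbn [map coef fold_right fst snd]. fold (coef (map (fun e => (a e, e)) l) e). rewrite IH.
  destruct (in_dec (list_eq_dec Nat.eq_dec) e (f :: l)) as [Hin|Hin];
    destruct (in_dec (list_eq_dec Nat.eq_dec) e l) as [Hin'|Hin'];
    destruct (list_eq_dec Nat.eq_dec f e) as [->|Hfe]; try contradiction; try ring.
  - destruct Hin; contradiction.
  - exfalso; apply Hin; right; auto.
  - exfalso; apply Hin; left; auto.
Qed.

Lemma exps_NoDup (q : Z) (ws : list Z) (k : nat) : NoDup (exps q ws k).
Proof. apply NoDup_filter, enum_NoDup. Qed.

Lemma pwf_harm_poly (q : Z) (ps : list Z) (W k : nat) (y : list nat) :
  pwf (2 * length ps + W) k (harm_poly q ps W k y).
Proof.
  intros t Ht. apply in_map_iff in Ht. destruct Ht as [e [<- He]]. apply in_exps in He.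
  rewrite weights_length in He. simpl. tauto.
Qed.

(** Restricting [harm] to the invariant exponents of degree [k] keeps it harmonic: all exponents in
    the equation at [e] have the weight of [e] and degree [deg e + 2], so either all or none of them
    are kept. *)
Lemma coef_harm_poly_lap (q : Z) (ps : list Z) (W k : nat) (y e : list nat) :
  (1 <= length ps)%nat -> length e = (2 * length ps + W)%nat ->
  coef (plap (length ps) W (harm_poly q ps W k y)) e = 0.
Proof.
  intros Hn He. rewrite coef_plap by auto. fold (lap_eq (length ps) W (coef (harm_poly q ps W k y)) e).
  destruct (length ps) as [|n] eqn:En; [lia|].
  destruct (Nat.eq_dec (S (S (deg e))) k) as [Hk|Hk].
  - destruct (winv q (weights ps W) e) eqn:Hw.
    + transitivity (lap_eq (S n) W (harm n W (fun f => if list_eq_dec Nat.eq_dec f y then 1 else 0)) e);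
        [|apply lap_eq_harm; auto].
      assert (HC : forall f, In f (exps q (weights ps W) k) -> coef (harm_poly q ps W k y) f =
        harm n W (fun f => if list_eq_dec Nat.eq_dec f y then 1 else 0) f).
      { intros f Hf. unfold harm_poly. rewrite coef_list by apply exps_NoDup. rewrite En.
        destruct (in_dec (list_eq_dec Nat.eq_dec) f (exps q (weights ps W) k)); tauto. }
      unfold lap_eq. f_equal; apply sumR_ext; intros i Hi; rewrite HC; auto;
        apply in_exps; rewrite weights_length, !inc_length, !deg_inc by (rewrite ?inc_length; lia);
        split; try lia; split; auto; unfold winv in *.
      * rewrite wt_inc_pair by lia. auto.
      * rewrite <- En, wt_inc_real by lia. auto.
    + assert (HC : forall f, winv q (weights ps W) f = false -> coef (harm_poly q ps W k y) f = 0).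
      { intros f Hf. unfold harm_poly. rewrite coef_list by apply exps_NoDup.
        destruct (in_dec (list_eq_dec Nat.eq_dec) f (exps q (weights ps W) k)) as [Hin|]; auto.
        apply in_exps in Hin. destruct Hin as [_ [_ Hin]]. congruence. }
      unfold lap_eq. rewrite !sumR_0; [ring| |]; intros i Hi; rewrite HC; try ring;
        unfold winv in *.
      * rewrite <- En, wt_inc_real by lia. auto.
      * rewrite wt_inc_pair by lia. auto.
  - assert (HC : forall f, deg f = S (S (deg e)) -> coef (harm_poly q ps W k y) f = 0).
    { intros f Hf. apply (coef_deg _ k _ _ (pwf_harm_poly q ps W k y)). lia. }
    unfold lap_eq. rewrite !sumR_0; [ring| |]; intros i Hi; rewrite HC; try ring;
      rewrite !deg_inc by (rewrite ?inc_length; lia); auto.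
Qed.

Lemma pder_deg0 (d j : nat) (p : poly) : pwf d 0 p -> pder j p = nil.
Proof.
  intros Hp. induction p as [|[c e] p IH]; auto. cbn [pder].
  destruct (Nat.eq_dec (nth j e 0%nat) 0) as [|Hj].
  - apply IH. intros t Ht. apply Hp. right; auto.
  - destruct (Hp (c, e) (or_introl eq_refl)) as [_ Hd]. cbn [snd] in Hd.
    rewrite (deg_dec j e Hj) in Hd. discriminate.
Qed.

Lemma psum_nil (m : nat) (f : nat -> poly) : (forall i, f i = nil) -> psum m f = nil.
Proof. intros Hf. induction m as [|m IH]; auto. cbn [psum]. rewrite IH, Hf. auto. Qed.

Lemma plap_low (d n W k : nat) (p : poly) : (k < 2)%nat -> pwf d k p -> plap n W p = nil.
Proof.
  intros Hk Hp. assert (H : forall i j, pder i (pder j p) = nil).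
  { intros i j. destruct k as [|[|k]]; [| |lia].
    - rewrite (pder_deg0 d j p Hp). auto.
    - apply (pder_deg0 d). apply pwf_pder; auto. }
  unfold plap. rewrite !psum_nil; auto. intros i. rewrite H. auto.
Qed.

Lemma hom_eig_ev (n W k : nat) (p : poly) : pwf (2 * n + W) k p ->
  (forall e, length e = (2 * n + W)%nat -> coef (plap n W p) e = 0) ->
  hom_eig (2 * n + W) (INR k) 0 (ev n p).
Proof.
  intros Hp H0. split; [|split].
  - apply (smooth_ev _ n k); auto. lia.
  - apply homog_ev; auto.
  - destruct (laplacian_ev n W p) as [G [K [HP HK]]]. exists G, K. split; auto.
    intros y Hy. rewrite HK by auto.
    assert (E : ev n (plap n W p) y = 0).
    { destruct (le_lt_dec 2 k) as [Hk|Hk].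
      - destruct k as [|[|k]]; [lia|lia|]. apply (ev_coef_zero (2 * n + W) n k); auto.
        apply pwf_plap; auto.
      - rewrite (plap_low (2 * n + W) n W k p Hk Hp). unfold ev; simpl; ring. }
    rewrite E. field. apply Rgt_not_eq, Hy.
Qed.

Definition skip (j0 j : nat) : nat := if (j <? j0)%nat then j else S j.

Lemma sumR_skip (m j0 : nat) (f : nat -> R) : (j0 <= m)%nat ->
  sumR (S m) f = f j0 + sumR m (fun j => f (skip j0 j)).
Proof.
  revert j0; induction m as [|m IH]; intros j0 Hj.
  - replace j0 with 0%nat by lia. simpl. ring.
  - cbn [sumR] in *. destruct (Nat.eq_dec j0 (S m)) as [->|Hne].
    + rewrite (sumR_ext m (fun j => f (skip (S m) j)) f).
      * unfold skip. destruct (Nat.ltb_spec m (S m)); [ring|lia].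
      * intros i Hi. unfold skip. destruct (Nat.ltb_spec i (S m)); [auto|lia].
    + rewrite (IH j0) by lia. unfold skip at 3. destruct (Nat.ltb_spec m j0); [lia|]. ring.
Qed.

(** Gaussian elimination: a pivot [a j0 N] removes the last equation and the unknown [j0], whose
    value [- s] is then forced by that equation. *)
Lemma linear_dependence (N m : nat) (a : nat -> nat -> R) : (N < m)%nat ->
  exists c : nat -> R, (exists j, (j < m)%nat /\ c j <> 0) /\
    forall y, (y < N)%nat -> sumR m (fun j => c j * a j y) = 0.
Proof.
  revert m a; induction N as [|N IH]; intros m a Hm.
  - exists (fun _ => 1). split; [exists 0%nat; split; [lia|exact R1_neq_R0]|lia].
  - destruct (classic (exists j0, (j0 < m)%nat /\ a j0 N <> 0)) as [[j0 [Hj0 Ha]]|Hn].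
    + destruct m as [|m]; [lia|].
      destruct (IH m (fun j y => a (skip j0 j) y - a (skip j0 j) N / a j0 N * a j0 y)) as [c [[i [Hi Hc]] HS]];
        [lia|].
      set (s := sumR m (fun j => c j * (a (skip j0 j) N / a j0 N))).
      set (c' := fun j => if Nat.eqb j j0 then - s else if (j <? j0)%nat then c j else c (pred j)).
      assert (Hskip : forall j, c' (skip j0 j) = c j).
      { intros j. unfold c', skip. destruct (Nat.ltb_spec j j0).
        - destruct (Nat.eqb_spec j j0); [lia|]. destruct (Nat.ltb_spec j j0); [auto|lia].
        - destruct (Nat.eqb_spec (S j) j0); [lia|]. destruct (Nat.ltb_spec (S j) j0); [lia|auto]. }
      assert (Hc0 : c' j0 = - s) by (unfold c'; rewrite Nat.eqb_refl; auto).
      exists c'. split.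
      * exists (skip j0 i). rewrite Hskip. split; auto. unfold skip. destruct (i <? j0)%nat; lia.
      * intros y Hy. rewrite (sumR_skip m j0) by lia. rewrite Hc0.
        rewrite (sumR_ext m _ (fun j => c j * a (skip j0 j) y)) by (intros; rewrite Hskip; auto).
        assert (E : sumR m (fun j => c j * a (skip j0 j) y) =
          sumR m (fun j => c j * (a (skip j0 j) y - a (skip j0 j) N / a j0 N * a j0 y)) + a j0 y * s).
        { unfold s. rewrite <- sumR_scal, <- sumR_plus. apply sumR_ext. intros; ring. }
        destruct (Nat.eq_dec y N) as [->|Hne].
        -- rewrite E, (sumR_0 m); [ring|]. intros; field; auto.
        -- rewrite E, HS by lia. ring.
    + destruct (IH m a) as [c [Hc HS]]; [lia|]. exists c. split; auto.
      intros y Hy. destruct (Nat.eq_dec y N) as [->|]; [|apply HS; lia].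
      apply sumR_0. intros j Hj. destruct (Req_dec (a j N) 0) as [->|]; [ring|].
      exfalso; apply Hn; eauto.
Qed.

Definition lbexps (L : lens) (k : nat) : list (list nat) :=
  bexps (Z.of_nat (lq L)) (weights (lps L) (lW L)) k.

Lemma lamb_weights (L : lens) : length (weights (lps L) (lW L)) = lamb L.
Proof. apply weights_length. Qed.

Lemma sphere_eq_inU (d n k : nat) (p : poly) : pwf d k p ->
  (forall x, on_sphere d x -> ev n p x = 0) -> forall x, inU d x -> ev n p x = 0.
Proof.
  intros Hp H x Hx. rewrite (scale_normalize d x Hx), (ev_scale_pt d n k) by auto.
  rewrite H by (apply normalize_sphere; auto). ring.
Qed.

Lemma lamb_ge1 (L : lens) : lens_wf L -> (1 <= lamb L)%nat.
Proof. intros [_ [H _]]. unfold lamb. lia. Qed.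

(** The polynomials [harm_poly] of different boundary exponents are independent, as their boundary
    coefficients form an identity matrix. *)
Lemma mult_ge_bexps (L : lens) (k m : nat) : lens_wf L -> (m <= length (lbexps L k))%nat ->
  mult_ge L (INR k * (INR k + INR (lamb L) - 2)) m.
Proof.
  intros HL Hm. assert (Hd := lamb_ge1 L HL). destruct HL as [Hq [Hn _]].
  set (Y := lbexps L k) in *. set (q := Z.of_nat (lq L)). set (n := ln L) in *.
  set (P := fun j => harm_poly q (lps L) (lW L) k (nth j Y nil)).
  assert (HP : forall j, pwf (lamb L) k (P j)) by (intros j; apply pwf_harm_poly).
  exists (fun j => ev n (P j)). split.
  - intros j Hj.
    assert (HE : hom_eig (lamb L) (INR k) 0 (ev n (P j))).
    { apply hom_eig_ev; [apply HP|]. intros e He. apply coef_harm_poly_lap; auto. }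
    destruct (poly_eigenfunction _ _ _ HE) as [H1 H2].
    split; [auto|split; auto]. intros i x Hx. apply ev_invariant; [lia|].
    intros t Ht. apply in_map_iff in Ht. destruct Ht as [e [<- He]]. apply in_exps in He. tauto.
  - intros c Hc i Hi.
    set (Q := psum m (fun j => pscale (c j) (P j))).
    assert (HQ : pwf (lamb L) k Q) by (apply pwf_psum; intros; apply pwf_scale; auto).
    assert (H0 : forall x, inU (lamb L) x -> ev n Q x = 0).
    { apply (sphere_eq_inU _ _ k); auto. intros x Hx. unfold Q. rewrite ev_psum.
      rewrite <- (Hc x Hx). apply sumR_ext. intros; apply ev_scale. }
    assert (HY : In (nth i Y nil) Y) by (apply nth_In; lia).
    assert (HY' := HY). apply filter_In in HY'. destruct HY' as [Hin Hb].
    assert (Hlen := Hin). apply in_exps in Hlen. destruct Hlen as [Hlen _].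
    rewrite lamb_weights in Hlen.
    assert (E := ev_independent (lamb L) n k Q Hd ltac:(unfold lamb, n; lia) HQ H0 _ Hlen).
    unfold Q in E. rewrite coef_psum in E.
    rewrite (sumR_ext m _ (fun j => 0 + (if Nat.eqb j i then c i else 0))) in E.
    + rewrite sumR_indic, sumR_0 in E by auto. destruct (Nat.ltb_spec i m); [lra|lia].
    + intros j Hj. rewrite coef_scale. unfold P, harm_poly.
      rewrite coef_list by apply exps_NoDup.
      destruct (in_dec (list_eq_dec Nat.eq_dec) (nth i Y nil) (exps q (weights (lps L) (lW L)) k));
        [|contradiction].
      rewrite harm_boundary by auto.
      assert (HN : NoDup Y) by (apply NoDup_filter, exps_NoDup).
      destruct (list_eq_dec Nat.eq_dec (nth i Y nil) (nth j Y nil)) as [Eq|Ne];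
        destruct (Nat.eqb_spec j i) as [->|Hne]; try ring; [|contradiction].
      exfalso; apply Hne. symmetry. apply (proj1 (NoDup_nth Y nil) HN); auto; lia.
Qed.

Lemma lambda_inj (d k k' : nat) : (4 <= d)%nat ->
  INR k * (INR k + INR d - 2) = INR k' * (INR k' + INR d - 2) -> k = k'.
Proof.
  intros Hd H. apply (le_INR 4) in Hd. simpl in Hd. apply INR_eq.
  pose proof (pos_INR k). pose proof (pos_INR k').
  assert (E : (INR k - INR k') * (INR k + INR k' + INR d - 2) = 0) by lra.
  apply Rmult_integral in E. destruct E; lra.
Qed.

Lemma mult_ge_le_bexps (L : lens) (lam : R) (m : nat) : lens_wf L -> (4 <= lamb L)%nat ->
  mult_ge L lam m -> m = 0%nat \/
  exists k, lam = INR k * (INR k + INR (lamb L) - 2) /\ (m <= length (lbexps L k))%nat.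
Proof.
  intros HL Hd4 [Fs [HF Hind]]. assert (Hd := lamb_ge1 L HL). destruct HL as [Hq [Hn _]].
  destruct m as [|m0]; [left; auto|right]. set (m := S m0) in *.
  set (d := lamb L) in *. set (n := ln L) in *.
  assert (Hn2 : (2 * n <= d)%nat) by (unfold d, lamb, n; lia).
  assert (H1 : forall j, (j < m)%nat -> exists (k : nat) (u : pt -> R),
    lam = INR k * (INR k + INR d - 2) /\ hpoly d k u /\
    hom_eig d (INR k) 0 u /\ forall x, on_sphere d x -> u x = Fs j x).
  { intros j Hj. destruct (HF j Hj) as [Hs [_ HLap]].
    destruct (eigenfunction_poly d (Fs j) lam Hd4 Hs HLap) as [H0|H]; auto.
    (* A function [Fs j] vanishing on the sphere contradicts independence, by the combination with
       the single coefficient 1 at [j]. *)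
    exfalso. assert (E : 1 = 0); [|lra].
    assert (E' := Hind (fun i => if Nat.eqb i j then 1 else 0)).
    cbv beta in E'. rewrite <- (E') with (j := j); auto; [rewrite Nat.eqb_refl; auto|].
    intros x Hx. apply sumR_0. intros i Hi. destruct (Nat.eqb_spec i j) as [->|]; [|ring].
    rewrite H0 by auto. ring. }
  destruct (H1 0%nat) as [k [_ [Hk _]]]; [unfold m; lia|]. exists k. split; auto.
  assert (H2 : forall j, exists p, (j < m)%nat -> pwf d k p /\
    (forall x, on_sphere d x -> ev n p x = Fs j x) /\
    (forall e, length e = d -> coef (plap n (lW L) p) e = 0)).
  { intros j. destruct (le_lt_dec m j) as [|Hj]; [exists nil; lia|].
    destruct (H1 j Hj) as [k' [u [Hk' [Hu [He Hux]]]]].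
    (* The eigenvalue determines the degree, so all the polynomials have the same degree. *)
    assert (k' = k) by (apply (lambda_inj d); auto; congruence). subst k'.
    destruct (hpoly_ev d n k u Hn2 Hu) as [p [Hp Hpu]]. exists p. intros _.
    split; auto. split; [intros x Hx; rewrite <- Hux, Hpu; auto; apply sphere_inU; auto|].
    intros e Hlen. destruct (le_lt_dec 2 k) as [Hk2|Hk2].
    - destruct k as [|[|k]]; [lia|lia|].
      apply (ev_independent d n k); auto; [apply pwf_plap; auto|].
      intros x Hx. destruct He as [_ [_ Hlap]].
      destruct (laplacian_ev n (lW L) p) as [G [K [HP HK]]]. change (2 * n + lW L)%nat with d in HP, HK.
      rewrite <- HK by auto.
      rewrite (laplacian_on_eq d u _ G K x Hlap); auto.
      + field. apply Rgt_not_eq, Hx.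
      + intros i Hi. destruct (HP i Hi) as [P1 P2]. split; auto.
        apply (partial_on_ext d i (ev n p) u (G i) (G i)); auto. intros; symmetry; auto.
    - rewrite (plap_low d n (lW L) k p Hk2 Hp). auto. }
  set (P := fun j => proj1_sig (constructive_indefinite_description _ (H2 j))).
  assert (HP : forall j, (j < m)%nat -> pwf d k (P j) /\
    (forall x, on_sphere d x -> ev n (P j) x = Fs j x) /\
    (forall e, length e = d -> coef (plap n (lW L) (P j)) e = 0))
    by (intros j; exact (proj2_sig (constructive_indefinite_description _ (H2 j)))).
  apply Nat.nlt_ge. intros Hlt. set (Y := lbexps L k) in *.
  destruct (linear_dependence (length Y) m (fun j y => coef (P j) (nth y Y nil)) Hlt)
    as [c [[i [Hi Hci]] Hc]].
  apply Hci. apply Hind; auto.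
  set (Q := psum m (fun j => pscale (c j) (P j))).
  assert (HQ : pwf d k Q).
  { apply pwf_psum. intros j Hj. apply pwf_scale. apply HP; auto. }
  assert (HQx : forall x, on_sphere d x -> ev n Q x = sumR m (fun j => c j * Fs j x)).
  { intros x Hx. unfold Q. rewrite ev_psum. apply sumR_ext. intros j Hj.
    rewrite ev_scale. f_equal. apply HP; auto. }
  intros x Hx. rewrite <- HQx by auto. apply (ev_coef_zero d n k); auto.
  assert (Hcoef : forall e, coef Q e = sumR m (fun j => c j * coef (P j) e)).
  { intros e. unfold Q. rewrite coef_psum. apply sumR_ext. intros; apply coef_scale. }
  destruct n as [|n'] eqn:En; [unfold n in En; lia|].
  assert (EdS : d = (2 * S n' + lW L)%nat) by (rewrite <- En; reflexivity).
  intros e0 He0. rewrite EdS in He0. revert e0 He0. apply (lap_eq_unique n' (lW L)).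
  - intros e He Hb. assert (He' : length e = d) by lia.
    destruct (winv (Z.of_nat (lq L)) (weights (lps L) (lW L)) e) eqn:Hw.
    + destruct (Nat.eq_dec (deg e) k) as [Hdeg|Hdeg]; [|apply (coef_deg d k); auto].
      assert (Hin : In e Y).
      { apply filter_In. split; auto. apply in_exps. rewrite lamb_weights. auto. }
      destruct (In_nth _ _ nil Hin) as [y [Hy <-]]. rewrite Hcoef. apply Hc; auto.
    + rewrite Hcoef. apply sumR_0. intros j Hj. destruct (HP j Hj) as [Hw1 [Hw2 _]].
      rewrite (invariant_coef L k (P j) e); auto; [ring|].
      fold n. rewrite En. intros z Hz. assert (Hz' := lact_sphere L 1 z Hz).
      rewrite !Hw2 by auto. apply (HF j Hj); auto.
  - intros e He. assert (He' : length e = d) by lia.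
    replace (coef Q) with (fun e => sumR m (fun j => c j * coef (P j) e))
      by (apply functional_extensionality; intros; auto).
    rewrite lap_eq_sumR. apply sumR_0. intros j Hj. destruct (HP j Hj) as [_ [_ H3]].
    specialize (H3 e He'). rewrite coef_plap in H3 by auto.
    transitivity (c j * 0); [f_equal; exact H3|ring].
Qed.

(** * Counting the invariant exponents *)

(* Number of exponents of degree [k] whose weight is congruent to [r] modulo [q]. *)
Fixpoint cn (q : Z) (ws : list Z) : nat -> Z -> nat :=
  match ws with
  | nil => fun k r => match k with O => if ((0 - r) mod q =? 0)%Z then 1%nat else 0%nat | S _ => 0%nat end
  | w :: ws' => fix f (k : nat) (r : Z) : nat :=
      (cn q ws' k r + match k with O => 0 | S k' => f k' (r - w)%Z end)%nat
  end.

Lemma cn_cons_S (q w : Z) (ws : list Z) (k : nat) (r : Z) :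
  cn q (w :: ws) (S k) r = (cn q ws (S k) r + cn q (w :: ws) k (r - w)%Z)%nat.
Proof. reflexivity. Qed.

Lemma cn_cons_0 (q w : Z) (ws : list Z) (r : Z) : cn q (w :: ws) 0 r = cn q ws 0 r.
Proof. cbn [cn]. lia. Qed.

Lemma filter_map_length {A B : Type} (f : A -> B) (P : B -> bool) (l : list A) :
  length (filter P (map f l)) = length (filter (fun x => P (f x)) l).
Proof.
  induction l as [|x l IH]; auto. cbn [map filter]. destruct (P (f x)); simpl; auto.
Qed.

Lemma cn_enum (q : Z) (ws : list Z) (k : nat) (r : Z) :
  length (filter (fun e => ((wt ws e - r) mod q =? 0)%Z) (enum (length ws) k)) = cn q ws k r.
Proof.
  revert k r; induction ws as [|w ws IHw]; intros k r.
  - destruct k; auto. cbn [length enum filter wt cn]. destruct (_ =? 0)%Z; auto.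
  - revert r; induction k as [|k IHk]; intros r.
    + rewrite cn_cons_0, <- IHw. cbn [length enum]. rewrite app_nil_r, filter_map_length.
      f_equal. apply filter_ext. intros e. cbn [wt]. f_equal. f_equal. lia.
    + change (enum (length (w :: ws)) (S k)) with
        (map (cons 0%nat) (enum (length ws) (S k)) ++ map (inc 0) (enum (length (w :: ws)) k)).
      rewrite filter_app, length_app, !filter_map_length, cn_cons_S, <- IHw, <- IHk. f_equal.
      * f_equal. apply filter_ext. intros e. cbn [wt]. f_equal. f_equal. lia.
      * f_equal. apply filter_ext_in. intros e He. apply in_enum in He.
        destruct e as [|a e]; [simpl in He; lia|]. cbn [inc wt]. f_equal. f_equal. lia.
Qed.

Lemma exps_length (q : Z) (ws : list Z) (k : nat) : length (exps q ws k) = cn q ws k 0.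
Proof.
  rewrite <- cn_enum. unfold exps, winv. f_equal. apply filter_ext. intros e.
  rewrite Z.sub_0_r. auto.
Qed.

Definition weq (q : Z) (ws ws' : list Z) : Prop := forall k r, cn q ws k r = cn q ws' k r.

Lemma cn_mod (q : Z) (ws : list Z) (k : nat) (r r' : Z) : (0 < q)%Z -> (q | r - r')%Z ->
  cn q ws k r = cn q ws k r'.
Proof.
  intros Hq. revert k r r'; induction ws as [|w ws IHw]; intros k r r' Hr.
  - destruct k; auto. cbn [cn]. destruct Hr as [m Hm].
    replace ((0 - r) mod q)%Z with ((0 - r') mod q)%Z; auto.
    replace (0 - r')%Z with (0 - r + m * q)%Z by lia. rewrite Z_mod_plus by lia. auto.
  - revert r r' Hr; induction k as [|k IHk]; intros r r' Hr.
    + rewrite !cn_cons_0. auto.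
    + rewrite !cn_cons_S. rewrite (IHw (S k) r r'), (IHk (r - w)%Z (r' - w)%Z); auto.
      replace (r - w - (r' - w))%Z with (r - r')%Z by lia. auto.
Qed.

Lemma weq_cons (q w : Z) (ws ws' : list Z) : weq q ws ws' -> weq q (w :: ws) (w :: ws').
Proof.
  intros H k; induction k as [|k IH]; intros r; [rewrite !cn_cons_0; auto|].
  rewrite !cn_cons_S, H, IH. auto.
Qed.

Lemma weq_head (q w w' : Z) (ws : list Z) : (0 < q)%Z -> (q | w - w')%Z ->
  weq q (w :: ws) (w' :: ws).
Proof.
  intros Hq Hw k; induction k as [|k IH]; intros r; [rewrite !cn_cons_0; auto|].
  rewrite !cn_cons_S, IH. f_equal. apply cn_mod; auto.
  replace (r - w - (r - w'))%Z with (- (w - w'))%Z by lia. apply Z.divide_opp_r; auto.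
Qed.

Lemma weq_swap (q v w : Z) (ws : list Z) : weq q (v :: w :: ws) (w :: v :: ws).
Proof.
  intros k; induction k as [k IH] using lt_wf_ind; intros r.
  destruct k as [|[|k]].
  - rewrite !cn_cons_0. auto.
  - rewrite !cn_cons_S, !cn_cons_0. lia.
  - rewrite (cn_cons_S q v), (cn_cons_S q w (v :: ws)), (cn_cons_S q w ws), (cn_cons_S q v ws).
    rewrite (IH (S k) ltac:(lia) (r - v)%Z), <- (IH (S k) ltac:(lia) (r - w)%Z).
    rewrite (cn_cons_S q w (v :: ws)), (cn_cons_S q v (w :: ws)).
    rewrite (IH k ltac:(lia) (r - w - v)%Z).
    replace (r - w - v)%Z with (r - v - w)%Z by lia. lia.
Qed.

Lemma weq_perm (q : Z) (ws ws' : list Z) : Permutation ws ws' -> weq q ws ws'.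
Proof.
  intros H. induction H as [|w l l' H IH|v w l|l l' l'' H1 IH1 H2 IH2].
  - intros k r; auto.
  - apply weq_cons; auto.
  - apply weq_swap.
  - intros k r. rewrite IH1. auto.
Qed.

Lemma cn_scale (q u : Z) (ws : list Z) (k : nat) (r : Z) : (0 < q)%Z -> rel_prime u q ->
  cn q (map (Z.mul u) ws) k (u * r)%Z = cn q ws k r.
Proof.
  intros Hq Hu. revert k r; induction ws as [|w ws IHw]; intros k r.
  - destruct k; auto. cbn [map cn].
    assert (E : ((0 - u * r) mod q = 0 <-> (0 - r) mod q = 0)%Z).
    { rewrite !Z.mod_divide by lia. split; intros H.
      - apply (Gauss q u); [|apply rel_prime_sym; auto].
        replace (u * (0 - r))%Z with (0 - u * r)%Z by lia. auto.
      - replace (0 - u * r)%Z with (u * (0 - r))%Z by lia. apply Z.divide_mul_r; auto. }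
    destruct (Z.eqb_spec ((0 - u * r) mod q) 0); destruct (Z.eqb_spec ((0 - r) mod q) 0); tauto.
  - revert r; induction k as [|k IHk]; intros r; cbn [map].
    + rewrite !cn_cons_0. auto.
    + rewrite !cn_cons_S, IHw, <- IHk. cbn [map]. f_equal. f_equal. lia.
Qed.

(** A plane contributes both [p] and [- p], so the sign of a rotation number is irrelevant. *)
Lemma weights_weq (q : Z) (W : nat) (ps ps' : list Z) : (0 < q)%Z ->
  Forall2 (fun p p' => (q | p - p') \/ (q | p + p'))%Z ps ps' ->
  weq q (weights ps W) (weights ps' W).
Proof.
  intros Hq H. induction H as [|p p' ps ps' Hp H IH]; [intros k r; auto|].
  unfold weights in *. cbn [flat_map app]. intros k r.
  destruct Hp as [Hp|Hp].
  - rewrite (weq_head q p p' _ Hq Hp k r). apply weq_cons.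
    intros k' r'. rewrite (weq_head q (- p) (- p') _ Hq); [apply weq_cons; auto|].
    replace (- p - - p')%Z with (- (p - p'))%Z by lia. apply Z.divide_opp_r; auto.
  - rewrite (weq_head q p (- p') _ Hq) by (replace (p - - p')%Z with (p + p')%Z by lia; auto).
    rewrite weq_swap. rewrite (weq_head q (- p) p' _ Hq)
      by (replace (- p - p')%Z with (- (p + p'))%Z by lia; apply Z.divide_opp_r; auto).
    apply weq_cons, weq_cons; auto.
Qed.

Lemma weights_perm (W : nat) (ps ps' : list Z) : Permutation ps ps' ->
  Permutation (weights ps W) (weights ps' W).
Proof.
  intros H. unfold weights. apply Permutation_app_tail. apply Permutation_flat_map. auto.
Qed.

Lemma weights_scale (u : Z) (W : nat) (ps : list Z) :
  map (Z.mul u) (weights ps W) = weights (map (Z.mul u) ps) W.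
Proof.
  unfold weights. rewrite map_app. f_equal.
  - induction ps as [|p ps IH]; auto. cbn [flat_map map app]. rewrite IH. f_equal. f_equal. lia.
  - rewrite map_repeat. f_equal. lia.
Qed.

(** * The full list of weights and the removal of two of them *)

Definition full_ps (h : nat) : list Z := map Z.of_nat (seq 1 h).

(** The representative in $[0, q/2]$ of the class of [x] modulo [q] and up to sign. *)
Definition fold_mod (q x : Z) : Z :=
  let r := (x mod q)%Z in if (r <=? q / 2)%Z then r else (q - r)%Z.

Lemma fold_mod_spec (q x : Z) : (2 <= q)%Z ->
  (0 <= fold_mod q x <= q / 2)%Z /\ ((q | x - fold_mod q x) \/ (q | x + fold_mod q x))%Z.
Proof.
  intros Hq. unfold fold_mod. pose proof (Z.mod_pos_bound x q ltac:(lia)) as Hb.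
  pose proof (Z.div_mod x q ltac:(lia)) as Hx. pose proof (Z.div_mod q 2 ltac:(lia)) as Hh.
  pose proof (Z.mod_pos_bound q 2 ltac:(lia)) as Hb2.
  destruct (Z.leb_spec (x mod q) (q / 2)); split; try lia.
  - left. exists (x / q)%Z. lia.
  - right. exists (x / q + 1)%Z. lia.
Qed.

(** Multiplication by a unit is injective on residues up to sign and fixes only the class 0 as
    preimage of 0; an injection of a finite list into itself is a permutation. *)
Lemma unit_permutes (q : nat) (u : Z) : (2 <= q)%nat -> rel_prime u (Z.of_nat q) ->
  Permutation (map (fun p => fold_mod (Z.of_nat q) (u * p)) (full_ps (q / 2))) (full_ps (q / 2)).
Proof.
  intros Hq Hu. set (Q := Z.of_nat q) in *. assert (HQ : (2 <= Q)%Z) by lia.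
  assert (Hh : Z.of_nat (q / 2) = (Q / 2)%Z) by (rewrite Nat2Z.inj_div; auto).
  assert (Hin : forall p, In p (full_ps (q / 2)) <-> (1 <= p <= Q / 2)%Z).
  { intros p. unfold full_ps. rewrite in_map_iff. split.
    - intros [n [<- Hn]]. apply in_seq in Hn. lia.
    - intros Hp. exists (Z.to_nat p). split; [lia|]. apply in_seq. lia. }
  assert (HN : NoDup (full_ps (q / 2))).
  { apply Injective_map_NoDup; [intros a b H; lia|apply seq_NoDup]. }
  pose proof (Z.div_mod Q 2 ltac:(lia)) as Hd2. pose proof (Z.mod_pos_bound Q 2 ltac:(lia)) as Hb2.
  assert (Hdiv : forall x, (Q | u * x)%Z -> (Q | x)%Z).
  { intros x Hx. apply (Gauss Q u); auto. apply rel_prime_sym; auto. }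
  apply NoDup_Permutation_bis.
  - apply NoDup_map_NoDup_ForallPairs; auto. intros x y Hx Hy He.
    apply Hin in Hx, Hy.
    destruct (fold_mod_spec Q (u * x) HQ) as [_ H1]. destruct (fold_mod_spec Q (u * y) HQ) as [_ H2].
    rewrite He in H1. set (f := fold_mod Q (u * y)) in *.
    assert (H : (Q | u * (x - y))%Z \/ (Q | u * (x + y))%Z).
    { destruct H1 as [[m Hm]|[m Hm]]; destruct H2 as [[m' Hm']|[m' Hm']].
      - left. exists (m - m')%Z. lia.
      - right. exists (m + m')%Z. lia.
      - right. exists (m + m')%Z. lia.
      - left. exists (m - m')%Z. lia. }
    destruct H as [H|H]; apply Hdiv in H; destruct H as [m Hm].
    + assert (m = 0)%Z by nia. lia.
    + assert (m = 1)%Z by nia. lia.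
  - rewrite length_map. auto.
  - intros y Hy. apply in_map_iff in Hy. destruct Hy as [p [<- Hp]]. apply Hin in Hp. apply Hin.
    destruct (fold_mod_spec Q (u * p) HQ) as [H1 H2].
    destruct (Z.eq_dec (fold_mod Q (u * p)) 0) as [H0|]; [|lia].
    rewrite H0, Z.sub_0_r, Z.add_0_r in H2.
    assert (Hp' : (Q | p)%Z) by (apply Hdiv; tauto). destruct Hp' as [m Hm].
    assert (m = 0 \/ m >= 1 \/ m <= -1)%Z by lia. nia.
Qed.

Lemma cn_full_unit (q W : nat) (u : Z) (k : nat) (r : Z) : (2 <= q)%nat ->
  rel_prime u (Z.of_nat q) ->
  cn (Z.of_nat q) (weights (full_ps (q / 2)) W) k (u * r)%Z =
  cn (Z.of_nat q) (weights (full_ps (q / 2)) W) k r.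
Proof.
  intros Hq Hu. rewrite <- (cn_scale (Z.of_nat q) u _ k r) by (auto; lia).
  rewrite weights_scale. symmetry.
  rewrite (weights_weq (Z.of_nat q) W _
    (map (fun p => fold_mod (Z.of_nat q) (u * p)) (full_ps (q / 2)))).
  - apply weq_perm, weights_perm, unit_permutes; auto.
  - lia.
  - clear - Hq. induction (full_ps (q / 2)) as [|p l IH]; constructor; auto.
    apply fold_mod_spec. lia.
Qed.

(* Removing the variable of weight [w] multiplies the generating function by [1 - z e^w]. *)
Definition remove (w : Z) (f : nat -> Z -> Z) (k : nat) (r : Z) : Z :=
  (f k r - match k with O => 0 | S k' => f k' (r - w) end)%Z.

Lemma cn_remove (q w : Z) (ws : list Z) (k : nat) (r : Z) :
  Z.of_nat (cn q ws k r) = remove w (fun k r => Z.of_nat (cn q (w :: ws) k r)) k r.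
Proof.
  unfold remove. destruct k; [rewrite cn_cons_0|rewrite cn_cons_S]; lia.
Qed.

Lemma remove_ext (w : Z) (f g : nat -> Z -> Z) (k : nat) (r : Z) :
  (forall k r, f k r = g k r) -> remove w f k r = remove w g k r.
Proof. intros H. unfold remove. destruct k; rewrite !H; auto. Qed.

(** The coefficients of $z^j$ times the series with coefficients [m]. *)
Definition before (m : nat -> Z) (j k : nat) : Z := if (j <=? k)%nat then m (k - j)%nat else 0%Z.

(** Expansion of $(1 - z (X + X^{-1}) + z^2)(1 - z (X^b + X^{-b}) + z^2)$: the coefficient of $z^2$
    is 2 plus the four terms $X^{\pm 1 \pm b}$. *)
Lemma remove4 (M : nat -> Z -> Z) (b : Z) (m0 m1 mb : nat -> Z) :
  (forall k x, x = 0%Z -> M k x = m0 k) ->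
  (forall k x, (x = 1 \/ x = -1 \/ x = 1 + b \/ x = 1 - b \/ x = -1 + b \/ x = -1 - b)%Z ->
     M k x = m1 k) ->
  (forall k x, (x = b \/ x = - b)%Z -> M k x = mb k) ->
  forall k, remove (- b) (remove b (remove (-1) (remove 1 M))) k 0 =
  (m0 k - 2 * (before m1 1 k + before mb 1 k) + 2 * before m0 2 k + 4 * before m1 2 k
   - 2 * (before m1 3 k + before mb 3 k) + before m0 4 k)%Z.
Proof.
  intros H0 H1 Hb k. unfold before.
  destruct k as [|[|[|[|k]]]]; cbn [remove Nat.leb Nat.sub]; rewrite ?Nat.sub_0_r;
    unfold remove;
    repeat match goal with |- context [M ?k ?x] =>
      first [rewrite (H0 k x) by lia | rewrite (H1 k x) by lia | rewrite (Hb k x) by lia] end; lia.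
Qed.

Definition lens_ps (q b : nat) : list Z :=
  map Z.of_nat (filter (fun p => andb (negb (p =? 1)%nat) (negb (p =? b)%nat)) (seq 1 (q / 2))).

Lemma lens_ps_perm (q b : nat) : (2 <= b <= q / 2)%nat ->
  Permutation (1%Z :: Z.of_nat b :: lens_ps q b) (full_ps (q / 2)).
Proof.
  intros Hb. unfold lens_ps, full_ps. change (1%Z) with (Z.of_nat 1).
  rewrite <- !map_cons. apply Permutation_map. apply NoDup_Permutation.
  - constructor; [|constructor].
    + intros [H|H]; [lia|]. apply filter_In in H. destruct H as [_ H]. simpl in H. discriminate.
    + intros H. apply filter_In in H. destruct H as [_ H]. rewrite Nat.eqb_refl in H.
      rewrite Bool.andb_false_r in H. discriminate.
    + apply NoDup_filter, seq_NoDup.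
  - apply seq_NoDup.
  - intros x. cbn [In]. rewrite filter_In, in_seq. split.
    + intros [<-|[<-|[H _]]]; lia.
    + intros H. destruct (Nat.eqb_spec x 1); [auto|]. destruct (Nat.eqb_spec x b); [auto|].
      right; right. split; auto.
Qed.

(* With [1 + b] and [1 - b] units, the count is a function of the values at [0], [1] and [b] of the
   corresponding count for the full list of weights, which only depends on orbits of units. *)
Lemma exps_lens_ps (q W b b' : nat) (u : Z) (k : nat) :
  (2 <= b <= q / 2)%nat -> (2 <= b' <= q / 2)%nat -> rel_prime u (Z.of_nat q) ->
  (Z.of_nat q | Z.of_nat b' - u * Z.of_nat b)%Z ->
  rel_prime (1 + Z.of_nat b) (Z.of_nat q) -> rel_prime (1 - Z.of_nat b) (Z.of_nat q) ->
  rel_prime (1 + Z.of_nat b') (Z.of_nat q) -> rel_prime (1 - Z.of_nat b') (Z.of_nat q) ->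
  cn (Z.of_nat q) (weights (lens_ps q b) W) k 0 = cn (Z.of_nat q) (weights (lens_ps q b') W) k 0.
Proof.
  intros Hb Hb' Hu Hbb Hp Hm Hp' Hm'.
  assert (Hq : (2 <= q)%nat) by (destruct q as [|[|q]]; simpl in Hb; lia).
  set (Q := Z.of_nat q) in *. set (M := fun k r => Z.of_nat (cn Q (weights (full_ps (q / 2)) W) k r)).
  assert (HMu : forall v k r, rel_prime v Q -> M k (v * r)%Z = M k r).
  { intros v k' r Hv. unfold M. f_equal. apply cn_full_unit; auto. }
  assert (HM1 : forall v k, rel_prime v Q -> M k v = M k 1%Z).
  { intros v k' Hv. rewrite <- (Z.mul_1_r v) at 1. apply HMu; auto. }
  assert (Hopp : forall v, rel_prime v Q -> rel_prime (- v) Q).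
  { intros v [_ _ H]. constructor; try apply Z.divide_1_l.
    intros x Hx. apply H. apply Z.divide_opp_r. auto. }
  assert (H1 : rel_prime 1 Q) by apply rel_prime_1.
  assert (Hgen : forall c, (2 <= c <= q / 2)%nat -> rel_prime (1 + Z.of_nat c) Q ->
    rel_prime (1 - Z.of_nat c) Q -> Z.of_nat (cn Q (weights (lens_ps q c) W) k 0) =
    (M k 0 - 2 * (before (fun k => M k 1) 1 k + before (fun k => M k (Z.of_nat c)) 1 k)
     + 2 * before (fun k => M k 0) 2 k + 4 * before (fun k => M k 1) 2 k
     - 2 * (before (fun k => M k 1) 3 k + before (fun k => M k (Z.of_nat c)) 3 k)
     + before (fun k => M k 0) 4 k)%Z).
  { intros c Hc Hcp Hcm.
    rewrite <- (remove4 M (Z.of_nat c) (fun k => M k 0%Z) (fun k => M k 1%Z) (fun k => M k (Z.of_nat c))).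
    - rewrite (cn_remove Q (- Z.of_nat c)). apply remove_ext. intros k1 r1.
      rewrite (cn_remove Q (Z.of_nat c)). apply remove_ext. intros k2 r2.
      rewrite (cn_remove Q (-1)). apply remove_ext. intros k3 r3.
      rewrite (cn_remove Q 1). apply remove_ext. intros k4 r4. unfold M. f_equal.
      apply (weq_perm Q (weights (1%Z :: Z.of_nat c :: lens_ps q c) W)).
      apply weights_perm, lens_ps_perm; auto.
    - intros k' x ->. auto.
    - intros k' x Hx. apply HM1. destruct Hx as [->|[->|[->|[->|[->| ->]]]]]; auto.
      + apply (Hopp 1%Z); auto.
      + replace (-1 + Z.of_nat c)%Z with (- (1 - Z.of_nat c))%Z by lia. auto.
      + replace (-1 - Z.of_nat c)%Z with (- (1 + Z.of_nat c))%Z by lia. auto.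
    - intros k' x [->| ->]; auto. replace (- Z.of_nat c)%Z with (-1 * Z.of_nat c)%Z by lia.
      apply HMu, (Hopp 1%Z); auto. }
  apply Nat2Z.inj. rewrite !Hgen by auto.
  assert (Hbb' : forall k, M k (Z.of_nat b') = M k (Z.of_nat b)).
  { intros k'. rewrite <- (HMu u k' (Z.of_nat b) Hu). unfold M. f_equal. apply cn_mod; auto. lia. }
  unfold before. rewrite !Hbb'. auto.
Qed.

(** The monomial [zeta 0 * zeta 1] has weight 0, so multiplication by it maps the invariant
    exponents of degree [k - 2] bijectively onto those of degree [k] that are not on the
    boundary. *)
Lemma bexps_length (q w : Z) (ws : list Z) (k : nat) :
  length (bexps q (w :: (- w)%Z :: ws) k) =
  (length (exps q (w :: (- w)%Z :: ws) k) -
   match k with S (S k') => length (exps q (w :: (- w)%Z :: ws) k') | _ => 0 end)%nat.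
Proof.
  set (us := w :: (- w)%Z :: ws). unfold bexps.
  rewrite <- (filter_length boundary (exps q us k)).
  assert (E : length (filter (fun e => negb (boundary e)) (exps q us k)) =
    match k with S (S k') => length (exps q us k') | _ => 0%nat end); [|lia].
  assert (Hb : forall e, In e (filter (fun e => negb (boundary e)) (exps q us k)) ->
    length e = length us /\ deg e = k /\ winv q us e = true /\
    exists a b f, e = S a :: S b :: f).
  { intros e He. apply filter_In in He. destruct He as [He Hn]. apply in_exps in He.
    destruct He as [H1 [H2 H3]]. repeat split; auto.
    destruct e as [|[|a] [|[|b] f]]; simpl in H1; try lia; try discriminate. eauto. }
  destruct k as [|[|k]].
  1, 2: destruct (filter (fun e => negb (boundary e)) _) as [|e l]; auto;
    destruct (Hb e (or_introl eq_refl)) as [_ [Hd [_ [a [b [f ->]]]]]]; unfold deg in Hd; simpl in Hd; lia.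
  rewrite <- (length_map (fun e => inc 0 (inc 1 e)) (exps q us k)).
  apply Permutation_length. apply NoDup_Permutation.
  - apply NoDup_filter, exps_NoDup.
  - apply Injective_map_NoDup; [|apply exps_NoDup]. intros x y H.
    rewrite <- (dec_inc 1 x), <- (dec_inc 0 (inc 1 x)), H, !dec_inc. auto.
  - intros e. rewrite in_map_iff. split.
    + intros He. destruct (Hb e He) as [H1 [H2 [H3 [a [b [f ->]]]]]].
      exists (a :: b :: f). split; auto. apply in_exps. repeat split; auto.
      * unfold deg in *. simpl in *. lia.
      * unfold winv, us in *. cbn [wt] in *.
        replace (w * Z.of_nat a + (- w * Z.of_nat b + wt ws f))%Z with
          (w * Z.of_nat (S a) + (- w * Z.of_nat (S b) + wt ws f))%Z by lia. auto.
    + intros [f [<- Hf]]. apply in_exps in Hf. destruct Hf as [H1 [H2 H3]].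
      destruct f as [|a [|b f]]; simpl in H1; try lia. cbn [inc].
      apply filter_In. split; auto. apply in_exps. repeat split; auto.
      * unfold deg in *. simpl in *. lia.
      * unfold winv, us in *. cbn [wt] in *.
        replace (w * Z.of_nat (S a) + (- w * Z.of_nat (S b) + wt ws f))%Z with
          (w * Z.of_nat a + (- w * Z.of_nat b + wt ws f))%Z by lia. auto.
Qed.

(** * Isometries of the quotients *)

Lemma lact_ext (L : lens) (x y : pt) :
  (forall a, (a < ln L)%nat -> x (2 * a)%nat = y (2 * a)%nat /\ x (2 * a + 1)%nat = y (2 * a + 1)%nat) ->
  (forall j, (2 * ln L <= j)%nat -> x j = y j) -> x = y.
Proof.
  intros H1 H2. apply functional_extensionality; intros j.
  destruct (le_lt_dec (2 * ln L) j) as [Hj|Hj]; [apply H2; auto|].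
  destruct (Nat.Even_or_Odd j) as [[a ->]|[a ->]]; apply H1; lia.
Qed.

Lemma lang_add (L : lens) (i j a : nat) : lang L (i + j) a = lang L i a + lang L j a.
Proof.
  unfold lang. rewrite !mult_IZR, Nat2Z.inj_add, plus_IZR. unfold Rdiv. ring.
Qed.

Lemma lact_add (L : lens) (i j : nat) (x : pt) : lact L (i + j) x = lact L j (lact L i x).
Proof.
  apply (lact_ext L).
  - intros a Ha. rewrite !lact_even, !lact_odd, lact_even, lang_add, cos_plus, sin_plus by auto.
    split; ring.
  - intros k Hk. rewrite !lact_real by auto. auto.
Qed.

Lemma lact_0 (L : lens) (x : pt) : lact L 0 x = x.
Proof.
  assert (H : forall a, lang L 0 a = 0).
  { intros a. unfold lang. simpl. unfold Rdiv. ring. }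
  apply (lact_ext L).
  - intros a Ha. rewrite lact_even, lact_odd, H, cos_0, sin_0 by auto. split; ring.
  - intros k Hk. rewrite lact_real by auto. auto.
Qed.

Lemma lact_order (L : lens) (x : pt) : (0 < lq L)%nat -> lact L (lq L) x = x.
Proof.
  intros Hq. assert (H : forall a, cis (lang L (lq L) a) = RtoC 1).
  { intros a. unfold lang. rewrite <- (cis_2PI (nth a (lps L) 0%Z)). f_equal.
    rewrite mult_IZR, <- INR_IZR_INZ. field. apply not_0_INR. lia. }
  assert (Hc : forall a, cos (lang L (lq L) a) = 1) by (intros a; apply (f_equal fst (H a))).
  assert (Hs : forall a, sin (lang L (lq L) a) = 0) by (intros a; apply (f_equal snd (H a))).
  apply (lact_ext L).
  - intros a Ha. rewrite lact_even, lact_odd, Hc, Hs by auto. split; ring.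
  - intros k Hk. rewrite lact_real by auto. auto.
Qed.

(** Halves all angles, so that every [lact L k] is the square of an orthogonal map and has
    determinant 1. *)
Definition double_lens (L : lens) : lens := Lens (2 * lq L) (lps L) (lW L).

Lemma lact_double (L : lens) (k : nat) (x : pt) : (0 < lq L)%nat ->
  lact L k x = lact (double_lens L) (k + k) x.
Proof.
  intros Hq. assert (H : forall a, lang (double_lens L) (k + k) a = lang L k a).
  { intros a. unfold lang, double_lens. cbn [lq lps].
    rewrite !mult_IZR, Nat2Z.inj_add, plus_IZR, mult_INR. simpl (INR 2). field. apply not_0_INR; lia. }
  apply (lact_ext L).
  - intros a Ha. rewrite !lact_even, !lact_odd, H by auto. auto.
  - intros j Hj. rewrite !lact_real by auto. auto.
Qed.

Lemma lact_two (L : lens) (k j : nat) : (j < lamb L)%nat ->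
  exists c1 c2 j', (j' < lamb L)%nat /\ forall x, lact L k x j = c1 * x j + c2 * x j'.
Proof.
  intros Hj. destruct (le_lt_dec (2 * ln L) j) as [Hr|Hr].
  - exists 1, 0, j. split; auto. intros x. rewrite lact_real by auto. ring.
  - destruct (Nat.Even_or_Odd j) as [[a ->]|[a ->]].
    + exists (cos (lang L k a)), (sin (lang L k a)), (2 * a + 1)%nat.
      split; [unfold lamb; lia|]. intros x. apply lact_even. lia.
    + exists (cos (lang L k a)), (- sin (lang L k a)), (2 * a)%nat.
      split; [unfold lamb; lia|]. intros x. rewrite lact_odd by lia. ring.
Qed.

Definition pdot (d : nat) (x y : pt) : R := sumR d (fun i => x i * y i).

Lemma pdot_bounds (d : nat) (x y : pt) : on_sphere d x -> on_sphere d y ->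
  -1 <= pdot d x y <= 1.
Proof.
  intros [_ Hx] [_ Hy]. unfold norm2 in *.
  assert (Hs : forall s, s * s = 1 -> 0 <= 2 + 2 * (s * pdot d x y)).
  { intros s Hs. replace (2 + 2 * (s * pdot d x y)) with (sumR d (fun i => (x i + s * y i) ^ 2)).
    - rewrite <- (sumR_0 d (fun _ => 0)) by auto. apply sumR_le. intros; apply pow2_ge_0.
    - unfold pdot. rewrite <- !sumR_scal.
      rewrite (sumR_ext d _ (fun i => x i ^ 2 + (s * s * y i ^ 2 + 2 * (s * (x i * y i)))))
        by (intros; ring).
      rewrite !sumR_plus, !sumR_scal, Hx, Hy, Hs. ring. }
  pose proof (Hs 1 ltac:(ring)). pose proof (Hs (-1) ltac:(ring)). lra.
Qed.

Lemma acos_le_inv (u v : R) : -1 <= u <= 1 -> -1 <= v <= 1 -> acos u <= acos v -> v <= u.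
Proof.
  intros Hu Hv H. rewrite <- (cos_acos u), <- (cos_acos v) by auto.
  pose proof (acos_bound u). pose proof (acos_bound v). apply cos_decr_1; lra.
Qed.

Lemma fold_Rmin_le (b : R) (l : list R) : fold_right Rmin b l <= b.
Proof.
  induction l as [|a l IH]; simpl; [lra|]. eapply Rle_trans; [apply Rmin_r|auto].
Qed.

Lemma fold_Rmin_in (b : R) (l : list R) (a : R) : In a l -> fold_right Rmin b l <= a.
Proof.
  induction l as [|c l IH]; intros H; [destruct H|].
  destruct H as [->|H]; simpl; [apply Rmin_l|].
  eapply Rle_trans; [apply Rmin_r|auto].
Qed.

Lemma fold_Rmin_attained (b : R) (l : list R) :
  fold_right Rmin b l = b \/ In (fold_right Rmin b l) l.
Proof.
  induction l as [|c l IH]; simpl; auto.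
  assert (E : Rmin c (fold_right Rmin b l) = c \/
    Rmin c (fold_right Rmin b l) = fold_right Rmin b l)
    by (unfold Rmin at 1 3; destruct (Rle_dec c (fold_right Rmin b l)); auto).
  destruct E as [E|E]; rewrite E; tauto.
Qed.

Lemma qdist_le (L : lens) (x y : pt) (k : nat) : (k < lq L)%nat ->
  qdist L x y <= sdist (lamb L) x (lact L k y).
Proof.
  intros Hk. unfold qdist. destruct k as [|k]; [rewrite lact_0; apply fold_Rmin_le|].
  apply fold_Rmin_in. apply (in_map (fun k => sdist (lamb L) x (lact L k y))). apply in_seq. lia.
Qed.

Lemma qdist_attained (L : lens) (x y : pt) :
  exists k, qdist L x y = sdist (lamb L) x (lact L k y).
Proof.
  unfold qdist.
  destruct (fold_Rmin_attained (sdist (lamb L) x y)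
    (map (fun k => sdist (lamb L) x (lact L k y)) (seq 1 (lq L - 1)))) as [H|H].
  - exists 0%nat. rewrite lact_0. auto.
  - apply in_map_iff in H. destruct H as [k [H _]]. exists k. auto.
Qed.

(** As [acos] is decreasing, a quotient distance is attained at the largest inner product with the
    orbit; equal distances thus become two inequalities between inner products. *)
Lemma isometric_pdot (L1 L2 : lens) : isometric L1 L2 ->
  exists phi : pt -> pt, (forall x, on_sphere (lamb L1) x -> on_sphere (lamb L2) (phi x)) /\
  forall x y, on_sphere (lamb L1) x -> on_sphere (lamb L1) y ->
    (forall i, (i < lq L1)%nat -> exists j,
       pdot (lamb L1) x (lact L1 i y) <= pdot (lamb L2) (phi x) (lact L2 j (phi y))) /\
    (forall j, (j < lq L2)%nat -> exists i,
       pdot (lamb L2) (phi x) (lact L2 j (phi y)) <= pdot (lamb L1) x (lact L1 i y)).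
Proof.
  intros [phi [H1 [_ H2]]]. exists phi. split; auto. intros x y Hx Hy.
  assert (B1 : forall i, -1 <= pdot (lamb L1) x (lact L1 i y) <= 1)
    by (intros i; apply pdot_bounds; auto; apply lact_sphere; auto).
  assert (B2 : forall j, -1 <= pdot (lamb L2) (phi x) (lact L2 j (phi y)) <= 1)
    by (intros i; apply pdot_bounds; auto; apply lact_sphere; auto).
  specialize (H2 x y Hx Hy). split.
  - intros i Hi. destruct (qdist_attained L2 (phi x) (phi y)) as [j Hj]. exists j.
    apply acos_le_inv; auto.
    change (sdist (lamb L2) (phi x) (lact L2 j (phi y)) <= sdist (lamb L1) x (lact L1 i y)).
    rewrite <- Hj, H2. apply qdist_le; auto.
  - intros j Hj. destruct (qdist_attained L1 x y) as [i Hi]. exists i.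
    apply acos_le_inv; auto.
    change (sdist (lamb L1) x (lact L1 i y) <= sdist (lamb L2) (phi x) (lact L2 j (phi y))).
    rewrite <- Hi, <- H2. apply qdist_le; auto.
Qed.

Lemma cos_eq_congr (q x y : Z) : (0 < q)%Z ->
  cos (2 * PI * (IZR x / IZR q)) = cos (2 * PI * (IZR y / IZR q)) ->
  (q | x - y)%Z \/ (q | x + y)%Z.
Proof.
  intros Hq H.
  assert (E : sin (PI * IZR (x - y) / IZR q) * sin (PI * IZR (x + y) / IZR q) = 0).
  { assert (Hq0 : IZR q <> 0) by (apply not_0_IZR; lia).
    set (u := PI * IZR (x - y) / IZR q). set (v := PI * IZR (x + y) / IZR q).
    replace (2 * PI * (IZR x / IZR q)) with (v + u) in H
      by (unfold u, v; rewrite minus_IZR, plus_IZR; field; auto).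
    replace (2 * PI * (IZR y / IZR q)) with (v - u) in H
      by (unfold u, v; rewrite minus_IZR, plus_IZR; field; auto).
    rewrite cos_plus, cos_minus in H. lra. }
  apply Rmult_integral in E.
  destruct E as [E|E]; apply sin_PI_div in E; auto; apply Z.mod_divide in E; auto; lia.
Qed.

(** The characteristic polynomial of the rotation of plane [a], applied to a vector of that plane;
    it replaces complex eigenvectors. *)
Lemma plane_charpoly (L : lens) (k a : nat) (x : pt) : (a < ln L)%nat ->
  (forall j, j <> (2 * a)%nat -> x j = 0) -> forall j,
  lact L k (lact L k x) j + x j = (cos (lang L k a) + cos (lang L k a)) * lact L k x j.
Proof.
  intros Ha Hx j.
  cut (lact L k (lact L k x) j - 2 * cos (lang L k a) * lact L k x j + x j = 0); [lra|].
  pose proof (sin2_cos2 (lang L k a)) as Hsc. unfold Rsqr in Hsc.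
  assert (Hj : forall b, (b < ln L)%nat ->
    lact L k (lact L k x) (2 * b)%nat - 2 * cos (lang L k a) * lact L k x (2 * b)%nat + x (2 * b)%nat = 0 /\
    lact L k (lact L k x) (2 * b + 1)%nat - 2 * cos (lang L k a) * lact L k x (2 * b + 1)%nat
      + x (2 * b + 1)%nat = 0).
  { intros b Hb. rewrite !lact_even, !lact_odd, lact_even by auto.
    rewrite (Hx (2 * b + 1)%nat) by lia.
    destruct (Nat.eq_dec b a) as [->|Hne].
    - set (c := cos (lang L k a)) in *. set (s := sin (lang L k a)) in *. set (z := x (2 * a)%nat).
      split.
      + transitivity (z * (1 - (s * s + c * c))); [ring|]. rewrite Hsc. ring.
      + ring.
    - rewrite (Hx (2 * b)%nat) by lia. split; ring. }
  destruct (le_lt_dec (2 * ln L) j) as [Hr|Hr].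
  - rewrite !lact_real by auto. rewrite Hx by lia. ring.
  - destruct (Nat.Even_or_Odd j) as [[b ->]|[b ->]]; apply Hj; lia.
Qed.

(** On a plane where $g$ is a rotation with cosine $C$ one has $g^2 + 1 = 2 C g$, so the hypothesis
    reads $2 (C - c) g v = 0$ there, and $g$ is invertible. On the fixed coordinates it forces $c =
    1$. *)
Lemma charpoly_angle (L : lens) (k : nat) (c : R) (v : pt) (j : nat) : (j < lamb L)%nat ->
  (forall i, (i < lamb L)%nat -> lact L k (lact L k v) i + v i = (c + c) * lact L k v i) ->
  v j <> 0 -> c = 1 \/ exists a, (a < ln L)%nat /\ cos (lang L k a) = c.
Proof.
  intros Hj H0 Hv.
  assert (H : forall i, (i < lamb L)%nat ->
    lact L k (lact L k v) i - 2 * c * lact L k v i + v i = 0)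
    by (intros i Hi; specialize (H0 i Hi); lra). destruct (le_lt_dec (2 * ln L) j) as [Hr|Hr].
  - left. specialize (H j Hj). rewrite !lact_real in H by auto.
    assert (E : (1 - c) * v j = 0) by lra. apply Rmult_integral in E. destruct E; [lra|contradiction].
  - right. assert (Hb : exists b, (b < ln L)%nat /\ (v (2 * b)%nat <> 0 \/ v (2 * b + 1)%nat <> 0)).
    { destruct (Nat.Even_or_Odd j) as [[b ->]|[b ->]]; exists b; split; auto; lia. }
    destruct Hb as [b [Hb Hvb]]. exists b. split; auto.
    pose proof (H (2 * b)%nat ltac:(unfold lamb; lia)) as H1.
    pose proof (H (2 * b + 1)%nat ltac:(unfold lamb; lia)) as H2.
    rewrite !lact_even, !lact_odd in H1 by auto. rewrite !lact_odd, !lact_even in H2 by auto.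
    pose proof (sin2_cos2 (lang L k b)) as Hsc. unfold Rsqr in Hsc.
    set (C := cos (lang L k b)) in *. set (s := sin (lang L k b)) in *.
    set (x := v (2 * b)%nat) in *. set (y := v (2 * b + 1)%nat) in *.
    assert (E1 : 2 * (C - c) * (C * x + s * y) = 0).
    { rewrite <- H1. transitivity (2 * (C - c) * (C * x + s * y) + x * (1 - (s * s + C * C)));
        [rewrite Hsc; ring|ring]. }
    assert (E2 : 2 * (C - c) * (- s * x + C * y) = 0).
    { rewrite <- H2. transitivity (2 * (C - c) * (- s * x + C * y) + y * (1 - (s * s + C * C)));
        [rewrite Hsc; ring|ring]. }
    apply Rmult_integral in E1, E2.
    destruct E1 as [E1|E1]; [lra|]. destruct E2 as [E2|E2]; [lra|].
    assert (x = 0).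
    { transitivity (C * (C * x + s * y) - s * (- s * x + C * y)); [|rewrite E1, E2; ring].
      transitivity ((s * s + C * C) * x); [rewrite Hsc; ring|ring]. }
    assert (y = 0).
    { transitivity (s * (C * x + s * y) + C * (- s * x + C * y)); [|rewrite E1, E2; ring].
      transitivity ((s * s + C * C) * y); [rewrite Hsc; ring|ring]. }
    tauto.
Qed.

(** * Maps preserving distances of orbits, and conjugacy of cyclic groups of rotations *)

Module Orthogonal.
Import all_boot all_order all_algebra classical_sets reals ring lra.
Import Order.TTheory GRing.Theory Num.Theory.
Local Open Scope ring_scope.
Set Implicit Arguments.
Unset Strict Implicit.
Unset Printing Implicit Defensive.

Section Dot.
Context {R : realType} {d : nat}.
Implicit Types (x y z v w : 'rV[R]_d) (A B : 'M[R]_d).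

Definition dot x y : R := (x *m y^T) 0 0.

Lemma dotE x y : dot x y = \sum_j x 0 j * y 0 j.
Proof. by rewrite /dot mxE; apply: eq_bigr => j _; rewrite mxE. Qed.

Lemma dotC x y : dot x y = dot y x.
Proof. by rewrite !dotE; apply: eq_bigr => j _; rewrite mulrC. Qed.

Lemma dotDl x y z : dot (x + y) z = dot x z + dot y z.
Proof. by rewrite /dot mulmxDl mxE. Qed.

Lemma dotDr x y z : dot z (x + y) = dot z x + dot z y.
Proof. by rewrite dotC dotDl !(dotC _ z). Qed.

Lemma dotZl a x z : dot (a *: x) z = a * dot x z.
Proof. by rewrite /dot -scalemxAl mxE. Qed.

Lemma dotZr a x z : dot z (a *: x) = a * dot z x.
Proof. by rewrite dotC dotZl dotC. Qed.

Lemma dotNl x z : dot (- x) z = - dot x z.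
Proof. by rewrite -scaleN1r dotZl mulN1r. Qed.

Lemma dotNr x z : dot z (- x) = - dot z x.
Proof. by rewrite dotC dotNl dotC. Qed.

Lemma dot0l x : dot 0 x = 0.
Proof. by rewrite -(scale0r x) dotZl mul0r. Qed.

Lemma dot0r x : dot x 0 = 0.
Proof. by rewrite dotC dot0l. Qed.

Definition dotE' := (dotDl, dotDr, dotNl, dotNr, dotZl, dotZr).

Lemma dot_ge0 x : 0 <= dot x x.
Proof. by rewrite dotE; apply: sumr_ge0 => j _; rewrite -expr2 sqr_ge0. Qed.

Lemma dot_eq0 x : (dot x x == 0) = (x == 0).
Proof.
apply/idP/eqP => [|->]; last by rewrite dotE big1 // => j _; rewrite !mxE mul0r.
rewrite dotE psumr_eq0 => [/allP H|j _]; last by rewrite -expr2 sqr_ge0.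
apply/rowP => j; have := H j (mem_index_enum _).
by rewrite mxE /= mulf_eq0 orbb => /eqP.
Qed.

Lemma dot_gt0 x : (0 < dot x x) = (x != 0).
Proof. by rewrite lt_neqAle dot_ge0 andbT eq_sym dot_eq0. Qed.

Lemma dot_mulr x y A : dot x (y *m A) = dot (x *m A^T) y.
Proof. by rewrite /dot trmx_mul mulmxA. Qed.

Lemma dot_orth x y A : A *m A^T = 1%:M -> dot (x *m A) (y *m A) = dot x y.
Proof. by move=> oA; rewrite dot_mulr -mulmxA oA mulmx1. Qed.

Lemma sub_dot x y : dot (x - y) (x - y) = dot x x + dot y y - 2 * dot x y.
Proof. rewrite !dotE' (dotC y x); ring. Qed.

Lemma sub_dot_le x y z : dot (x - z) (x - z) <= 2 * dot (x - y) (x - y) + 2 * dot (y - z) (y - z).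
Proof.
have -> : x - z = (x - y) + (y - z) by rewrite addrA subrK.
move: (x - y) (y - z) => a b; have := dot_ge0 (a - b).
by rewrite sub_dot !dotE' (dotC b a); lra.
Qed.

Lemma unit_dot_eq x y : dot x x = 1 -> dot y y = 1 -> 1 <= dot x y -> x = y.
Proof.
move=> x1 y1 xy; apply/eqP; rewrite -subr_eq0 -dot_eq0 eq_le dot_ge0 andbT sub_dot x1 y1.
lra.
Qed.

Lemma small_avoid (s : seq R) : exists2 a : R, 0 < a & forall t, 0 < t -> t < a -> t \notin s.
Proof.
elim: s => [|b s [a a0 IH]]; first by exists 1.
have [b0|b0] := ltrP 0 b.
  exists (Num.min a b); first by rewrite lt_min a0.
  by move=> t t0; rewrite lt_min inE => /andP[ta tb]; rewrite negb_or lt_eqF //= IH.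
exists a => // t t0 ta; rewrite inE negb_or IH // andbT gt_eqF //; exact: le_lt_trans t0.
Qed.

(** Induction on the hyperplanes: [v] is pushed off the new one by [t *: w]. For each hyperplane not
    parallel to [w] at most one [t] is bad, and the parallel ones keep avoiding the point. *)
Lemma generic (ws : seq 'rV[R]_d) x (e : R) : 0 < e -> 0 \notin ws ->
  exists2 v, dot (v - x) (v - x) < e & forall w, w \in ws -> dot v w != 0.
Proof.
elim: ws e => [|w ws IH] e e0; first by exists x; rewrite // subrr -(scale0r x) dotZl mul0r.
rewrite inE negb_or eq_sym => /andP[w0 /IH IHws].
have [|v vx vw] := IHws (e / 4); first lra.
have [a a0 Ha] := small_avoid [seq - (dot v w') / dot w w' | w' <- w :: ws].
have ww := dot_ge0 w.
have b0 : 0 < e / 4 / (dot w w + 1) by apply: divr_gt0; lra.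
pose m := Num.min 1 (Num.min a (e / 4 / (dot w w + 1))).
have m0 : 0 < m by rewrite !lt_min ltr01 a0 b0.
pose t := m / 2; have t0 : 0 < t by rewrite /t; lra.
have [t1 ta tb] : [/\ t < 1, t < a & t < e / 4 / (dot w w + 1)].
  have : t < m by rewrite /t; lra.
  by rewrite !lt_min => /and3P[].
exists (v + t *: w).
  have := sub_dot_le (v + t *: w) v x; rewrite [v + _ - v]addrAC subrr add0r dotZl dotZr.
  have : t * (dot w w + 1) < e / 4 by rewrite -ltr_pdivlMr //; lra.
  nra.
move=> w' w'in; rewrite dotDl dotZl.
have [w'w0|w'w0] := eqVneq (dot w w') 0.
  rewrite w'w0 mulr0 addr0; apply: vw; move: w'in; rewrite inE => /orP[/eqP w'w|//].
  by move: w0; rewrite -dot_eq0 -{2}w'w w'w0 eqxx.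
apply/eqP => E; have /negP[] := Ha _ t0 ta; apply/mapP; exists w' => //.
by apply: (mulIf w'w0); rewrite divfK //; apply/eqP; rewrite -subr_eq0 opprK addrC E.
Qed.

Definition normed x := (Num.sqrt (dot x x))^-1 *: x.

Lemma sqrt_dot_gt0 x : x != 0 -> 0 < Num.sqrt (dot x x).
Proof. by rewrite -dot_gt0 sqrtr_gt0. Qed.

Lemma normed_dot x : x != 0 -> dot (normed x) (normed x) = 1.
Proof.
move=> x0; have r0 := sqrt_dot_gt0 x0; rewrite /normed dotZl dotZr.
by rewrite -{3}(sqr_sqrtr (dot_ge0 x)) expr2 mulKf ?mulVf ?gt_eqF.
Qed.

Definition cap x (e : R) y := dot y y = 1 /\ 1 - e < dot x y.

(** With $r = |v|$ and $c$ the inner product of $x$ with $v / r$, the hypothesis is $1 + r^2 - 2 r c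
    < e$. Then $c > 0$, and $(r - c)^2 \ge 0$ gives $1 - c^2 < e$; if $c < 1$, then $1 - c < 1 -
    c^2$. *)
Lemma cap_normed x v (e : R) : dot x x = 1 -> e <= 1 -> dot (v - x) (v - x) < e ->
  v != 0 /\ cap x e (normed v).
Proof.
move=> x1 e1 vx; have e0 := le_lt_trans (dot_ge0 _) vx.
move: vx; rewrite sub_dot x1 (dotC v x) => vx.
have v0 : v != 0 by apply/eqP => v0; move: vx; rewrite v0 !dot0r; lra.
have r0 := sqrt_dot_gt0 v0; split=> //; split; first exact: normed_dot.
have rr := sqr_sqrtr (dot_ge0 v); rewrite /normed dotZr.
set r := Num.sqrt _ in r0 rr *; set c := r^-1 * _.
have a : dot x v = r * c by rewrite mulVKf ?gt_eqF.
move: vx; rewrite -rr a => vx.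
have rc : 0 < r * c by have := sqr_ge0 r; lra.
have c0 : 0 < c by move: rc; rewrite pmulr_rgt0.
have cc : 1 - c ^+ 2 < e by have := sqr_ge0 (r - c); rewrite sqrrB; lra.
have [|c1] := lerP 1 c; first lra.
by have : 0 < (1 - c) * c; [apply: mulr_gt0; lra | rewrite mulrBl mul1r -expr2; lra].
Qed.

Lemma generic_unit (ws : seq 'rV[R]_d) x (e : R) : dot x x = 1 -> 0 < e -> e <= 1 -> 0 \notin ws ->
  exists y, cap x e y /\ forall w, w \in ws -> dot y w != 0.
Proof.
move=> x1 e0 e1 ws0; have [v vx vw] := generic x e0 ws0.
have [v0 vcap] := cap_normed x1 e1 vx; exists (normed v); split=> // w win.
by rewrite dotZl mulf_neq0 ?vw // invr_eq0 gt_eqF // sqrt_dot_gt0.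
Qed.

(** The vectors $x + t e_i$ with $t > 0$ are independent unless $t$ is the negative of the sum of
    the coordinates of $x$; a small $t$ avoids this value. *)
Lemma cap_basis x (e : R) : dot x x = 1 -> 0 < e -> e <= 1 ->
  exists2 V : 'M[R]_d, V \in unitmx & forall i, cap x e (row i V).
Proof.
move=> x1 e0 e1; have [a a0 Ha] := small_avoid [:: - (\sum_j x 0 j)].
pose t := Num.min a e / 2.
have m0 : 0 < Num.min a e by rewrite lt_min a0.
have t0 : 0 < t by rewrite /t; lra.
have /andP[ta te] : (t < a) && (t < e) by rewrite -lt_min /t; lra.
pose v (i : 'I_d) := x + t *: delta_mx 0 i : 'rV[R]_d.
have vx i : dot (v i - x) (v i - x) < e.
  rewrite /v [x + _]addrC addrK dotZl dotZr.
  have -> : dot (delta_mx 0 i) (delta_mx 0 i) = 1 :> R.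
    rewrite dotE (bigD1 i) //= !mxE !eqxx mulr1 big1 ?addr0 // => j /negPf ji.
    by rewrite !mxE ji andbF mul0r.
  rewrite mulr1; apply: (le_lt_trans _ te); rewrite -[leRHS]mulr1 ler_pM2l //; lra.
pose V := \matrix_i normed (v i).
exists V; last by move=> i; rewrite rowK; case: (cap_normed x1 e1 (vx i)).
rewrite -row_free_unit; apply: inj_row_free => c; rewrite mulmx_sum_row => cV.
pose b := \row_i (c 0 i * (Num.sqrt (dot (v i) (v i)))^-1).
pose S := \sum_i b 0 i.
have E : S *: x + t *: b = 0.
  rewrite -[RHS]cV {1}(row_sum_delta b) scaler_sumr /S scaler_suml -big_split /=.
  apply: eq_bigr => i _; rewrite rowK /normed [RHS]scalerA.
  have <- : b 0 i = c 0 i * (Num.sqrt (dot (v i) (v i)))^-1 by rewrite mxE.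
  by rewrite /v scalerDr !scalerA [t * _]mulrC.
have S0 : S = 0.
  have : \sum_j (S *: x + t *: b) 0 j = 0 by rewrite E big1 // => j _; rewrite mxE.
  under eq_bigr => j _ do rewrite mxE mxE [X in _ + X]mxE.
  rewrite big_split /= -!mulr_sumr -/S [t * S]mulrC -mulrDr => /eqP; rewrite mulf_eq0.
  case/orP => [/eqP//|/eqP St]; have := Ha t t0 ta; rewrite inE -subr_eq0 opprK addrC St eqxx //.
have b0 : b = 0.
  by move: E => /eqP; rewrite S0 scale0r add0r scaler_eq0 gt_eqF //= => /eqP.
apply/rowP => i; rewrite mxE; have /rowP/(_ i) := b0; rewrite !mxE => /eqP.
rewrite mulf_eq0 invr_eq0 => /orP[/eqP//|].
by rewrite gt_eqF // sqrt_dot_gt0 //; case: (cap_normed x1 e1 (vx i)).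
Qed.

Lemma mul_trmx_dot (m n : nat) (M : 'M[R]_(m, d)) (N : 'M[R]_(n, d)) i j :
  (M *m N^T) i j = dot (row i M) (row j N).
Proof. by rewrite mxE dotE; apply: eq_bigr => k _; rewrite !mxE. Qed.

(** The two products of the same block matrices, taken in either order, are block triangular and
    have equal determinants. *)
Lemma det_1_add_mul (u : 'cV[R]_d) (a : 'rV[R]_d) : \det (1%:M + u *m a) = 1 + (a *m u) 0 0.
Proof.
have E1 : block_mx 1%:M (- u) a (1%:M : 'M_1) *m block_mx 1%:M u 0 1%:M
  = block_mx 1%:M 0 a (1%:M + a *m u).
  rewrite mulmx_block !mulmx1 !mul1mx !mulmx0 !addr0 subrr ?mul0mx; congr block_mx; last by rewrite addrC.
have E2 : block_mx 1%:M u 0 1%:M *m block_mx 1%:M (- u) a (1%:M : 'M_1)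
  = block_mx (1%:M + u *m a) 0 a 1%:M.
  by rewrite mulmx_block !mulmx1 !mul1mx !mul0mx !add0r addNr.
have := congr1 determinant E1; rewrite det_mulmx => D1.
have := congr1 determinant E2; rewrite det_mulmx mulrC D1 !det_lblock !det1 mul1r mulr1 => <-.
by rewrite det_mx11 !mxE eqxx.
Qed.

(** The determinant gives $a u = 0$; evaluating orthogonality on $u^T$ then leaves $|u|^4 |a|^2 =
    0$. *)
Lemma rank_one_orth (u : 'cV[R]_d) (a : 'rV[R]_d) :
  (1%:M + u *m a) *m (1%:M + u *m a)^T = 1%:M -> \det (1%:M + u *m a) = 1 -> u *m a = 0.
Proof.
rewrite det_1_add_mul => O D.
have au : a *m u = 0.
  by apply/matrixP => i j; rewrite !ord1 [RHS]mxE; apply: (addrI 1); rewrite addr0.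
have aa : u^T *m u = (dot u^T u^T)%:M by rewrite /dot trmxK -mx11_scalar.
have E' : u^T *m ((1%:M + u *m a) *m (1%:M + u *m a)^T) *m u = u^T *m u by rewrite O mulmx1.
have auT : u^T *m a^T = 0 by rewrite -trmx_mul au trmx0.
move: E'; rewrite linearD /= trmx1 trmx_mul.
rewrite !(mulmxDl, mulmxDr) !mulmx1 ?mul1mx !mulmxA auT !mul0mx addr0.
rewrite -(mulmxA _ a u) au mulmx0 add0r -[RHS]addr0 => /addrI.
rewrite -(mulmxA _ u^T u) aa mul_mx_scalar mul_scalar_mx -!scalemxAl => /matrixP/(_ 0 0).
rewrite [LHS]mxE [X in _ * X]mxE [RHS]mxE -/(dot a a) => /eqP; rewrite !mulf_eq0 !dot_eq0 => /or3P[]/eqP.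
- by move=> u0; rewrite -[u]trmxK u0 trmx0 mul0mx.
- by move=> u0; rewrite -[u]trmxK u0 trmx0 mul0mx.
- by move=> ->; rewrite mulmx0.
Qed.

(* An element of determinant 1 of the orthogonal group fixes no hyperplane pointwise unless it is
   the identity. *)
Lemma orth_functional A y : A *m A^T = 1%:M -> \det A = 1 -> A != 1%:M -> y *m A != y ->
  exists f, [/\ f != 0, dot y f = 0 & forall v, dot v f != 0 -> v *m A != v].
Proof.
move=> OA DA A1 yA; pose N := A - 1%:M; pose a := y *m N.
have aE : a = y *m A - y by rewrite /a /N mulmxBr mulmx1.
have a0 : a != 0 by rewrite aE subr_eq0.
have aa : dot a a != 0 by rewrite dot_eq0.
(* The projection along [a = y *m N]. The columns of [N *m P] vanish at [y] and at every fixed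
   vector of [A]; if they were all zero, [A - 1] would have rank one. *)
pose P := 1%:M - (dot a a)^-1 *: (a^T *m a).
have NP : N *m P != 0.
  apply: contraNneq A1; rewrite /P mulmxBr mulmx1 -scalemxAr mulmxA => /eqP.
  rewrite subr_eq0 => /eqP NE; pose u := (dot a a)^-1 *: (N *m a^T).
  have AE : A = 1%:M + u *m a by rewrite /u -scalemxAl -NE /N addrC subrK.
  by rewrite AE [u *m a]rank_one_orth ?addr0 // -AE.
have aP : a *m P = 0.
  rewrite /P mulmxBr mulmx1 -scalemxAr mulmxA [a *m a^T]mx11_scalar -/(dot a a) mul_scalar_mx.
  by rewrite scalerA mulVf // scale1r subrr.
have /existsP[j Pj] : [exists j, row j (N *m P)^T != 0].
  apply: contraNT NP => /existsPn H; rewrite -[_ *m P]trmxK; apply/eqP.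
  rewrite (_ : (N *m P)^T = 0) ?trmx0 //; apply/row_matrixP => j.
  by rewrite row0; apply/eqP; move: (H j); rewrite negbK.
exists (row j (N *m P)^T); split => //.
  by rewrite /dot -tr_col trmxK -[col j _]mulmx1 colE mulmx1 -!mulmxA mulmxA -/a mulmxA aP mul0mx mxE.
move=> v; apply: contraNneq => vA; rewrite /dot -tr_col trmxK colE -!mulmxA mulmxA.
by rewrite {1}/N mulmxBr vA mulmx1 subrr mul0mx mxE.
Qed.

Lemma orthogonal_vector y : (1 < d)%N -> exists2 f, f != 0 & dot y f = 0.
Proof.
move=> d1; exists (nz_row (kermx y^T)).
  rewrite nz_row_eq0 -mxrank_eq0 mxrank_ker subn_eq0 -ltnNge.
  by apply: leq_ltn_trans d1; rewrite mxrank_tr rank_leq_row.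
by rewrite dotC /dot; have /sub_kermxP -> := nz_row_sub (kermx y^T); rewrite mxE.
Qed.

End Dot.

Lemma pos_lower_bound {R : realType} (s : seq R) : {in s, forall a, 0 < a} ->
  exists e : R, [/\ 0 < e, e <= 1 & {in s, forall a, e <= a}].
Proof.
elim: s => [|b s IH] H; first by exists 1.
have [|e [e0 e1 He]] := IH; first by move=> a ain; apply: H; rewrite inE ain orbT.
have b0 : 0 < b by apply: H; rewrite inE eqxx.
exists (Num.min b e); split; first by rewrite lt_min b0.
  by rewrite ge_min e1 orbT.
move=> a; rewrite inE => /orP[/eqP->|/He ea]; first by rewrite ge_min lexx.
by rewrite ge_min ea orbT.
Qed.

Record cyclic_rotations {R : realType} {d : nat} (q : nat) (G : nat -> 'M[R]_d) : Prop := {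
  rot_gt0 : (0 < q)%N;
  rot0 : G 0%N = 1%:M;
  rotD : forall i j, G (i + j)%N = G i *m G j;
  rotq : G q = 1%:M;
  rotT : forall i, G i *m (G i)^T = 1%:M;
  rot_det : forall i, \det (G i) = 1 }.

(** An exponent of the inverse of [G i], because $i + i (q - 1) = i q$. *)
Definition rinv (q i : nat) := (i * q.-1)%N.

Section Rotations.
Context {R : realType} {d q : nat} {G : nat -> 'M[R]_d}.
Hypothesis hG : cyclic_rotations q G.
Implicit Types (x y z v w : 'rV[R]_d).

Lemma rotC i j : G i *m G j = G j *m G i.
Proof. by rewrite -!(rotD hG) addnC. Qed.

Lemma rot_mod i : G (i %% q) = G i.
Proof.
rewrite {2}(divn_eq i q) (rotD hG); suff -> : G (i %/ q * q) = 1%:M by rewrite mul1mx.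
elim: (i %/ q)%N => [|m IH]; first by rewrite mul0n (rot0 hG).
by rewrite mulSn (rotD hG) (rotq hG) IH mulmx1.
Qed.

Lemma rot_inv i : G i *m G (rinv q i) = 1%:M.
Proof.
rewrite -(rotD hG) /rinv -mulnS prednK ?(rot_gt0 hG) // -rot_mod modnMl (rot0 hG) //.
Qed.

Lemma rot_inv' i : G (rinv q i) *m G i = 1%:M.
Proof. by rewrite rotC rot_inv. Qed.

Lemma rot_trmx i : (G i)^T = G (rinv q i).
Proof.
by rewrite -[LHS]mul1mx -(rot_inv' i) -mulmxA (rotT hG) mulmx1.
Qed.

Lemma rot_dot i x y : dot (x *m G i) (y *m G i) = dot x y.
Proof. by rewrite dot_orth // (rotT hG). Qed.

Lemma rot_dotl i x y : dot (x *m G i) y = dot x (y *m G (rinv q i)).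
Proof. by rewrite [RHS]dot_mulr -rot_trmx trmxK. Qed.

Lemma rot_ord i : exists k : 'I_q, G k = G i.
Proof.
have h : (i %% q < q)%N by rewrite ltn_mod (rot_gt0 hG).
by exists (Ordinal h); rewrite /= rot_mod.
Qed.

End Rotations.

Lemma unit_vector {R : realType} {d : nat} : (1 < d)%N -> exists x : 'rV[R]_d, dot x x = 1.
Proof.
case: d => // d _; exists (delta_mx 0 0).
rewrite dotE (bigD1 0) //= !mxE eqxx mulr1 big1 ?addr0 // => j /negPf j0.
by rewrite !mxE j0 andbF mul0r.
Qed.

Lemma nonfix_functional {R : realType} {d : nat} (A : 'M[R]_d) : A != 1%:M ->
  exists f : 'rV[R]_d, f != 0 /\ forall v, dot v f != 0 -> v *m A != v.
Proof.
move=> A1; pose N := A - 1%:M.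
have /existsP[j Nj] : [exists j, row j N^T != 0].
  apply: contraNT A1 => /existsPn H; rewrite -subr_eq0 -[A - _]trmxK; apply/eqP.
  rewrite (_ : (A - 1%:M)^T = 0) ?trmx0 //; apply/row_matrixP => j.
  by rewrite row0; apply/eqP; move: (H j); rewrite negbK.
exists (row j N^T); split => // v; apply: contraNneq => vA.
rewrite /dot -tr_col trmxK colE mulmxA.
by rewrite /N mulmxBr vA mulmx1 subrr mul0mx mxE.
Qed.

Section FreePoint.
Context {R : realType} {d q : nat} {G : nat -> 'M[R]_d}.
Hypothesis hG : cyclic_rotations q G.
Implicit Types (x y z v w : 'rV[R]_d).

(** If [x] is moved by every nontrivial [G k], then in a small cap around [x] no other point of the
    orbit of [z] is nearer to [y] than [z] itself. *)
Lemma free_point : (1 < d)%N -> exists x (e : R), [/\ dot x x = 1, 0 < e, e <= 1 &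
  forall y z, cap x e y -> cap x e z -> forall k, dot y (z *m G k) <= dot y z].
Proof.
move=> d1; have [u u1] := @unit_vector R d d1.
have u0 : u != 0 by rewrite -dot_eq0 u1 oner_eq0.
have /fin_all_exists[f Hf] : forall k : 'I_q, exists f : 'rV[R]_d,
    f != 0 /\ (G k != 1%:M -> forall v, dot v f != 0 -> v *m G k != v).
  move=> k; have [Gk|Gk] := eqVneq (G k) 1%:M; first by exists u.
  by have [f [f0 Hf]] := nonfix_functional Gk; exists f.
have [|x [[x1 _] Hx]] := @generic_unit R d [seq f k | k : 'I_q] u 1 u1 ltr01 (lexx _).
  by apply/mapP => -[k _ k0]; have [] := Hf k; rewrite -k0 eqxx.
have /fin_all_exists[e He] : forall k : 'I_q, exists e : R, 0 < e /\ forall y z,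
    cap x e y -> cap x e z -> dot y (z *m G k) <= dot y z.
  move=> k; have [Gk|Gk] := eqVneq (G k) 1%:M.
    by exists 1; split=> // y z _ _; rewrite Gk mulmx1.
  have xG : x *m G k != x.
    by have [_ H] := Hf k; apply: H Gk _ _; apply: Hx; apply/mapP; exists k; rewrite ?mem_enum.
  pose dl := dot (x - x *m G k) (x - x *m G k).
  have dl0 : 0 < dl by rewrite /dl dot_gt0 subr_eq0 eq_sym.
  (* With $e = dl / 48$ one has $|x - y|^2, |x - z|^2 < 2 e$, hence $|y - z|^2 < 8 e$, while the
     image $z'$ of $z$ satisfies $|y - z'|^2 > (dl - 12 e) / 4 = 9 e$. *)
  exists (dl / 48); split; first by apply: divr_gt0 => //; lra.
  move=> y z [y1 xy] [z1 xz].
  have b1 := sub_dot_le x y (x *m G k); have b2 := sub_dot_le y (z *m G k) (x *m G k).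
  have b3 := sub_dot_le y x z.
  move: b1 b2 b3; rewrite -/dl -mulmxBl (rot_dot hG) !sub_dot !(rot_dot hG) x1 y1 z1.
  by rewrite (dotC z x) (dotC y x); lra.
have [e0 [e00 e01 Hle]] := @pos_lower_bound R [seq e k | k : 'I_q]
  (fun a => ltac:(by move=> /mapP[k _ ->]; case: (He k))).
exists x, e0; split => // y z [y1 xy] [z1 xz] k.
have [i <-] := rot_ord hG k; have [_ H] := He i.
have ei : e0 <= e i by apply: Hle; apply/mapP; exists i; rewrite ?mem_enum.
by apply: H; split=> //; lra.
Qed.

End FreePoint.

Section Isometry.
Context {R : realType} {d q : nat} {G1 G2 : nat -> 'M[R]_d} {phi : 'rV[R]_d -> 'rV[R]_d}.
Hypothesis h1 : cyclic_rotations q G1.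
Hypothesis h2 : cyclic_rotations q G2.
Hypothesis d1 : (1 < d)%N.
Hypothesis phi1 : forall x, dot x x = 1 -> dot (phi x) (phi x) = 1.
Hypothesis H12 : forall x y, dot x x = 1 -> dot y y = 1 -> forall i, exists j,
  dot x (y *m G1 i) <= dot (phi x) (phi y *m G2 j).
Hypothesis H21 : forall x y, dot x x = 1 -> dot y y = 1 -> forall j, exists i,
  dot (phi x) (phi y *m G2 j) <= dot x (y *m G1 i).
Implicit Types (x y z v w : 'rV[R]_d).

(* For [y'] the reflection of [y] in the axis of [x], the points [phi y] and [phi y'] (with
   representatives nearest to [phi x]) are symmetric about the axis of [phi x]; applying the
   inequality for distances to [y, z] and to [y, z'] then shows that distances are preserved. *)
Lemma local_linear : exists x e (A : 'M[R]_d), [/\ dot x x = 1, 0 < e, e <= 1, A *m A^T = 1%:M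
  & forall y, cap x e y -> exists j, phi y *m G2 j = y *m A].
Proof.
have [x [e [x1 e0 e1 Hx]]] := free_point h1 d1.
have xcap : cap x e x by split; rewrite ?x1 //; lra.
pose rep y p := (exists j, p = phi y *m G2 j) /\ dot (phi x) p = dot x y.
have rep_ex y : cap x e y -> exists p, rep y p.
  move=> ycap; have [y1 _] := ycap; have [j Hj] := H12 x1 y1 0.
  exists (phi y *m G2 j); split; first by exists j.
  apply/eqP; rewrite eq_le; apply/andP; split; last by move: Hj; rewrite (rot0 h1) mulmx1.
  by have [i /le_trans->] := H21 x1 y1 j; rewrite // Hx.
have rep_le y z p r : cap x e y -> cap x e z -> rep y p -> rep z r -> dot p r <= dot y z.
  move=> ycap zcap [[j ->] _] [[k ->] _]; rewrite (rot_dotl h2) -mulmxA -(rotD h2).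
  by have [i /le_trans->] := H21 (proj1 ycap) (proj1 zcap) (k + rinv q j)%N; rewrite // Hx.
have rep_unit y p : cap x e y -> rep y p -> dot p p = 1.
  by move=> [y1 _] [[j ->] _]; rewrite (rot_dot h2) phi1.
pose refl y := (2 * dot x y) *: x - y.
have refl_cap y : cap x e y -> cap x e (refl y).
  by move=> [y1 xy]; rewrite /refl; split; rewrite !dotE' x1 ?y1 ?(dotC y x); first ring; lra.
have rep_refl y p p' : cap x e y -> rep y p -> rep (refl y) p' ->
    p' = (2 * dot x y) *: phi x - p.
  move=> ycap yp yp'; have ycap' := refl_cap _ ycap.
  have H := rep_le _ _ _ _ ycap ycap' yp yp'.
  have p1 := rep_unit _ _ ycap yp; have p1' := rep_unit _ _ ycap' yp'.
  have [_ xp] := yp; have [_ xp'] := yp'; have [y1 _] := ycap.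
  (* For $s = x \cdot y$ the squared norm of the difference is $2 + 2\, p \cdot p' - 4 s^2$, and [H]
     bounds $p \cdot p'$ by $2 s^2 - 1$. *)
  apply/eqP; rewrite -subr_eq0 -dot_eq0 eq_le dot_ge0 andbT.
  move: H xp'; rewrite /refl !dotE' x1 y1 (dotC y x) => H xp'.
  rewrite (dotC p' (phi x)) (dotC p (phi x)) (dotC p' p) p1 p1' xp xp' (phi1 x1).
  have := sqr_ge0 (dot x y); rewrite expr2; nra.
have rep_dot y z p r : cap x e y -> cap x e z -> rep y p -> rep z r -> dot p r = dot y z.
  move=> ycap zcap yp zr; apply/eqP; rewrite eq_le (rep_le y z) //=.
  have [r' zr'] := rep_ex _ (refl_cap _ zcap).
  have := rep_le _ _ _ _ ycap (refl_cap _ zcap) yp zr'.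
  rewrite (rep_refl _ _ _ zcap zr zr') /refl !dotE' (dotC p (phi x)) (dotC y x).
  by have [_ ->] := yp; lra.
(* The matrix [A] is defined by its values on a basis of points of the cap; equality of the Gram
   matrices makes it orthogonal. *)
have [V Vu Vcap] := cap_basis x1 e0 e1.
have /fin_all_exists[p Hp] : forall i, exists p, rep (row i V) p by move=> i; apply: rep_ex.
pose P := \matrix_i p i.
have PP : P *m P^T = V *m V^T.
  by apply/matrixP => i j; rewrite !mul_trmx_dot !rowK (rep_dot (row i V) (row j V)).
exists x, e, (invmx V *m P); split=> //.
  rewrite trmx_mul mulmxA -(mulmxA _ P) PP mulmxA mulVmx // mul1mx.
  by rewrite -trmx_mul mulVmx // trmx1.
move=> y ycap; have [r yr] := rep_ex _ ycap.
suff -> : y *m (invmx V *m P) = r by have [[j ->] _] := yr; exists j.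
pose c := y *m invmx V; have yE : y = c *m V by rewrite /c mulmxKV.
rewrite mulmxA -/c; apply/eqP; rewrite -subr_eq0 -dot_eq0 sub_dot.
have -> : dot (c *m P) (c *m P) = 1.
  by rewrite /dot trmx_mul mulmxA -(mulmxA c) PP mulmxA -yE -mulmxA -trmx_mul -yE; case: ycap.
have -> : dot r r = 1 by apply: rep_unit yr.
have rP : r *m P^T = y *m V^T.
  apply/matrixP => i j; rewrite !ord1 !mul_trmx_dot rowK !row_id.
  by rewrite (rep_dot y (row j V)).
have -> : dot (c *m P) r = 1.
  by rewrite dotC /dot trmx_mul mulmxA rP -mulmxA -trmx_mul -yE; case: ycap.
by apply/eqP; lra.
Qed.

Lemma max_rot z y : exists k, forall i, dot y (z *m G1 i) <= dot y (z *m G1 k).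
Proof.
have q0 := rot_gt0 h1.
have [k _ Hk] := @arg_maxP _ _ _ (Ordinal q0) predT (fun k : 'I_q => dot y (z *m G1 k)) isT.
by exists k => i; have [k' <-] := rot_ord h1 i; apply: Hk.
Qed.

(* Some [y] in the cap lies on none of the finitely many hyperplanes orthogonal to the nonzero
   vectors [w (k, j)], while the distances from [phi y] to the orbit of [phi z] put [y] on one. *)
Lemma global_form : exists x e (A : 'M[R]_d), [/\ dot x x = 1, 0 < e, e <= 1, A *m A^T = 1%:M
  & (forall y, cap x e y -> exists j, phi y *m G2 j = y *m A) /\
    (forall z, dot z z = 1 -> exists k j, phi z *m G2 j = z *m G1 k *m A)].
Proof.
have [x [e [A [x1 e0 e1 OA HA]]]] := local_linear; exists x, e, A; split=> //; split=> // z z1.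
pose w (kj : 'I_q * 'I_q) := phi z *m G2 kj.2 *m A^T - z *m G1 kj.1.
have [w0|] := boolP (0 \in [seq w kj | kj : 'I_q * 'I_q]); last first.
  move=> w0; have [y [ycap yw]] := generic_unit x1 e0 e1 w0; have [y1 _] := ycap.
  have [k Hk] := max_rot z y; have [jy Hjy] := HA y ycap.
  have [j Hj] := H12 y1 z1 k; have [i Hi] := H21 y1 z1 j.
  have E : dot (phi y) (phi z *m G2 j) = dot y (z *m G1 k).
    by apply/eqP; rewrite eq_le Hj andbT (le_trans Hi).
  have [j' Ej'] := rot_ord h2 (j + jy); have [k' Ek'] := rot_ord h1 k.
  have /eqP[] := yw (w (k', j')) (map_f w (mem_enum _ _)).
  rewrite /w /= dotDr dotNr Ek' Ej' -E dot_mulr trmxK -Hjy (rotD h2) mulmxA (rot_dot h2).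
  by rewrite subrr.
have /mapP[[k j] _ /esym/eqP] := w0; rewrite /w subr_eq0 => /eqP /= E.
by exists k, j; rewrite -E -mulmxA (mulmx1C OA) mulmx1.
Qed.

End Isometry.

(** Considers the supremum of the [s] such that [P] holds on $[0, s]$. *)
Lemma unit_interval_connected {R : realType} (P : R -> bool) :
  (forall s, 0 <= s -> s <= 1 -> exists2 e : R, 0 < e &
     forall s', 0 <= s' -> s' <= 1 -> `|s - s'| < e -> P s' = P s) -> P 0 -> P 1.
Proof.
move=> HP P0.
pose A : set R := [set s | [/\ 0 <= s, s <= 1 & forall s', 0 <= s' -> s' <= s -> P s']]%classic.
have A0 : A 0 by split=> // s' a b; rewrite (_ : s' = 0) //; apply/eqP; rewrite eq_le a b.
have supA : has_sup A by split; [exists 0 | exists 1 => s []].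
pose t := sup A.
have t0 : 0 <= t by apply: sup_upper_bound.
have t1 : t <= 1 by apply: ge_sup; [exists 0 | move=> s []].
have [e e0 He] := HP t t0 t1.
have [a [a0 a1 Ha]] := sup_adherent e0 supA; rewrite -/t => ta.
have at' : a <= t by apply: sup_upper_bound.
have tP : P t by rewrite -(He a) // ?Ha //; rewrite ger0_norm; lra.
have [|tlt] := lerP 1 t; first by move=> t1'; rewrite (_ : 1 = t) //; apply/eqP; rewrite eq_le t1 t1'.
pose m := Num.min (t + e / 2) 1.
have [m1 mt me] : [/\ m <= 1, t < m & m < t + e].
  split; first by rewrite ge_min lexx orbT.
    by rewrite lt_min tlt andbT; lra.
  by rewrite gt_min; apply/orP; left; lra.
have Am : A m.
  split; [lra|exact: m1|move=> s' s0 sm].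
  have [sa|sa] := lerP s' a; first exact: Ha.
  rewrite He //; first exact: le_trans m1.
  by rewrite ltr_norml; apply/andP; split; lra.
by have := sup_upper_bound supA Am; rewrite leNgt mt.
Qed.

Lemma normed_scale {R : realType} {d : nat} (c : R) (v : 'rV[R]_d) : 0 < c ->
  normed (c *: v) = normed v.
Proof.
move=> c0; rewrite /normed dotZl dotZr mulrA -expr2 sqrtrM ?sqr_ge0 //.
by rewrite sqrtr_sqr gtr0_norm // scalerA invfM mulrAC mulVf ?mul1r // gt_eqF.
Qed.

Lemma normed_cont {R : realType} {d : nat} (v : 'rV[R]_d) (e : R) : v != 0 -> 0 < e ->
  exists2 r : R, 0 < r & forall v', dot (v - v') (v - v') < r ->
    v' != 0 /\ dot (normed v - normed v') (normed v - normed v') < e.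
Proof.
move=> v0 e0; have n0 := sqrt_dot_gt0 v0; set n := Num.sqrt _ in n0.
have nn : n ^+ 2 = dot v v by rewrite sqr_sqrtr // dot_ge0.
pose b := Num.min 1 (e / 2).
have b0 : 0 < b by rewrite lt_min ltr01; lra.
have b1 : b <= 1 by rewrite ge_min lexx.
have be : b <= e / 2 by rewrite ge_min lexx orbT.
exists (n ^+ 2 * b); first by rewrite mulr_gt0 ?exprn_gt0.
move=> v' vv'.
have H : dot (n^-1 *: v' - normed v) (n^-1 *: v' - normed v) < b.
  rewrite /normed -/n -scalerBr dotZl dotZr mulrA -expr2 exprVn mulrC ltr_pdivrMr ?exprn_gt0 //.
  by rewrite mulrC (_ : dot _ _ = dot (v - v') (v - v')) // -[v' - v]opprB dotNl dotNr opprK.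
have [v'0 [_ Hd]] := cap_normed (normed_dot v0) b1 H.
have v'0' : v' != 0 by apply: contraNneq v'0 => ->; rewrite scaler0.
split=> //; rewrite sub_dot !normed_dot //.
by move: Hd; rewrite normed_scale ?invr_gt0 //; lra.
Qed.

Lemma orth_mul {R : realType} {d : nat} (A B : 'M[R]_d) :
  A *m A^T = 1%:M -> B *m B^T = 1%:M -> (A *m B) *m (A *m B)^T = 1%:M.
Proof. by move=> oA oB; rewrite trmx_mul mulmxA -(mulmxA A) oB mulmx1. Qed.

Section Conjugacy.
Context {R : realType} {d q : nat} {G1 G2 : nat -> 'M[R]_d} {phi : 'rV[R]_d -> 'rV[R]_d}.
Hypothesis h1 : cyclic_rotations q G1.
Hypothesis h2 : cyclic_rotations q G2.
Hypothesis d1 : (1 < d)%N.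
Hypothesis phi1 : forall x, dot x x = 1 -> dot (phi x) (phi x) = 1.
Hypothesis H12 : forall x y, dot x x = 1 -> dot y y = 1 -> forall i, exists j,
  dot x (y *m G1 i) <= dot (phi x) (phi y *m G2 j).
Hypothesis H21 : forall x y, dot x x = 1 -> dot y y = 1 -> forall j, exists i,
  dot (phi x) (phi y *m G2 j) <= dot x (y *m G1 i).
Variable A : 'M[R]_d.
Hypothesis OA : A *m A^T = 1%:M.
Hypothesis HA : forall z, dot z z = 1 -> exists k j, phi z *m G2 j = z *m G1 k *m A.
Implicit Types (x y z v w : 'rV[R]_d).

(* [phi] coincides with [A] on the cap, and up to the groups everywhere: [S k y] says that the sheet
   [G1 k *m A] represents [phi] at [y], and [K k] that this sheet agrees with [A] modulo [G2].  Two
   sheets only meet at fixed points of some [N i]; these matrices have determinant 1, so that the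
   fixed spaces of those different from [1] have codimension at least 2 and do not disconnect the
   sphere.  Hence the sheets with [K k] represent [phi] at all generic points, and comparing with
   the sheet at the image of the cap under [G1] gives [K 1]. *)
Let K k := [exists t : 'I_q, G1 k *m A == A *m G2 t].
Let S k y := [exists j : 'I_q, phi y *m G2 j == y *m G1 k *m A].
Let N (i : 'I_q * 'I_q * 'I_q) : 'M[R]_d :=
  G1 i.1.1 *m A *m G2 i.2 *m A^T *m (G1 i.1.2)^T.

Lemma KP k : reflect (exists t, G1 k *m A = A *m G2 t) (K k).
Proof.
apply: (iffP existsP) => [[t /eqP E]|[t E]]; first by exists t.
by have [t' Et] := rot_ord h2 t; exists t'; rewrite Et; apply/eqP.
Qed.

Lemma SP k y : reflect (exists j, phi y *m G2 j = y *m G1 k *m A) (S k y).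
Proof.
apply: (iffP existsP) => [[t /eqP E]|[t E]]; first by exists t.
by have [t' Et] := rot_ord h2 t; exists t'; rewrite Et; apply/eqP.
Qed.

Lemma AtA : A^T *m A = 1%:M.
Proof. exact: mulmx1C. Qed.

Lemma N_orth i : N i *m (N i)^T = 1%:M.
Proof.
rewrite /N; do !apply: orth_mul => //; rewrite ?(rotT h1) ?(rotT h2) ?trmxK ?AtA //.
exact/mulmx1C/(rotT h1).
Qed.

Lemma N_det i : \det (N i) = 1.
Proof.
rewrite /N !det_mulmx !det_tr (rot_det h1) (rot_det h2) (rot_det h1) !mul1r !mulr1.
by rewrite -{2}det_tr -det_mulmx OA det1.
Qed.

Lemma S_fix (k l : 'I_q) y : S k y -> S l y -> exists c, y *m N (k, l, c) = y.
Proof.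
move=> /SP[a Ea] /SP[b Eb]; have [c Ec] := rot_ord h2 (rinv q a + b); exists c.
rewrite /N /= Ec (rotD h2) !mulmxA -Ea -(mulmxA _ (G2 a)) (rot_inv h2) mulmx1 Eb.
by rewrite -(mulmxA _ A) OA mulmx1 -mulmxA (rotT h1) mulmx1.
Qed.

Lemma N_1 k l c : N (k, l, c) = 1%:M -> K k = K l.
Proof.
move=> N1; have E : G1 k *m A *m G2 c = G1 l *m A.
  rewrite -[RHS]mul1mx -N1 /N /= !mulmxA -(mulmxA _ (G1 l)^T) (mulmx1C (rotT h1 l)) mulmx1.
  by rewrite -(mulmxA _ A^T) AtA mulmx1.
apply/KP/KP => -[t Et].
  by exists (t + c)%N; rewrite -E Et -mulmxA (rotD h2).
exists (t + rinv q c)%N; rewrite (rotD h2) mulmxA -Et -E -mulmxA (rot_inv h2) mulmx1 //.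
Qed.

(** [phi] need not be continuous, but by [H12] some point of the orbit of [phi y'] is at most as far
    from [phi y] as [y'] is from [y]. So if the sheet met [phi] close to [y], it would pass closer
    to the orbit of [phi y] than the finitely many distances [D j] allow. *)
Lemma S_open (k : 'I_q) y : dot y y = 1 -> ~~ S k y -> exists e : R, 0 < e /\
  forall y', dot y' y' = 1 -> dot (y - y') (y - y') < e -> ~~ S k y'.
Proof.
move=> y1 Sy; pose D (j : 'I_q) := dot (phi y *m G2 j - y *m G1 k *m A) (phi y *m G2 j - y *m G1 k *m A).
have D0 j : 0 < D j by rewrite dot_gt0 subr_eq0; apply: contraNneq Sy => E; apply/SP; exists j.
have [|e [e0 _ He]] := @pos_lower_bound R [seq D j | j : 'I_q].
  by move=> a /mapP[j _ ->].
exists (e / 4); split=> [|y' y'1 yy']; first by lra.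
apply/SP => -[j' Ej']; have [i Hi] := H12 y1 y'1 0.
rewrite (rot0 h1) mulmx1 in Hi.
have [j Ej] := rot_ord h2 (j' + rinv q i).
have : e <= D j by apply: He; apply: map_f; rewrite mem_enum.
have b := sub_dot_le (phi y *m G2 j) (y' *m G1 k *m A) (y *m G1 k *m A).
have : dot (y' *m G1 k *m A - y *m G1 k *m A) (y' *m G1 k *m A - y *m G1 k *m A) = dot (y - y') (y - y').
  by rewrite -!mulmxBl (dot_orth _ _ OA) (rot_dot h1) -opprB dotNl dotNr opprK.
have : dot (phi y *m G2 j - y' *m G1 k *m A) (phi y *m G2 j - y' *m G1 k *m A) <= dot (y - y') (y - y').
  rewrite -Ej' Ej addnC (rotD h2) mulmxA -mulmxBl (rot_dot h2).
  rewrite !sub_dot (rot_dot h2) !phi1 // y1 y'1 (rot_dotl h2).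
  have -> : phi y' *m G2 (rinv q (rinv q i)) = phi y' *m G2 i.
    by rewrite -(rot_trmx h2 (rinv q i)) -(rot_trmx h2 i) trmxK.
  lra.
rewrite /D; lra.
Qed.

Definition on_sheet v := [exists k : 'I_q, K k && S k (normed v)].

Lemma S_avoid_open (T : pred 'I_q) v : v != 0 -> (forall k, T k -> ~~ S k (normed v)) ->
  exists2 r : R, 0 < r & forall v', dot (v - v') (v - v') < r ->
    v' != 0 /\ forall k, T k -> ~~ S k (normed v').
Proof.
move=> v0 HT; have v1 := normed_dot v0.
have /fin_all_exists[e He] : forall k : 'I_q, exists e : R, 0 < e /\ (T k ->
    forall y', dot y' y' = 1 -> dot (normed v - y') (normed v - y') < e -> ~~ S k y').
  move=> k; case Tk : (T k); last by exists 1.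
  by have [e [e0 He]] := S_open v1 (HT _ Tk); exists e.
have [|e0 [e00 _ Hle]] := @pos_lower_bound R [seq e k | k : 'I_q].
  by move=> a /mapP[k _ ->]; case: (He k).
have [r r0 Hr] := normed_cont v0 e00; exists r => // v' /Hr[v'0 vv']; split=> // k Tk.
have [_ H] := He k; apply: H => //; first exact: normed_dot.
by apply: lt_le_trans vv' _; apply: Hle; apply: map_f; rewrite mem_enum.
Qed.

Lemma S_cover y : dot y y = 1 -> exists k : 'I_q, S k y.
Proof.
move=> y1; have [k [j E]] := HA y1; have [k' Ek] := rot_ord h1 k.
by exists k'; apply/SP; exists j; rewrite Ek.
Qed.

Definition good v := v != 0 /\ forall i, N i != 1%:M -> v *m N i != v.

(** All sheets through a good point share the same value of [K]; the sheets with the other value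
    stay away nearby, and some sheet represents [phi] at every point. *)
Lemma on_sheet_locally_const v : good v -> exists2 r : R, 0 < r & forall v',
  dot (v - v') (v - v') < r -> on_sheet v' = on_sheet v.
Proof.
move=> [v0 vN]; have v1 := normed_dot v0.
have [/existsP[l /andP[Kl Sl]]|Ev] := boolP (on_sheet v).
  have [|r r0 Hr] := @S_avoid_open (fun k => ~~ K k) v v0.
    move=> k; apply: contra => Sk; have [c Hc] := S_fix Sk Sl.
    have : N (k, l, c) = 1%:M.
      apply/eqP; apply: contraTT isT => /vN /eqP[]; move: Hc; rewrite /normed -scalemxAl.
      by move=> /(scalerI _) -> //; rewrite invr_eq0 gt_eqF // sqrt_dot_gt0.
    by move=> /N_1 ->.
  exists r => // v' /Hr[v'0 H]; have [k Sk] := S_cover (normed_dot v'0).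
  by apply/existsP; exists k; rewrite Sk andbT; apply: contraTT Sk => /H.
have [|r r0 Hr] := @S_avoid_open (fun k => K k) v v0.
  by move=> k Kk; apply: contraNN Ev => Sk; apply/existsP; exists k; rewrite Kk.
exists r => // v' /Hr[v'0 H]; apply/negbTE/existsPn => k; rewrite negb_and -implybE.
by apply/implyP => /H.
Qed.

Lemma on_sheet_segment v w : (forall s, 0 <= s -> s <= 1 -> good (v + s *: (w - v))) ->
  on_sheet v = on_sheet w.
Proof.
move=> Hg; pose P s := on_sheet (v + s *: (w - v)).
have HP s : 0 <= s -> s <= 1 -> exists2 e : R, 0 < e &
    forall s', 0 <= s' -> s' <= 1 -> `|s - s'| < e -> P s' = P s.
  move=> s0 s1; have [r r0 Hr] := on_sheet_locally_const (Hg s s0 s1).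
  have D0 := dot_ge0 (w - v); set D := dot _ _ in D0.
  exists (Num.min 1 (r / (D + 1))); first by rewrite lt_min ltr01 divr_gt0 //; lra.
  move=> s' s'0 s'1; rewrite lt_min => /andP[a1 a2]; apply: Hr.
  rewrite opprD addrACA subrr add0r -scalerBl dotZl dotZr -/D mulrA -expr2 -real_normK ?num_real //.
  move: a2; rewrite ltr_pdivlMr; last lra.
  by have := normr_ge0 (s - s'); nra.
have E0 : P 0 = on_sheet v by rewrite /P scale0r addr0.
have E1 : P 1 = on_sheet w by rewrite /P scale1r addrC subrK.
rewrite -E0 -E1; apply/idP/idP; first exact: unit_interval_connected.
apply: contraTT; apply: (@unit_interval_connected R (fun s => ~~ P s)).
by move=> s s0 s1; have [e e0 He] := HP s s0 s1; exists e => // s' a b c; rewrite He.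
Qed.

(** The functionals all vanish at [y], so on the segment from [y] to [w] they are [s] times their
    value at [w], which is nonzero for [s > 0]: the segment consists of good points. The functional
    [g] keeps it away from the origin. *)
Lemma on_sheet_generic y : good y -> exists2 fs : seq 'rV[R]_d, 0 \notin fs &
  forall w, (forall f, f \in fs -> dot w f != 0) -> on_sheet y = on_sheet w.
Proof.
move=> [y0 yN]; have [g g0 yg] := @orthogonal_vector R d y d1.
have /fin_all_exists[f Hf] : forall i, exists f : 'rV[R]_d, f != 0 /\ (N i != 1%:M ->
    dot y f = 0 /\ forall v, dot v f != 0 -> v *m N i != v).
  move=> i; have [Ni|Ni] := eqVneq (N i) 1%:M; first by exists y.
  by have [f [f0 yf H]] := orth_functional (N_orth i) (N_det i) Ni (yN _ Ni); exists f.
exists (g :: [seq f i | i : 'I_q * 'I_q * 'I_q]).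
  rewrite inE negb_or eq_sym g0; apply/mapP => -[i _ fi].
  by have [] := Hf i; rewrite -fi eqxx.
move=> w Hw; apply: on_sheet_segment => s s0 s1.
have [->|sn] := eqVneq s 0; first by rewrite scale0r addr0.
have dotE0 h : dot y h = 0 -> dot w h != 0 -> dot (y + s *: (w - y)) h != 0.
  by move=> yh wh; rewrite dotDl dotZl dotDl dotNl yh oppr0 !addr0 add0r mulf_neq0.
split.
  have /dotE0 := Hw g (mem_head _ _); move=> /(_ yg); apply: contraNneq => ->.
  by rewrite dot0l.
move=> i Ni; have [_ /(_ Ni)[yf H]] := Hf i; apply/H/dotE0 => //.
by apply: Hw; rewrite inE map_f ?orbT // mem_enum.
Qed.

Lemma conjugate_of_form x (e : R) : dot x x = 1 -> 0 < e -> e <= 1 ->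
  (forall y, cap x e y -> exists j, phi y *m G2 j = y *m A) ->
  exists t, G1 1%N *m A = A *m G2 t.
Proof.
move=> x1 e0 e1 HB; have /fin_all_exists[f Hf] : forall i, exists f : 'rV[R]_d, f != 0 /\
    (N i != 1%:M -> forall v, dot v f != 0 -> v *m N i != v).
  move=> i; have [Ni|Ni] := eqVneq (N i) 1%:M.
    by exists x; rewrite -dot_eq0 x1 oner_eq0.
  by have [f [f0 Hf]] := nonfix_functional Ni; exists f.
pose m := rinv q 1.
pose ws := [seq f i | i : 'I_q * 'I_q * 'I_q] ++
  [seq f i *m G1 (rinv q m) | i : 'I_q * 'I_q * 'I_q].
have ws0 : 0 \notin ws.
  rewrite mem_cat negb_or; apply/andP; split; apply/mapP => -[i _ fi]; have [/eqP[]] := Hf i => //.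
  by rewrite -[f i]mulmx1 -(rot_inv' h1 m) mulmxA -fi mul0mx.
have [y0 [y0cap Hy0]] := generic_unit x1 e0 e1 ws0; have [y01 _] := y0cap.
pose y1 := y0 *m G1 m; have y11 : dot y1 y1 = 1 by rewrite (rot_dot h1).
have unit_neq0 y : dot y y = 1 -> y != 0 by move=> yy; rewrite -dot_eq0 yy oner_eq0.
have normed1 y : dot y y = 1 -> normed y = y.
  by move=> yy; rewrite /normed yy sqrtr1 invr1 scale1r.
have good0 : good y0.
  split=> [|i Ni]; first exact: unit_neq0.
  by have [_ H] := Hf i; apply: H Ni _ _; apply: Hy0; rewrite mem_cat map_f ?mem_enum.
have good1 : good y1.
  split=> [|i Ni]; first exact: unit_neq0.
  have [_ H] := Hf i; apply: H Ni _ _; rewrite (rot_dotl h1); apply: Hy0.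
  by rewrite mem_cat; apply/orP; right; apply/mapP; exists i; rewrite ?mem_enum.
have [fs0 fs00 Hfs0] := on_sheet_generic good0; have [fs1 fs10 Hfs1] := on_sheet_generic good1.
have [|w [_ Hw]] := @generic_unit R d (fs0 ++ fs1) x e x1 e0 e1.
  by rewrite mem_cat negb_or fs00.
have E : on_sheet y0 = on_sheet y1.
  rewrite (Hfs0 w) ?(Hfs1 w) // => f' Hf'; apply: Hw; rewrite mem_cat Hf' ?orbT //.
have [k0 Ek0] := rot_ord h1 0; have [k1 Ek1] := rot_ord h1 1.
have E0 : on_sheet y0.
  apply/existsP; exists k0; apply/andP; split.
    by apply/KP; exists 0%N; rewrite Ek0 (rot0 h1) (rot0 h2) mul1mx mulmx1.
  rewrite normed1 //; apply/SP; have [j Hj] := HB y0 y0cap.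
  by exists j; rewrite Ek0 (rot0 h1) mulmx1.
have S1 : S k1 y1.
  apply/SP; rewrite Ek1 -(mulmxA _ (G1 m)) (rot_inv' h1) mulmx1.
  have [a <-] := HB y0 y0cap; have [j Hj] := H12 y11 y01 m.
  (* As [y1] is in the orbit of [y0], the bound [Hj] makes an inner product of unit vectors at least
     1. *)
  have E1 : phi y1 = phi y0 *m G2 j.
    apply: unit_dot_eq; rewrite ?(rot_dot h2) ?phi1 //.
    by apply: le_trans Hj; rewrite y11.
  by exists (rinv q j + a)%N; rewrite E1 (rotD h2) mulmxA -(mulmxA _ (G2 j)) (rot_inv h2) mulmx1.
move: E0; rewrite E => /existsP[k /andP[Kk]]; rewrite normed1 // => Sk.
have [c Hc] := S_fix Sk S1.
have : N (k, k1, c) = 1%:M.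
  by apply/eqP; apply: contraTT isT => /(proj2 good1) /eqP[].
by move/N_1; rewrite Kk => /esym/KP; rewrite Ek1.
Qed.

End Conjugacy.

Theorem conjugate_rotations {R : realType} {d q : nat} (G1 G2 : nat -> 'M[R]_d)
    (phi : 'rV[R]_d -> 'rV[R]_d) :
  cyclic_rotations q G1 -> cyclic_rotations q G2 -> (1 < d)%N ->
  (forall x, dot x x = 1 -> dot (phi x) (phi x) = 1) ->
  (forall x y, dot x x = 1 -> dot y y = 1 -> forall i, exists j,
     dot x (y *m G1 i) <= dot (phi x) (phi y *m G2 j)) ->
  (forall x y, dot x x = 1 -> dot y y = 1 -> forall j, exists i,
     dot (phi x) (phi y *m G2 j) <= dot x (y *m G1 i)) ->
  exists (A : 'M[R]_d) t, A *m A^T = 1%:M /\ G1 1%N *m A = A *m G2 t.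
Proof.
move=> h1 h2 d1 phi1 H12 H21.
have [x [e [A [x1 e0 e1 OA [HB HA]]]]] := global_form h1 h2 d1 phi1 H12 H21.
have [t Ht] := conjugate_of_form h1 h2 d1 phi1 H12 OA HA x1 e0 e1 HB.
by exists A, t.
Qed.

End Orthogonal.

(** * From points and lens spaces to row vectors and rotation matrices *)

Module RotationMatrix.
Import all_boot all_order all_algebra reals Rstruct.
Import Order.TTheory GRing.Theory Num.Theory.
Import Orthogonal.
Local Open Scope ring_scope.
Set Implicit Arguments.
Unset Strict Implicit.
Unset Printing Implicit Defensive.
Local Notation R := Rdefinitions.R.

Definition of_pt (d : nat) (x : pt) : 'rV[R]_d := \row_j x j.
Definition to_pt (d : nat) (v : 'rV[R]_d) : pt :=
  fun j => if insub j is Some i then v 0 i else 0.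

Lemma to_ptE d (v : 'rV[R]_d) (i : 'I_d) : to_pt v i = v 0 i.
Proof. by rewrite /to_pt valK. Qed.

Lemma of_ptK d (v : 'rV[R]_d) : of_pt d (to_pt v) = v.
Proof. by apply/rowP => i; rewrite mxE to_ptE. Qed.

Lemma sumR_big d (f : nat -> R) : sumR d f = \sum_(j < d) f j.
Proof. by elim: d => [|d IH] /=; rewrite ?big_ord0 // big_ord_recr /= -IH RplusE. Qed.

Lemma dot_of_pt d x y : dot (of_pt d x) (of_pt d y) = pdot d x y.
Proof.
rewrite dotE /pdot sumR_big; apply: eq_bigr => j _.
by rewrite !mxE RmultE.
Qed.

Lemma pdot_norm2 d x : pdot d x x = norm2 d x.
Proof. by apply: sumR_ext => i _; rewrite /= Rmult_1_r. Qed.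

Lemma to_pt_sphere d (v : 'rV[R]_d) : dot v v = 1 -> on_sphere d (to_pt v).
Proof.
move=> v1; split.
  by move=> i /ssrnat.leP di; rewrite /to_pt insubF // ltnNge di.
by rewrite -pdot_norm2 -dot_of_pt of_ptK v1.
Qed.

Lemma of_pt_sphere d x : on_sphere d x -> dot (of_pt d x) (of_pt d x) = 1.
Proof. by move=> [_ H]; rewrite dot_of_pt pdot_norm2 H. Qed.

Definition basis_pt (a : nat) : pt := fun j => if Nat.eqb j a then 1 else 0.

Definition rotmx (d : nat) (L : lens) (k : nat) : 'M[R]_d :=
  \matrix_(a, b) lact L k (basis_pt a) b.

Lemma row_rotmx d L k a : row a (rotmx d L k) = of_pt d (lact L k (basis_pt a)).
Proof. by apply/rowP => b; rewrite !mxE. Qed.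

Lemma basis_sum d (x : pt) j : (j < d)%N -> \sum_(a < d) x a * basis_pt a j = x j.
Proof.
move=> jd; rewrite (bigD1 (Ordinal jd)) //= big1 ?addr0 => [|i ij].
  by rewrite /basis_pt Nat.eqb_refl mulr1.
rewrite /basis_pt; case: Nat.eqb_spec => [E|_]; last by rewrite mulr0.
by case/eqP: ij; apply: val_inj.
Qed.

Lemma of_pt_lact L k x :
  of_pt (lamb L) (lact L k x) = of_pt (lamb L) x *m rotmx (lamb L) L k.
Proof.
apply/rowP => b; rewrite !mxE.
have /ssrnat.leP/(lact_two L k) [c1 [c2 [j' [/ssrnat.leP j'd H]]]] := ltn_ord b.
rewrite H RplusE !RmultE.
under eq_bigr => a _ do rewrite !mxE H RplusE !RmultE mulrDr.
rewrite big_split /= -(basis_sum x (ltn_ord b)) -(basis_sum x j'd) !mulr_sumr.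
by congr (_ + _); apply: eq_bigr => a _; rewrite mulrCA.
Qed.

Lemma rotmx_cyclic L : (0 < lq L)%N -> cyclic_rotations (lq L) (rotmx (lamb L) L).
Proof.
have Hadd L' i j : rotmx (lamb L') L' (i + j)%N = rotmx (lamb L') L' i *m rotmx (lamb L') L' j.
  by apply/row_matrixP => a; rewrite row_mul !row_rotmx -of_pt_lact lact_add.
have H0 L' : rotmx (lamb L') L' 0 = 1%:M.
  apply/matrixP => a b; rewrite !mxE lact_0 /basis_pt.
  case: Nat.eqb_spec => [E|E]; first by rewrite (_ : a == b) //; apply/eqP/val_inj.
  by rewrite (_ : (a == b) = false) //; apply/eqP => ab; case: E; rewrite ab.
have HT L' i : rotmx (lamb L') L' i *m (rotmx (lamb L') L' i)^T = 1%:M.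
  apply/matrixP => a b; rewrite mul_trmx_dot !row_rotmx dot_of_pt /pdot lact_dot.
  rewrite -/(pdot (lamb L') (basis_pt a) (basis_pt b)) -dot_of_pt -[RHS]mul1r -(H0 L').
  have E c : of_pt (lamb L') (basis_pt c) = of_pt (lamb L') (lact L' 0 (basis_pt c)) by rewrite lact_0.
  by rewrite !E -!row_rotmx -mul_trmx_dot H0 trmx1 mulmx1 mul1r.
move=> /ssrnat.leP q0; split=> //; first exact/ssrnat.leP.
- by apply/row_matrixP => a; rewrite row_rotmx lact_order // -{1}(lact_0 L (basis_pt a)) -row_rotmx H0.
- move=> i; have -> : rotmx (lamb L) L i = rotmx (lamb L) (double_lens L) (i + i).
    by apply/matrixP => a b; rewrite !mxE lact_double.
  have -> : lamb L = lamb (double_lens L) by [].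
  rewrite Hadd det_mulmx; have := congr1 determinant (HT (double_lens L) i).
  by rewrite det_mulmx det_tr det1.
Qed.

(** The conjugating matrix carries the relation of [plane_charpoly] for a basis vector of plane [a]
    to the power [t] of the second generator, where [charpoly_angle] reads off the angle. *)
Theorem isometric_angles (L1 L2 : lens) : (1 < lamb L1)%coq_nat -> lamb L2 = lamb L1 ->
  (0 < lq L1)%coq_nat -> lq L2 = lq L1 -> isometric L1 L2 ->
  exists t : nat, forall a, (a < ln L1)%coq_nat -> cos (lang L1 1 a) = R1 \/
    exists b, (b < ln L2)%coq_nat /\ cos (lang L2 t b) = cos (lang L1 1 a).
Proof.
move=> /ssrnat.ltP d1 dE /ssrnat.ltP q0 qE /isometric_pdot[phi [phi1 Hphi]].
have := @rotmx_cyclic L1 q0; have := @rotmx_cyclic L2; rewrite qE q0 => /(_ isT).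
have E2 := @of_pt_lact L2; move: phi1 Hphi E2; rewrite dE qE; set d := lamb L1 in d1 *.
move=> phi1 Hphi E2 h2 h1; have E1 : forall k x, of_pt d (lact L1 k x) = _ := @of_pt_lact L1.
pose psi (v : 'rV[R]_d) := of_pt d (phi (to_pt v)).
have [|||A [t [OA At]]] := @conjugate_rotations _ d (lq L1) _ _ psi h1 h2 d1.
- by move=> v /to_pt_sphere/phi1/of_pt_sphere.
- move=> v w v1 w1 i; have [i' <-] := rot_ord h1 i.
  have [H _] := Hphi _ _ (to_pt_sphere v1) (to_pt_sphere w1).
  have [j Hj] := H i' (elimT ssrnat.ltP (ltn_ord i')); exists j.
  rewrite -E2 dot_of_pt -{1}(of_ptK v) -{1}(of_ptK w) -E1 dot_of_pt; exact/RleP.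
- move=> v w v1 w1 j; have [j' <-] := rot_ord h2 j.
  have [_ H] := Hphi _ _ (to_pt_sphere v1) (to_pt_sphere w1).
  have [i Hi] := H j' (elimT ssrnat.ltP (ltn_ord j')); exists i.
  rewrite -E2 dot_of_pt -{2}(of_ptK v) -{2}(of_ptK w) -E1 dot_of_pt; exact/RleP.
exists t => a /ssrnat.ltP an; pose e := of_pt d (basis_pt (2 * a)).
have [v vE] : exists v, v = e *m A by exists (e *m A).
have ad : (2 * a < d)%N.
  by rewrite /d /lamb; apply: (leq_trans (n := 2 * ln L1)); rewrite ?ltn_mul2l // leq_addr.
have v0 : v != 0.
  rewrite vE -dot_eq0 dot_orth // dot_of_pt pdot_norm2 -pdot_norm2 /pdot sumR_big.
  rewrite (bigD1 (Ordinal ad)) //= RmultE /basis_pt Nat.eqb_refl mulr1 paddr_eq0 ?ler01 //.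
    by rewrite oner_eq0.
  by apply: sumr_ge0 => i _; rewrite RmultE -expr2 sqr_ge0.
have [j vj] : exists j, v 0 j != 0.
  apply/existsP; apply: contraNT v0 => /existsPn H; apply/eqP/rowP => j.
  by rewrite [RHS]mxE; apply/eqP; move: (H j); rewrite negbK.
have Vj := to_ptE v j.
have [|||c1|[b Hb]] := @charpoly_angle L2 t (cos (lang L1 1 a)) (to_pt v) j.
- by rewrite dE; apply/ssrnat.ltP.
- move=> i; rewrite dE => /ssrnat.ltP id; set c := cos _.
  have P : of_pt d (lact L1 1 (lact L1 1 (basis_pt (2 * a)))) + e =
      (c + c) *: of_pt d (lact L1 1 (basis_pt (2 * a))).
    apply/rowP => k; rewrite !mxE -RplusE; apply: plane_charpoly; first exact/ssrnat.ltP.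
    by move=> k' /Nat.eqb_neq Hk; rewrite /basis_pt Hk.
  have Q : of_pt d (lact L2 t (lact L2 t (to_pt v))) + v =
      (c + c) *: of_pt d (lact L2 t (to_pt v)).
    have At' (u : 'rV[R]_d) : u *m rotmx d L1 1 *m A = u *m A *m rotmx d L2 t.
      by rewrite -!mulmxA At.
    move/(congr1 (mulmx^~ A)): P; rewrite /= mulmxDl -scalemxAl !E1 -/d -/e !At' => P.
    by rewrite !E2 of_ptK vE.
  move/rowP/(_ (Ordinal id)): Q; rewrite !mxE.
  by rewrite -(to_ptE v (Ordinal id)).
- by move=> V0; move: vj; rewrite -Vj V0 eqxx.
- by left.
by right; exists b.
Qed.

End RotationMatrix.

(** * The pairs of lens spaces *)

Definition congr_pm (q x y : Z) : Prop := (q | x - y)%Z \/ (q | x + y)%Z.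

Lemma congr_pm_sym (q x y : Z) : congr_pm q x y -> congr_pm q y x.
Proof.
  intros [[m H]|[m H]]; [left; exists (- m)%Z|right; exists m]; lia.
Qed.

Lemma congr_pm_trans (q x y z : Z) : congr_pm q x y -> congr_pm q y z -> congr_pm q x z.
Proof.
  intros [[m H]|[m H]] [[m' H']|[m' H']].
  - left. exists (m + m')%Z. lia.
  - right. exists (m + m')%Z. lia.
  - right. exists (m - m')%Z. lia.
  - left. exists (m - m')%Z. lia.
Qed.

Lemma congr_pm_mul (q u x y : Z) : congr_pm q x y -> congr_pm q (u * x) (u * y).
Proof. intros [[m H]|[m H]]; [left|right]; exists (u * m)%Z; lia. Qed.

Lemma congr_pm_cancel (q u x y : Z) : rel_prime u q -> congr_pm q (u * x) (u * y) -> congr_pm q x y.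
Proof.
  intros Hu [H|H]; [left|right]; apply (Gauss q u); try (apply rel_prime_sym; auto).
  - rewrite Z.mul_sub_distr_l. auto.
  - rewrite Z.mul_add_distr_l. auto.
Qed.

Lemma congr_pm_range (q x y : Z) : (1 <= x <= q / 2)%Z -> (1 <= y <= q / 2)%Z ->
  congr_pm q x y -> x = y.
Proof.
  intros Hx Hy H. pose proof (Z.div_mod q 2 ltac:(lia)). pose proof (Z.mod_pos_bound q 2 ltac:(lia)).
  destruct H as [[m Hm]|[m Hm]].
  - assert (m = 0)%Z by nia. lia.
  - assert (m = 1)%Z by nia. lia.
Qed.

Lemma rel_prime_congr (q x y : Z) : (q | x - y)%Z -> rel_prime x q -> rel_prime y q.
Proof.
  intros Hd [_ _ H]. constructor; try apply Z.divide_1_l.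
  intros z Hy Hq. apply H; auto. replace x with (y + (x - y))%Z by lia.
  apply Z.divide_add_r; auto. eapply Z.divide_trans; eauto.
Qed.

Lemma rel_prime_opp (q x : Z) : rel_prime x q -> rel_prime (- x) q.
Proof.
  intros [_ _ H]. constructor; try apply Z.divide_1_l.
  intros z Hz. apply H. apply Z.divide_opp_r. auto.
Qed.

Lemma rel_prime_congr_pm (q x y : Z) : congr_pm q x y -> rel_prime x q -> rel_prime y q.
Proof.
  intros [H|H] Hx; [eapply rel_prime_congr; eauto|].
  replace y with (- - y)%Z by lia. apply rel_prime_opp. apply (rel_prime_congr q x); auto.
  replace (x - - y)%Z with (x + y)%Z by lia. auto.
Qed.

Lemma lens_ps_in (q b : nat) (p : Z) : (2 <= b <= q / 2)%nat ->
  In p (lens_ps q b) <-> (1 <= p <= Z.of_nat q / 2)%Z /\ p <> 1%Z /\ p <> Z.of_nat b.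
Proof.
  intros Hb. assert (Hh : Z.of_nat (q / 2) = (Z.of_nat q / 2)%Z) by (rewrite Nat2Z.inj_div; auto).
  unfold lens_ps. rewrite in_map_iff. split.
  - intros [n [<- Hn]]. apply filter_In in Hn. destruct Hn as [Hn Hc]. apply in_seq in Hn.
    apply Bool.andb_true_iff in Hc. destruct Hc as [H1 H2].
    apply Bool.negb_true_iff, Nat.eqb_neq in H1, H2. lia.
  - intros Hp. exists (Z.to_nat p). split; [lia|]. apply filter_In. split; [apply in_seq; lia|].
    apply Bool.andb_true_iff. split; apply Bool.negb_true_iff, Nat.eqb_neq; lia.
Qed.

Lemma lens_ps_length (q b : nat) : (2 <= b <= q / 2)%nat -> length (lens_ps q b) = (q / 2 - 2)%nat.
Proof.
  intros Hb. pose proof (Permutation_length (lens_ps_perm q b Hb)) as H.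
  unfold full_ps in H. rewrite length_map, length_seq in H. cbn [length] in H. lia.
Qed.

(** A common divisor of all weights divides a difference 1. This serves both for the gcd condition
    of [lens_wf] and for showing that the power in [lens_ps_not_isometric] is a unit. *)
Lemma lens_ps_consecutive (q b : nat) : (10 <= q)%nat -> (2 <= b <= q / 2)%nat ->
  exists c, In c (lens_ps q b) /\ In (c + 1)%Z (lens_ps q b).
Proof.
  intros Hq Hb. assert (H5 : (5 <= Z.of_nat q / 2)%Z) by (apply Z.div_le_lower_bound; lia).
  destruct (Nat.eq_dec b 2); [|destruct (Nat.eq_dec b 3)].
  1, 2: exists 4%Z; rewrite !lens_ps_in by auto; lia.
  exists 2%Z. rewrite !lens_ps_in by auto. lia.
Qed.

Lemma fold_gcd_divide (l : list Z) (a : Z) :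
  (fold_left Z.gcd l a | a)%Z /\ forall x, In x l -> (fold_left Z.gcd l a | x)%Z.
Proof.
  revert a; induction l as [|y l IH]; intros a; simpl.
  - split; [apply Z.divide_refl|tauto].
  - destruct (IH (Z.gcd a y)) as [H1 H2]. split.
    + eapply Z.divide_trans; [exact H1|apply Z.gcd_divide_l].
    + intros x [<-|Hx]; auto. eapply Z.divide_trans; [exact H1|apply Z.gcd_divide_r].
Qed.

Lemma fold_gcd_nonneg (l : list Z) (a : Z) : (0 <= a)%Z -> (0 <= fold_left Z.gcd l a)%Z.
Proof. revert a; induction l as [|y l IH]; intros a Ha; simpl; auto. apply IH, Z.gcd_nonneg. Qed.

Lemma lens_ps_wf (q b W : nat) : (10 <= q)%nat -> (2 <= b <= q / 2)%nat ->
  lens_wf (Lens q (lens_ps q b) W).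
Proof.
  intros Hq Hb. assert (H5 : (5 <= q / 2)%nat) by (apply Nat.div_le_lower_bound; lia).
  split; [simpl; lia|]. split; [unfold ln; cbn [lps]; rewrite lens_ps_length; lia|]. cbn [lq lps].
  destruct (lens_ps_consecutive q b Hq Hb) as [c [Hc1 Hc2]].
  pose proof (fold_gcd_divide (lens_ps q b) (Z.of_nat q)) as [_ H].
  pose proof (fold_gcd_nonneg (lens_ps q b) (Z.of_nat q) ltac:(lia)) as H0.
  set (g := fold_left Z.gcd (lens_ps q b) (Z.of_nat q)) in *.
  assert (Hg : (g | 1)%Z).
  { replace 1%Z with (c + 1 - c)%Z by lia. apply Z.divide_sub_r; auto. }
  apply Z.divide_1_r in Hg. lia.
Qed.

(* An isometry conjugates the generator of the first group to some power [t] of the generator of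
   the second one; as [1] and [b] are missing from one list, and [1] and [b'] from the other one,
   [t] is [1] or [-1] because [b] is not a unit, and then [b = b']. *)
Lemma lens_ps_not_isometric (q b b' W : nat) : (10 <= q)%nat -> (2 <= b <= q / 2)%nat ->
  (2 <= b' <= q / 2)%nat -> b <> b' -> ~ rel_prime (Z.of_nat b) (Z.of_nat q) ->
  ~ isometric (Lens q (lens_ps q b) W) (Lens q (lens_ps q b') W).
Proof.
  intros Hq Hb Hb' Hne Hnu HI. set (Q := Z.of_nat q) in *.
  assert (H5 : (5 <= q / 2)%nat) by (apply Nat.div_le_lower_bound; lia).
  assert (Hh : Z.of_nat (q / 2) = (Q / 2)%Z) by (unfold Q; rewrite Nat2Z.inj_div; auto).
  assert (Hlen := lens_ps_length q b Hb). assert (Hlen' := lens_ps_length q b' Hb').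
  destruct (@RotationMatrix.isometric_angles (Lens q (lens_ps q b) W) (Lens q (lens_ps q b') W))
    as [t0 Ht]; auto; try (unfold lamb, ln; cbn [lps lW lq]; lia).
  assert (HC : forall p, In p (lens_ps q b) -> exists p', In p' (lens_ps q b') /\
    congr_pm Q (Z.of_nat t0 * p') p).
  { intros p Hp. destruct (In_nth _ _ 0%Z Hp) as [a [Ha Hpa]].
    assert (Hp' := Hp). apply lens_ps_in in Hp'; auto. fold Q in Hp'.
    destruct (Ht a Ha) as [H1|[c [Hc H1]]]; unfold lang in H1; cbn [lps lq] in H1;
      rewrite Hpa, !INR_IZR_INZ in H1; fold Q in H1; rewrite Z.mul_1_l in H1.
    - exfalso. change R1 with 1 in H1.
      assert (E : cos (2 * PI * (IZR p / IZR Q)) = cos (2 * PI * (IZR 0 / IZR Q))).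
      { rewrite H1. unfold Rdiv. rewrite Rmult_0_l, Rmult_0_r, cos_0. auto. }
      apply cos_eq_congr in E; [|unfold Q; lia]. rewrite Z.sub_0_r, Z.add_0_r in E.
      assert (E' : (Q | p)%Z) by tauto. apply Z.divide_pos_le in E'; [|lia].
      pose proof (Z.div_lt Q 2 ltac:(lia) ltac:(lia)). lia.
    - exists (nth c (lens_ps q b') 0%Z). split; [apply nth_In; auto|].
      apply cos_eq_congr in H1; [exact H1|unfold Q; lia]. }
  set (t := Z.of_nat t0) in *.
  assert (Htu : rel_prime t Q).
  { destruct (lens_ps_consecutive q b Hq Hb) as [c [Hc1 Hc2]].
    constructor; try apply Z.divide_1_l. intros z Hz1 Hz2.
    assert (Hz : forall p, In p (lens_ps q b) -> (z | p)%Z).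
    { intros p Hp. destruct (HC p Hp) as [p' [_ [H|H]]].
      - replace p with (t * p' - (t * p' - p))%Z by lia.
        apply Z.divide_sub_r; [apply Z.divide_mul_l; auto|eapply Z.divide_trans; eauto].
      - replace p with ((t * p' + p) - t * p')%Z by lia.
        apply Z.divide_sub_r; [eapply Z.divide_trans; eauto|apply Z.divide_mul_l; auto]. }
    replace 1%Z with (c + 1 - c)%Z by lia. apply Z.divide_sub_r; auto. }
  destruct (fold_mod_spec Q t ltac:(lia)) as [Hr Hrt]. set (r := fold_mod Q t) in *.
  change (congr_pm Q t r) in Hrt.
  assert (Hr1 : (1 <= r)%Z).
  { destruct (Z.eq_dec r 0) as [E|]; [|lia]. exfalso.
    assert (HQ : rel_prime 0 Q) by (rewrite <- E; eapply rel_prime_congr_pm; eauto).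
    destruct HQ as [_ _ HQ]. specialize (HQ Q (Z.divide_0_r Q) (Z.divide_refl Q)).
    apply Z.divide_pos_le in HQ; lia. }
  (* If [r], congruent to [t] up to sign, were a weight of the first space, it would come from the
     weight 1 of the second one, which is missing. *)
  assert (Hr' : ~ In r (lens_ps q b)).
  { intros Hin. destruct (HC r Hin) as [p' [Hp' Hc]].
    assert (E : p' = 1%Z).
    { apply (congr_pm_range Q); try (apply lens_ps_in in Hp'; auto; fold Q in Hp'; lia).
      apply (congr_pm_cancel Q t); auto. rewrite Z.mul_1_r.
      eapply congr_pm_trans; [exact Hc|apply congr_pm_sym; auto]. }
    apply lens_ps_in in Hp'; auto. lia. }
  assert (Hrb : r = 1%Z \/ r = Z.of_nat b).
  { destruct (Z.eq_dec r 1); auto. destruct (Z.eq_dec r (Z.of_nat b)); auto.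
    exfalso. apply Hr'. apply lens_ps_in; auto. fold Q. lia. }
  destruct Hrb as [Er|Er].
  - rewrite Er in Hrt.
    assert (Hin : In (Z.of_nat b') (lens_ps q b)) by (apply lens_ps_in; auto; fold Q; lia).
    destruct (HC _ Hin) as [p' [Hp' Hc]].
    assert (E : p' = Z.of_nat b').
    { apply (congr_pm_range Q); try (apply lens_ps_in in Hp'; auto; fold Q in Hp'; lia).
      eapply congr_pm_trans; [|exact Hc]. rewrite <- (Z.mul_1_r p') at 1.
      rewrite (Z.mul_comm t). apply congr_pm_mul, congr_pm_sym. auto. }
    apply lens_ps_in in Hp'; auto. lia.
  - apply Hnu. rewrite <- Er. eapply rel_prime_congr_pm; eauto.
Qed.

Lemma lbexps_lens_ps (q b b' W k : nat) (u : Z) : (10 <= q)%nat ->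
  (2 <= b <= q / 2)%nat -> (2 <= b' <= q / 2)%nat -> rel_prime u (Z.of_nat q) ->
  (Z.of_nat q | Z.of_nat b' - u * Z.of_nat b)%Z ->
  rel_prime (1 + Z.of_nat b) (Z.of_nat q) -> rel_prime (1 - Z.of_nat b) (Z.of_nat q) ->
  rel_prime (1 + Z.of_nat b') (Z.of_nat q) -> rel_prime (1 - Z.of_nat b') (Z.of_nat q) ->
  length (lbexps (Lens q (lens_ps q b) W) k) = length (lbexps (Lens q (lens_ps q b') W) k).
Proof.
  intros Hq Hb Hb' Hu Hbb H1 H2 H3 H4.
  assert (H5 : (5 <= q / 2)%nat) by (apply Nat.div_le_lower_bound; lia).
  assert (HE : forall j, length (exps (Z.of_nat q) (weights (lens_ps q b) W) j) =
    length (exps (Z.of_nat q) (weights (lens_ps q b') W) j)).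
  { intros j. rewrite !exps_length. apply (exps_lens_ps q W b b' u); auto. }
  assert (Hlen := lens_ps_length q b Hb). assert (Hlen' := lens_ps_length q b' Hb').
  unfold lbexps. cbn [lq lps lW].
  destruct (lens_ps q b) as [|w ws]; [cbn [length] in Hlen; lia|].
  destruct (lens_ps q b') as [|w' ws']; [cbn [length] in Hlen'; lia|].
  unfold weights in *. cbn [flat_map app] in *. rewrite !bexps_length, HE.
  destruct k as [|[|k]]; auto.
Qed.

Lemma mult_ge_transfer (L1 L2 : lens) : lens_wf L1 -> lens_wf L2 -> (4 <= lamb L1)%nat ->
  lamb L1 = lamb L2 -> (forall k, length (lbexps L1 k) = length (lbexps L2 k)) ->
  forall lam m, mult_ge L1 lam m -> mult_ge L2 lam m.
Proof.
  intros H1 H2 H4 Hd HL lam m Hm.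
  destruct (mult_ge_le_bexps L1 lam m H1 H4 Hm) as [->|[k [-> Hk]]].
  - exists (fun _ _ => 0). split; intros; lia.
  - rewrite Hd. apply mult_ge_bexps; auto. rewrite <- HL. auto.
Qed.

(** [B] is any integer in the class of [b] up to sign, so the applications may take it from a Bezout
    relation. The conditions on [(u - 1) * B] and [(u + 1) * B] say that [u * B] is neither [B] nor
    [- B] modulo [q]. *)
Theorem lens_pair (q W : nat) (B u : Z) : (10 <= q)%nat ->
  rel_prime u (Z.of_nat q) -> ~ rel_prime B (Z.of_nat q) -> ~ (Z.of_nat q | B)%Z ->
  ~ (Z.of_nat q | (u - 1) * B)%Z -> ~ (Z.of_nat q | (u + 1) * B)%Z ->
  rel_prime (1 + B) (Z.of_nat q) -> rel_prime (1 - B) (Z.of_nat q) ->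
  rel_prime (1 + u * B) (Z.of_nat q) -> rel_prime (1 - u * B) (Z.of_nat q) ->
  exists L1 L2, iso_noniso_pair q (2 * (q / 2 - 2) + W - 1) L1 L2.
Proof.
  intros Hq Hu HB HqB Hm1 Hp1 HBp HBm HuBp HuBm. set (Q := Z.of_nat q) in *.
  assert (H5 : (5 <= q / 2)%nat) by (apply Nat.div_le_lower_bound; lia).
  assert (Hh : Z.of_nat (q / 2) = (Q / 2)%Z) by (unfold Q; rewrite Nat2Z.inj_div; auto).
  assert (HuB : ~ rel_prime (u * B) Q).
  { intros [_ _ H]. apply HB. constructor; try apply Z.divide_1_l.
    intros z Hz1 Hz2. apply H; auto. apply Z.divide_mul_r; auto. }
  assert (HquB : ~ (Q | u * B)%Z).
  { intros H. apply HqB. apply (Gauss Q u); auto. apply rel_prime_sym; auto. }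
  assert (Hfold : forall x, ~ rel_prime x Q -> ~ (Q | x)%Z ->
    exists c, (2 <= c <= q / 2)%nat /\ congr_pm Q x (Z.of_nat c)).
  { intros x Hx HQx. destruct (fold_mod_spec Q x ltac:(lia)) as [H1 H2].
    change (congr_pm Q x (fold_mod Q x)) in H2.
    exists (Z.to_nat (fold_mod Q x)). rewrite Z2Nat.id by lia. split; auto.
    assert (fold_mod Q x <> 0%Z).
    { intros E. rewrite E in H2. apply HQx. unfold congr_pm in H2.
      rewrite Z.sub_0_r, Z.add_0_r in H2. tauto. }
    assert (fold_mod Q x <> 1%Z).
    { intros E. rewrite E in H2. apply Hx. apply (rel_prime_congr_pm Q 1).
      - apply congr_pm_sym; auto.
      - apply rel_prime_1. }
    lia. }
  destruct (Hfold B HB HqB) as [b [Hb Hbc]]. destruct (Hfold _ HuB HquB) as [b' [Hb' Hbc']].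
  assert (Hpm : forall x c, congr_pm Q x (Z.of_nat c) -> rel_prime (1 + x) Q -> rel_prime (1 - x) Q ->
    rel_prime (1 + Z.of_nat c) Q /\ rel_prime (1 - Z.of_nat c) Q).
  { intros x c [[m H]|[m H]] Hx1 Hx2; split.
    - apply (rel_prime_congr Q (1 + x)); auto. exists m. lia.
    - apply (rel_prime_congr Q (1 - x)); auto. exists (- m)%Z. lia.
    - apply (rel_prime_congr Q (1 - x)); auto. exists (- m)%Z. lia.
    - apply (rel_prime_congr Q (1 + x)); auto. exists m. lia. }
  destruct (Hpm B b Hbc HBp HBm) as [Hb1 Hb2]. destruct (Hpm _ b' Hbc' HuBp HuBm) as [Hb1' Hb2'].
  assert (Hne : b <> b').
  { intros <-. pose proof (congr_pm_trans _ _ _ _ Hbc' (congr_pm_sym _ _ _ Hbc)) as [H|H].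
    - apply Hm1. replace ((u - 1) * B)%Z with (u * B - B)%Z by lia. auto.
    - apply Hp1. replace ((u + 1) * B)%Z with (u * B + B)%Z by lia. auto. }
  assert (Hbu : ~ rel_prime (Z.of_nat b) Q).
  { intros H. apply HB. apply (rel_prime_congr_pm Q (Z.of_nat b)); auto. apply congr_pm_sym; auto. }
  assert (Hub : exists v, rel_prime v Q /\ (Q | Z.of_nat b' - v * Z.of_nat b)%Z).
  { assert (H : congr_pm Q (Z.of_nat b') (u * Z.of_nat b)).
    { eapply congr_pm_trans; [apply congr_pm_sym; exact Hbc'|apply congr_pm_mul; auto]. }
    destruct H as [H|H]; [exists u; auto|]. exists (- u)%Z. split; [apply rel_prime_opp; auto|].
    replace (Z.of_nat b' - - u * Z.of_nat b)%Z with (Z.of_nat b' + u * Z.of_nat b)%Z by lia. auto. }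
  destruct Hub as [v [Hv Hvb]].
  set (L1 := Lens q (lens_ps q b) W). set (L2 := Lens q (lens_ps q b') W).
  assert (W1 : lens_wf L1) by (apply lens_ps_wf; auto).
  assert (W2 : lens_wf L2) by (apply lens_ps_wf; auto).
  assert (D1 : lamb L1 = (2 * (q / 2 - 2) + W)%nat)
    by (unfold lamb, ln, L1; cbn [lps lW]; rewrite lens_ps_length; auto).
  assert (D2 : lamb L2 = (2 * (q / 2 - 2) + W)%nat)
    by (unfold lamb, ln, L2; cbn [lps lW]; rewrite lens_ps_length; auto).
  assert (HL : forall k, length (lbexps L1 k) = length (lbexps L2 k))
    by (intros k; apply (lbexps_lens_ps q b b' W k v); auto).
  exists L1, L2. repeat split; try apply W1; try apply W2.
  - unfold ldim. rewrite D1. auto.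
  - unfold ldim. rewrite D2. auto.
  - apply mult_ge_transfer; auto; lia.
  - apply mult_ge_transfer; auto; lia.
  - apply lens_ps_not_isometric; auto.
Qed.

(** * The four families of orders *)

Lemma rel_prime_of_bezout (a b x y : Z) : (x * a + y * b = 1)%Z -> rel_prime a b.
Proof. intros H. apply bezout_rel_prime. exists x y. auto. Qed.

Lemma prime_rel_prime_small (p a : Z) : prime p -> (0 < a < p)%Z -> rel_prime a p.
Proof.
  intros Hp Ha. apply rel_prime_sym, prime_rel_prime; auto.
  intros H. apply Z.divide_pos_le in H; lia.
Qed.

Lemma not_rel_prime_divisor (d a b : Z) : (2 <= d)%Z -> (d | a)%Z -> (d | b)%Z -> ~ rel_prime a b.
Proof. intros Hd Ha Hb [_ _ H]. specialize (H d Ha Hb). apply Z.divide_pos_le in H; lia. Qed.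

Lemma half_odd (q : nat) : Nat.odd q = true -> q = (2 * (q / 2) + 1)%nat.
Proof.
  intros H. apply Nat.odd_spec in H. destruct H as [m ->]. f_equal. f_equal.
  rewrite Nat.mul_comm, Nat.div_add_l by lia. simpl. lia.
Qed.

(** With [q = P * r], the condition that [3 * P] is not a multiple of [q] holds because [r >= 5];
    for [P = 3] and [m = 2] one would have [r = 3] and [u * B] congruent to [- B]. *)
Lemma pair_prime_power (W P m : nat) : prime (Z.of_nat P) -> Nat.odd P = true ->
  ((5 <= P /\ 2 <= m)%nat \/ (3 <= P /\ 3 <= m)%nat) ->
  exists L1 L2, iso_noniso_pair (P ^ m) (P ^ m + W - 6) L1 L2.
Proof.
  intros HP Hodd Hm. assert (HP2 := prime_ge_2 _ HP).
  assert (Hodd' : Nat.odd (P ^ m) = true) by (rewrite Nat.odd_pow; [auto|lia]).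
  destruct m as [|[|m]]; try lia. set (r := (P ^ S m)%nat).
  assert (Hr : (5 <= r)%nat).
  { unfold r. cbn [Nat.pow]. assert (1 <= P ^ m)%nat by (apply Nat.neq_0_lt_0, Nat.pow_nonzero; lia).
    destruct Hm as [Hm|Hm]; [nia|]. destruct m as [|m]; [lia|]. cbn [Nat.pow].
    assert (1 <= P ^ m)%nat by (apply Nat.neq_0_lt_0, Nat.pow_nonzero; lia). nia. }
  assert (Hq : (P ^ S (S m) = P * r)%nat) by reflexivity.
  assert (HqZ : Z.of_nat (P ^ S (S m)) = (Z.of_nat P ^ Z.of_nat (S (S m)))%Z) by apply Nat2Z.inj_pow.
  assert (HqZ' : Z.of_nat (P ^ S (S m)) = (Z.of_nat P * Z.of_nat r)%Z) by (rewrite Hq; lia).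
  assert (Hrel : forall a, rel_prime a (Z.of_nat P) -> rel_prime a (Z.of_nat (P ^ S (S m)))).
  { intros a Ha. rewrite HqZ. apply rel_prime_Zpower_r; auto. lia. }
  assert (HoddP := half_odd P Hodd).
  replace (P ^ S (S m) + W - 6)%nat with (2 * (P ^ S (S m) / 2 - 2) + W - 1)%nat.
  2:{ pose proof (half_odd _ Hodd'). lia. }
  assert (Hdiv : forall x, (0 < x < Z.of_nat r)%Z -> ~ (Z.of_nat (P ^ S (S m)) | x * Z.of_nat P)%Z).
  { intros x Hx H. apply Z.divide_pos_le in H; [|nia]. rewrite HqZ' in H. nia. }
  apply (lens_pair _ W (Z.of_nat P) 2); try apply Hrel.
  - rewrite Hq. nia.
  - apply (rel_prime_of_bezout _ _ (- Z.of_nat (P / 2)) 1). lia.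
  - apply (not_rel_prime_divisor (Z.of_nat P)); try lia; [apply Z.divide_refl|].
    rewrite HqZ'. apply Z.divide_factor_l.
  - intros H. apply (Hdiv 1%Z); [lia|]. rewrite Z.mul_1_l. auto.
  - apply Hdiv. lia.
  - apply Hdiv. lia.
  - apply (rel_prime_of_bezout _ _ 1 (-1)). lia.
  - apply (rel_prime_of_bezout _ _ 1 1). lia.
  - apply (rel_prime_of_bezout _ _ 1 (-2)). lia.
  - apply (rel_prime_of_bezout _ _ 1 2). lia.
Qed.

(** Modulo [P1] the numbers [1 + B], [1 - B], [1 + 2 B], [1 - 2 B] are 1. Modulo [P2] they are 3,
    -1, 5, -3, while [B] and [3 B] are 2 and 6; none of these vanishes since [q >= 33] forces
    [P2 >= 7]. *)
Lemma pair_two_primes_lt (W P1 P2 : nat) : prime (Z.of_nat P1) -> prime (Z.of_nat P2) ->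
  Nat.odd P1 = true -> Nat.odd P2 = true -> (P1 < P2)%nat -> (33 <= P1 * P2)%nat ->
  exists L1 L2, iso_noniso_pair (P1 * P2) (P1 * P2 + W - 6) L1 L2.
Proof.
  intros H1 H2 O1 O2 Hlt Hq. assert (G1 := prime_ge_2 _ H1). assert (G2 := prime_ge_2 _ H2).
  assert (E1 := half_odd P1 O1). assert (E2 := half_odd P2 O2).
  assert (H7 : (7 <= P2)%nat) by nia.
  assert (Hodd : Nat.odd (P1 * P2) = true) by (rewrite Nat.odd_mul, O1, O2; auto).
  assert (Hrp : rel_prime (Z.of_nat P1) (Z.of_nat P2)) by (apply prime_rel_prime_small; auto; lia).
  apply rel_prime_bezout in Hrp. destruct Hrp as [x y Hxy].
  set (B := (2 * x * Z.of_nat P1)%Z).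
  assert (HB2 : B = (2 - 2 * y * Z.of_nat P2)%Z) by (unfold B; lia).
  replace (P1 * P2 + W - 6)%nat with (2 * (P1 * P2 / 2 - 2) + W - 1)%nat.
  2:{ pose proof (half_odd _ Hodd). lia. }
  assert (Hrel : forall a m c n, rel_prime a (Z.of_nat P1) -> (0 < c < 7)%Z ->
    (a = c + n * Z.of_nat P2 \/ a = - c + n * Z.of_nat P2)%Z -> m = Z.of_nat (P1 * P2) -> rel_prime a m).
  { intros a m c n Ha Hc Hac ->. rewrite Nat2Z.inj_mul. apply rel_prime_mult; auto.
    apply (rel_prime_congr_pm _ c); [|apply prime_rel_prime_small; auto; lia].
    destruct Hac as [->| ->]; [left; exists (- n)%Z|right; exists n]; lia. }
  assert (Hdiv : forall c, (0 < c < 7)%Z -> forall n m, (m = c + n * Z.of_nat P2)%Z ->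
    ~ (Z.of_nat (P1 * P2) | m)%Z).
  { intros c Hc n m -> H. assert (HP2 : (Z.of_nat P2 | c)%Z).
    { replace c with (c + n * Z.of_nat P2 - n * Z.of_nat P2)%Z by lia.
      apply Z.divide_sub_r; [|apply Z.divide_factor_r].
      eapply Z.divide_trans; [|exact H]. rewrite Nat2Z.inj_mul. apply Z.divide_factor_r. }
    apply Z.divide_pos_le in HP2; lia. }
  apply (lens_pair _ W B 2).
  - lia.
  - apply (rel_prime_of_bezout _ _ (- Z.of_nat (P1 * P2 / 2)) 1).
    pose proof (half_odd _ Hodd). lia.
  - apply (not_rel_prime_divisor (Z.of_nat P1)); [lia|apply Z.divide_factor_r|].
    rewrite Nat2Z.inj_mul. apply Z.divide_factor_l.
  - apply (Hdiv 2%Z ltac:(lia) (-2 * y)%Z). lia.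
  - apply (Hdiv 2%Z ltac:(lia) (-2 * y)%Z). lia.
  - apply (Hdiv 6%Z ltac:(lia) (-6 * y)%Z). lia.
  - apply (Hrel _ _ 3%Z (-2 * y)%Z); auto; try lia.
    apply (rel_prime_of_bezout _ _ 1 (-2 * x)). unfold B. lia.
  - apply (Hrel _ _ 1%Z (2 * y)%Z); auto; try lia.
    apply (rel_prime_of_bezout _ _ 1 (2 * x)). unfold B. lia.
  - apply (Hrel _ _ 5%Z (-4 * y)%Z); auto; try lia.
    apply (rel_prime_of_bezout _ _ 1 (-4 * x)). unfold B. lia.
  - apply (Hrel _ _ 3%Z (4 * y)%Z); auto; try lia.
    apply (rel_prime_of_bezout _ _ 1 (4 * x)). unfold B. lia.
Qed.

Lemma pair_power_of_two (W m : nat) : (6 <= m)%nat ->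
  exists L1 L2, iso_noniso_pair (2 ^ m) (2 ^ m + W - 5) L1 L2.
Proof.
  intros Hm. assert (Hpow : (2 ^ m = 64 * 2 ^ (m - 6))%nat).
  { replace m with (6 + (m - 6))%nat at 1 by lia. rewrite Nat.pow_add_r. auto. }
  assert (Hpos : (1 <= 2 ^ (m - 6))%nat) by (apply Nat.neq_0_lt_0, Nat.pow_nonzero; lia).
  assert (Hhalf : (2 ^ m / 2 = 32 * 2 ^ (m - 6))%nat).
  { rewrite Hpow. replace (64 * 2 ^ (m - 6))%nat with (32 * 2 ^ (m - 6) * 2)%nat by lia.
    apply Nat.div_mul. lia. }
  assert (Hrel : forall a k, (a = 2 * k + 1)%Z -> rel_prime a (Z.of_nat (2 ^ m))).
  { intros a k ->. rewrite Nat2Z.inj_pow. apply rel_prime_Zpower_r; [lia|].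
    apply (rel_prime_of_bezout _ _ 1 (- k)). lia. }
  replace (2 ^ m + W - 5)%nat with (2 * (2 ^ m / 2 - 2) + W - 1)%nat by lia.
  apply (lens_pair _ W 2 3).
  - lia.
  - apply (Hrel _ 1%Z). lia.
  - apply (not_rel_prime_divisor 2); [lia|apply Z.divide_refl|]. exists (32 * Z.of_nat (2 ^ (m - 6)))%Z. lia.
  - intros H. apply Z.divide_pos_le in H; lia.
  - intros H. apply Z.divide_pos_le in H; lia.
  - intros H. apply Z.divide_pos_le in H; lia.
  - apply (Hrel _ 1%Z). lia.
  - apply (Hrel _ (-1)%Z). lia.
  - apply (Hrel _ 3%Z). lia.
  - apply (Hrel _ (-3)%Z). lia.
Qed.

(** Modulo [P] the unit acts as 2, which leads to the same residues 3, -1, 5, -3 as for two odd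
    primes; [P] is added to make it odd. *)
Lemma pair_twice_prime (W P : nat) : prime (Z.of_nat P) -> Nat.odd P = true -> (7 <= P)%nat ->
  exists L1 L2, iso_noniso_pair (2 * P) (2 * P + W - 5) L1 L2.
Proof.
  intros HP Hodd H7. assert (E := half_odd P Hodd).
  assert (Hhalf : (2 * P / 2 = P)%nat) by (rewrite Nat.mul_comm; apply Nat.div_mul; lia).
  assert (Hrel : forall a k c n, (a = 2 * k + 1)%Z -> (0 < c < 7)%Z ->
    (a = c + n * Z.of_nat P \/ a = - c + n * Z.of_nat P)%Z -> rel_prime a (Z.of_nat (2 * P))).
  { intros a k c n Hk Hc Hac. rewrite Nat2Z.inj_mul. apply rel_prime_mult.
    - apply (rel_prime_of_bezout _ _ 1 (- k)). lia.
    - apply (rel_prime_congr_pm _ c); [|apply prime_rel_prime_small; auto; lia].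
      destruct Hac as [->| ->]; [left; exists (- n)%Z|right; exists n]; lia. }
  assert (Hdiv : forall c n, (0 < c < 7)%Z -> ~ (Z.of_nat (2 * P) | 2 * (c + n * Z.of_nat P))%Z).
  { intros c n Hc [z Hz]. assert (HPc : (Z.of_nat P | c)%Z) by (exists (z - n)%Z; lia).
    apply Z.divide_pos_le in HPc; lia. }
  replace (2 * P + W - 5)%nat with (2 * (2 * P / 2 - 2) + W - 1)%nat by lia.
  apply (lens_pair _ W 2 (Z.of_nat P + 2)).
  - lia.
  - apply (Hrel _ (Z.of_nat (P / 2) + 1)%Z 2%Z 1%Z); lia.
  - apply (not_rel_prime_divisor 2); [lia|apply Z.divide_refl|]. exists (Z.of_nat P). lia.
  - intros H. apply Z.divide_pos_le in H; lia.
  - intros H. apply (Hdiv 1%Z 1%Z); [lia|].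
    replace (2 * (1 + 1 * Z.of_nat P))%Z with ((Z.of_nat P + 2 - 1) * 2)%Z by lia. auto.
  - intros H. apply (Hdiv 3%Z 1%Z); [lia|].
    replace (2 * (3 + 1 * Z.of_nat P))%Z with ((Z.of_nat P + 2 + 1) * 2)%Z by lia. auto.
  - apply (Hrel _ 1%Z 3%Z 0%Z); lia.
  - apply (Hrel _ (-1)%Z 1%Z 0%Z); lia.
  - apply (Hrel _ (Z.of_nat P + 2)%Z 5%Z 2%Z); lia.
  - apply (Hrel _ (- Z.of_nat P - 2)%Z 3%Z (-2)%Z); lia.
Qed.

Theorem theorem3p2p5 (W : nat) :
  (forall P m : nat,
     prime (Z.of_nat P) -> Nat.odd P = true -> (1 <= m)%nat ->
     ((5 <= P /\ 2 <= m)%nat \/ (3 <= P /\ 3 <= m)%nat) ->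
     exists L1 L2, iso_noniso_pair (P ^ m) (P ^ m + W - 6) L1 L2) /\
  (forall P1 P2 : nat,
     prime (Z.of_nat P1) -> prime (Z.of_nat P2) ->
     Nat.odd P1 = true -> Nat.odd P2 = true -> P1 <> P2 ->
     (33 <= P1 * P2)%nat ->
     exists L1 L2, iso_noniso_pair (P1 * P2) (P1 * P2 + W - 6) L1 L2) /\
  (forall m : nat, (6 <= m)%nat ->
     exists L1 L2, iso_noniso_pair (2 ^ m) (2 ^ m + W - 5) L1 L2) /\
  (forall P : nat,
     prime (Z.of_nat P) -> Nat.odd P = true -> (7 <= P)%nat ->
     exists L1 L2, iso_noniso_pair (2 * P) (2 * P + W - 5) L1 L2).
Proof.
  split; [|split; [|split]].
  - intros P m HP Hodd _ Hm. apply pair_prime_power; auto.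
  - intros P1 P2 H1 H2 O1 O2 Hne Hq. destruct (Nat.lt_gt_cases P1 P2) as [Hc _].
    destruct (Hc Hne) as [Hlt|Hlt]; [apply pair_two_primes_lt; auto|].
    rewrite Nat.mul_comm. apply pair_two_primes_lt; auto. lia.
  - apply pair_power_of_two.
  - apply pair_twice_prime.
Qed.
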